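(* Consider the finite-sum bilevel problem, with $f=\frac1n\sum_{i=1}^nF_i$ and $g=\frac1m\sum_{j=1}^mG_j$. Assume: (i) $\nabla f$ is $L^f$-Lipschitz in $(x,y)$ and $\|\nabla_2 f(x,y^*(x))\|\le C^f$ for all $x$; (ii) $\nabla g$ and $\nabla^2 g$ are $L_1^g$- and $L_2^g$-Lipschitz in $(x,y)$, and $g(x,\cdot)$ is $\mu$-strongly convex for every $x$; (iii) for all $i\in[n]$, $j\in[m]$, the maps $\nabla F_i$, $\nabla G_j$, $\nabla^2G_j$ are respectively $L^f$-, $L_1^g$-, $L_2^g$-Lipschitz in $(x,y)$; (iv) $H$ is bounded below. Take $p=\frac{b}{n+m+b}$ and $b\le\sqrt{n+m}$, and step sizes $\alpha_k=c/(1+\sqrt{(1-p)/(pb)})$, $\beta_k=c_\beta\alpha_k$, $\gamma_k=c_\gamma\alpha_k$ for suitable positive constants $c,c_\beta,c_\gamma$. Then the sample complexity of SPABA (finite-sum version) for reaching an $\epsilon$-stationary point is $\mathcal O\left((n+m)^{1/2}\epsilon^{-1}\right)$: there is a number of iterations $K$ for which $\frac1K\sum_{k=0}^{K-1}\mathbb E\|\nabla H(x_k)\|^2\le\epsilon$ while the expected total number of sampled stochastic gradients and Hessian/Jacobian-vector products in these $K$ iterations is $\mathcal O((n+m)^{1/2}\epsilon^{-1})$.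
   Context: Bilevel problem: minimize $H(x)=f(x,y^*(x))$ over $x\in\mathbb{R}^{d_x}$, where $y^*(x)=\arg\min_{y\in\mathbb{R}^{d_y}}g(x,y)$ and $f,g$ are smooth real-valued functions on $\mathbb{R}^{d_x}\times\mathbb{R}^{d_y}$. $\nabla_1,\nabla_2$ are the partial gradients in $x$ and $y$; $\nabla_{12}^2 g$ ($d_x\times d_y$) and $\nabla_{22}^2g$ ($d_y\times d_y$) are blocks of the Hessian. Put $z^*(x)=[\nabla_{22}^2g(x,y^*(x))]^{-1}\nabla_2f(x,y^*(x))$ and $$D_x(x,y,z)=\nabla_1f(x,y)-\nabla_{12}^2g(x,y)z,\quad D_y(x,y,z)=\nabla_2g(x,y),\quad D_z(x,y,z)=\nabla_{22}^2g(x,y)z-\nabla_2f(x,y).$$ Let $R=C^f/\mu$ and let $\mathrm{Proj}_{\mathbb B(R)}$ be the Euclidean projection onto the closed ball of radius $R$ centered at $0$ in $\mathbb R^{d_y}$. An $\epsilon$-stationary point is a (random) $\bar x$ with $\mathbb E\|\nabla H(\bar x)\|^2\le\epsilon$; $\epsilon\in(0,1]$. SPABA (finite-sum version). At iteration $k$, sample a minibatch $I$ of $b$ independent uniform indices from $[n]$ and, independently, a minibatch $J$ of $b$ independent uniform indices from $[m]$ (independent of the past). Write $u_k=(x_k,y_k,z_k)$, and for $\bullet\in\{x,y,z\}$ let $\widehat D_\bullet(u;I,J)$ be the minibatch estimator of $D_\bullet(u)$ obtained by replacing $f$ by $\frac1b\sum_{i\in I}F_i$ and $g$ by $\frac1b\sum_{j\in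 J}G_j$ in the definition of $D_\bullet$. For each $\bullet\in\{x,y,z\}$, with a coin independent of the past and of the minibatches, $$v_k^\bullet=\begin{cases}D_\bullet(u_k)&\text{with probability }p,\\ v_{k-1}^\bullet+\widehat D_\bullet(u_k;I,J)-\widehat D_\bullet(u_{k-1};I,J)&\text{with probability }1-p.\end{cases}$$ Updates: $x_{k+1}=x_k-\alpha_kv_k^x$, $y_{k+1}=y_k-\beta_kv_k^y$, $z_{k+1}=\mathrm{Proj}_{\mathbb B(R)}(z_k-\gamma_kv_k^z)$, with initial $z$-points in $\mathbb B(R)$. Sample count: up to universal constant factors, an iteration costs $n+m$ with probability $p$ and $b$ with probability $1-p$, i.e. $p(n+m)+(1-p)b$ samples in expectation. Convention: $c,c_\beta,c_\gamma$ depend only on $L^f,C^f,L_1^g,L_2^g,\mu$; the constant hidden in $\mathcal O$ depends only on these and on the initial value $H(x_0)-\inf H+\|y_0-y^*(x_0)\|^2+\|z_0-z^*(x_0)\|^2+\frac{\alpha_0}{p}\sum_{\bullet}\mathbb E\|v_0^\bullet-D_\bullet(u_0)\|^2$, not otherwise on $n,m,b,\epsilon$. *)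

(* Defs.v *)
From HB Require Import structures.
From mathcomp Require Export all_boot all_order all_algebra.
From mathcomp Require Export all_classical all_reals all_analysis.
Export Order.TTheory GRing.Theory Num.Theory.
Export numFieldNormedType.Exports.

#[export] Set Implicit Arguments.
#[export] Unset Strict Implicit.
#[export] Unset Printing Implicit Defensive.

Local Open Scope classical_set_scope.
Local Open Scope ring_scope.

(* Vectors of R^d are columns 'cV[R]_d.  The library norm `|v| on matrices is
   the max norm, so Euclidean and operator norms are defined here. *)

Definition enorm {R : realType} {d : nat} (v : 'cV[R]_d) : R :=
  Num.sqrt (\sum_(i < d) v i ord0 ^+ 2).

Definition opnorm {R : realType} {d e : nat} (A : 'M[R]_(d, e)) : R :=
  sup [set enorm (A *m v) | v in [set v : 'cV[R]_e | enorm v <= 1]].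

Definition pderive {R : realType} {d : nat} (i : 'I_d) (h : 'cV[R]_d -> R)
    (u : 'cV[R]_d) : R :=
  'D_(delta_mx i ord0) h u.

Definition grad {R : realType} {d : nat} (h : 'cV[R]_d -> R) (u : 'cV[R]_d) :
    'cV[R]_d :=
  \col_i pderive i h u.

Definition hess {R : realType} {d : nat} (h : 'cV[R]_d -> R) (u : 'cV[R]_d) :
    'M[R]_d :=
  \matrix_(i, j) pderive i (pderive j h) u.

Definition lipschitz_grad {R : realType} {d : nat} (L : R) (h : 'cV[R]_d -> R) :
    Prop :=
  (forall u, differentiable h u) /\
  (forall u v, enorm (grad h u - grad h v) <= L * enorm (u - v)).

Definition lipschitz_hess {R : realType} {d : nat} (L : R) (h : 'cV[R]_d -> R) :
    Prop :=
  (forall i u, differentiable (pderive i h) u) /\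
  (forall u v, opnorm (hess h u - hess h v) <= L * enorm (u - v)).

Definition strongly_convex {R : realType} {d : nat} (mu : R)
    (h : 'cV[R]_d -> R) : Prop :=
  forall (y y' : 'cV[R]_d) (t : R), 0 <= t <= 1 ->
    h (t *: y + (1 - t) *: y') <=
      t * h y + (1 - t) * h y' - mu / 2 * t * (1 - t) * enorm (y - y') ^+ 2.

(* Junk value 0 if no minimizer exists. *)
Definition argmin {R : realType} {d : nat} (A : set 'cV[R]_d)
    (h : 'cV[R]_d -> R) : 'cV[R]_d :=
  xget 0 [set y | A y /\ forall y', A y' -> h y <= h y'].

Definition proj_ball {R : realType} {d : nat} (r : R) (z : 'cV[R]_d) :
    'cV[R]_d :=
  argmin [set w | enorm w <= r] (fun w => enorm (z - w)).

Definition avg {R : realType} {V : Type} {N : nat} (h : 'I_N -> V -> R) (u : V) :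
    R :=
  N%:R^-1 * \sum_(i < N) h i u.

(* A function of (x, y) in R^dx * R^dy is a function on 'cV[R]_(dx + dy),
   evaluated at col_mx x y; gradients and Hessians split into blocks. *)
Section bilevel.
Context {R : realType} {dx dy : nat}.
Implicit Types (f g : 'cV[R]_(dx + dy) -> R) (x : 'cV[R]_dx) (y z : 'cV[R]_dy).

Definition grad1 f x y : 'cV[R]_dx := usubmx (grad f (col_mx x y)).
Definition grad2 f x y : 'cV[R]_dy := dsubmx (grad f (col_mx x y)).
Definition hess12 g x y : 'M[R]_(dx, dy) := ursubmx (hess g (col_mx x y)).
Definition hess22 g x y : 'M[R]_(dy, dy) := drsubmx (hess g (col_mx x y)).

Definition ystar g x : 'cV[R]_dy := argmin setT (fun y => g (col_mx x y)).

Definition zstar f g x : 'cV[R]_dy :=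
  invmx (hess22 g x (ystar g x)) *m grad2 f x (ystar g x).

Definition hyperobj f g x : R := f (col_mx x (ystar g x)).

Definition Dx f g x y z : 'cV[R]_dx := grad1 f x y - hess12 g x y *m z.
Definition Dy f g x y z : 'cV[R]_dy := grad2 g x y.
Definition Dz f g x y z : 'cV[R]_dy := hess22 g x y *m z - grad2 f x y.

End bilevel.

Record finite_sum_assumptions {R : realType} (Lf Cf L1g L2g mu : R)
    {dx dy n m : nat} (F : 'I_n -> 'cV[R]_(dx + dy) -> R)
    (G : 'I_m -> 'cV[R]_(dx + dy) -> R) : Prop := {
  fsa_f_grad : lipschitz_grad Lf (avg F);
  fsa_f_bound : forall x, enorm (grad2 (avg F) x (ystar (avg G) x)) <= Cf;
  fsa_g_grad : lipschitz_grad L1g (avg G);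
  fsa_g_hess : lipschitz_hess L2g (avg G);
  fsa_g_convex : forall x : 'cV[R]_dx,
    strongly_convex mu (fun y => avg G (col_mx x y));
  fsa_F_grad : forall i, lipschitz_grad Lf (F i);
  fsa_G_grad : forall j, lipschitz_grad L1g (G j);
  fsa_G_hess : forall j, lipschitz_hess L2g (G j);
  fsa_H_lbound : has_lbound (range (hyperobj (avg F) (avg G)))
}.

(* Randomness of the method.  I k w, J k w are the minibatches of iteration k
   and cx k w, cy k w, cz k w the coins of the three estimators (true = full
   evaluation).  Only the joint law of the three coins of one iteration is left
   free, so they may be one shared coin or three independent ones.
   past k is a sigma-algebra of events known after iteration k; iteration 0
   only has to be known in past 0, since the starting estimators may depend on
   it. *)
Record spaba_sampling {R : realType} {d : measure_display}
    {T : measurableType d} (P : probability T R) (p : R) {n m b : nat}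
    (I : nat -> T -> 'I_b -> 'I_n) (J : nat -> T -> 'I_b -> 'I_m)
    (cx cy cz : nat -> T -> bool) (past : nat -> set (set T)) : Prop := {
  ss_past_sigma : forall k, sigma_algebra setT (past k);
  ss_past_measurable : forall k, past k `<=` measurable;
  ss_past_mono : forall k, past k `<=` past k.+1;
  ss_I_past : forall k l i, past k [set w | I k w l = i];
  ss_J_past : forall k l j, past k [set w | J k w l = j];
  ss_cx_past : forall k, past k [set w | cx k w];
  ss_cy_past : forall k, past k [set w | cy k w];
  ss_cz_past : forall k, past k [set w | cz k w];
  ss_I_unif : forall k l i, P [set w | I k w l = i] = (n%:R^-1)%:E;
  ss_J_unif : forall k l j, P [set w | J k w l = j] = (m%:R^-1)%:E;
  ss_cx_law : forall k, P [set w | cx k w] = p%:E;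
  ss_cy_law : forall k, P [set w | cy k w] = p%:E;
  ss_cz_law : forall k, P [set w | cz k w] = p%:E;
  ss_indep : forall k (A : set T) (i : 'I_b -> 'I_n) (j : 'I_b -> 'I_m)
      (s : bool * bool * bool), past k A ->
    P (A `&` [set w | forall l, I k.+1 w l = i l]
         `&` [set w | forall l, J k.+1 w l = j l]
         `&` [set w | (cx k.+1 w, cy k.+1 w, cz k.+1 w) = s]) =
    (P A * (\big[*%E/1]_(l < b) P [set w | I k.+1 w l = i l])
         * (\big[*%E/1]_(l < b) P [set w | J k.+1 w l = j l])
         * P [set w | (cx k.+1 w, cy k.+1 w, cz k.+1 w) = s])%E
}.

(* One update of the estimator of an operator D among Dx, Dy, Dz, where
   D f g u evaluates it for the pair of functions (f, g): unew and uold are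
   u_(k+1) and u_k, v is v_k, and the minibatch version of D is D evaluated at
   the minibatch averages. *)
Definition page_step {R : realType} {d e n m b : nat} {U : Type}
    (D : ('cV[R]_d -> R) -> ('cV[R]_d -> R) -> U -> 'cV[R]_e)
    (F : 'I_n -> 'cV[R]_d -> R) (G : 'I_m -> 'cV[R]_d -> R)
    (coin : bool) (I : 'I_b -> 'I_n) (J : 'I_b -> 'I_m)
    (unew uold : U) (v : 'cV[R]_e) : 'cV[R]_e :=
  let Dhat u := D (avg (fun l => F (I l))) (avg (fun l => G (J l))) u in
  if coin then D (avg F) (avg G) unew
  else v + Dhat unew - Dhat uold.

(* The starting estimators v_0 are arbitrary random vectors known in past 0,
   for instance the result of one step from points u_(-1) and estimators
   v_(-1). *)
Record spaba_run {R : realType} {dx dy n m b : nat}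
    (F : 'I_n -> 'cV[R]_(dx + dy) -> R) (G : 'I_m -> 'cV[R]_(dx + dy) -> R)
    (r : R) (alpha beta gamma : nat -> R)
    (x0 : 'cV[R]_dx) (y0 z0 : 'cV[R]_dy) {T : Type}
    (I : nat -> T -> 'I_b -> 'I_n) (J : nat -> T -> 'I_b -> 'I_m)
    (cx cy cz : nat -> T -> bool) (past : nat -> set (set T))
    (x : nat -> T -> 'cV[R]_dx) (y z : nat -> T -> 'cV[R]_dy)
    (vx : nat -> T -> 'cV[R]_dx) (vy vz : nat -> T -> 'cV[R]_dy) : Prop := {
  sr_z0_ball : enorm z0 <= r;
  sr_x0 : forall w, x 0%N w = x0;
  sr_y0 : forall w, y 0%N w = y0;
  sr_z0 : forall w, z 0%N w = z0;
  sr_vx0 : forall i (B : set R), measurable B ->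
    past 0%N [set w | B (vx 0%N w i ord0)];
  sr_vy0 : forall i (B : set R), measurable B ->
    past 0%N [set w | B (vy 0%N w i ord0)];
  sr_vz0 : forall i (B : set R), measurable B ->
    past 0%N [set w | B (vz 0%N w i ord0)];
  sr_x : forall k w, x k.+1 w = x k w - alpha k *: vx k w;
  sr_y : forall k w, y k.+1 w = y k w - beta k *: vy k w;
  sr_z : forall k w, z k.+1 w = proj_ball r (z k w - gamma k *: vz k w);
  sr_vx : forall k w, vx k.+1 w =
    page_step (fun f g u => Dx f g u.1.1 u.1.2 u.2) F G
      (cx k.+1 w) (I k.+1 w) (J k.+1 w)
      (x k.+1 w, y k.+1 w, z k.+1 w) (x k w, y k w, z k w) (vx k w);
  sr_vy : forall k w, vy k.+1 w =
    page_step (fun f g u => Dy f g u.1.1 u.1.2 u.2) F G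
      (cy k.+1 w) (I k.+1 w) (J k.+1 w)
      (x k.+1 w, y k.+1 w, z k.+1 w) (x k w, y k w, z k w) (vy k w);
  sr_vz : forall k w, vz k.+1 w =
    page_step (fun f g u => Dz f g u.1.1 u.1.2 u.2) F G
      (cz k.+1 w) (I k.+1 w) (J k.+1 w)
      (x k.+1 w, y k.+1 w, z k.+1 w) (x k w, y k w, z k w) (vz k w)
}.

Definition initial_value {R : realType} {d : measure_display}
    {T : measurableType d} (P : probability T R) (p alpha0 : R) {dx dy : nat}
    (f g : 'cV[R]_(dx + dy) -> R) (x0 : 'cV[R]_dx) (y0 z0 : 'cV[R]_dy)
    (vx0 : T -> 'cV[R]_dx) (vy0 vz0 : T -> 'cV[R]_dy) : \bar R :=
  ((hyperobj f g x0 - inf (range (hyperobj f g))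
    + enorm (y0 - ystar g x0) ^+ 2 + enorm (z0 - zstar f g x0) ^+ 2)%:E
   + (alpha0 / p)%:E *
     ('E_P[fun w => (enorm (vx0 w - Dx f g x0 y0 z0) ^+ 2)%R]
      + 'E_P[fun w => (enorm (vy0 w - Dy f g x0 y0 z0) ^+ 2)%R]
      + 'E_P[fun w => (enorm (vz0 w - Dz f g x0 y0 z0) ^+ 2)%R]))%E.

(* Samples used up to a universal factor: in each iteration, each of the three
   estimators uses n + m of them if its coin asks for a full evaluation and b
   otherwise. *)
Definition sample_count (R : realType) {T : Type} (n m b : nat)
    (cx cy cz : nat -> T -> bool) (K : nat) (w : T) : R :=
  let cost (c : bool) := if c then (n + m)%N else b in
  (\sum_(k < K) (cost (cx k w) + cost (cy k w) + cost (cz k w)))%N%:R.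

(* Main.v *)
Require Import Defs.
From mathcomp Require Import ring lra measurable_realfun.

Local Open Scope classical_set_scope.
Local Open Scope ring_scope.

(** The proof exhibits a Lyapunov function that decreases in expectation by
    alpha/2 times the squared norm of the gradient of the hyperobjective H,
    namely

      H(x_k) - inf H + w (|y_k - ystar(x_k)|^2 + |z_k - zstar(x_k)|^2)
        + (kappa alpha / p) (squared errors of the three estimators).

    Summing over the iterations bounds the average squared gradient by a
    constant times Delta / (alpha K).

    The deterministic half rests on a quadratic expansion of H
    ([hyperobj_increment]): the optimality conditions of the lower problem at
    two points, expanded in the direction zstar, eliminate the increment of
    ystar, so H is smooth with gradient Dx(x, ystar, zstar). A step along an
    inexact gradient then decreases H up to the distances of y and z to their
    targets and the estimator error ([x_progress]); by strong convexity each of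
    these distances contracts, up to the motion of its target
    ([y_progress], [z_progress]). The iterates z stay in the ball of radius
    Cf / mu, which contains zstar; this is what makes the product of the Hessian
    with z Lipschitz. Suitable weights and step ratios make all cross terms
    absorbable ([lyapunov_real], [lyapunov_step]).

    The probabilistic half is the recursion of one estimator
    ([estimator_step]): a full evaluation, of probability p, erases the error;
    otherwise the error is kept and the centred minibatch increment adds a
    variance of order |u_{k+1} - u_k|^2 / b ([two_batch_variance]). Since
    minibatches and coins take finitely many values independently of the past,
    the conditional expectation is a finite sum ([independent_expectation]).
    The weight alpha / p turns the contraction by 1 - p into a decrease of
    order alpha times the error, and the variance into
    alpha (1 - p) / (p b) |u_{k+1} - u_k|^2; the latter is absorbed because
    alpha^2 (1 - p) / (p b) is bounded by a small constant, which is exactly the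
    choice of the step size.

    All quantities are nonnegative, so their expectations are added in the
    extended reals, where the inequality propagates from the finite initial
    value. Finally an iteration costs at most 6 b samples in expectation, and
    b / alpha <= 2 sqrt(n + m) / c when b <= sqrt(n + m), which gives the
    stated complexity ([iteration_count]). *)

(** * Euclidean geometry *)

Definition dotv {R : realType} {d : nat} (u v : 'cV[R]_d) : R :=
  \sum_(i < d) u i ord0 * v i ord0.

Section Euclid.
Context {R : realType}.

Section dot.
Context {d : nat}.
Implicit Types (u v w : 'cV[R]_d) (a : R).

Lemma dotvC u v : dotv u v = dotv v u.
Proof. by apply: eq_bigr => i _; rewrite mulrC. Qed.

Lemma dotvDl u v w : dotv (u + v) w = dotv u w + dotv v w.
Proof. by rewrite -big_split; apply: eq_bigr => i _; rewrite mxE mulrDl. Qed.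

Lemma dotvDr u v w : dotv w (u + v) = dotv w u + dotv w v.
Proof. by rewrite dotvC dotvDl !(dotvC w). Qed.

Lemma dotvZl a u v : dotv (a *: u) v = a * dotv u v.
Proof. by rewrite mulr_sumr; apply: eq_bigr => i _; rewrite mxE mulrA. Qed.

Lemma dotvZr a u v : dotv u (a *: v) = a * dotv u v.
Proof. by rewrite dotvC dotvZl dotvC. Qed.

Lemma dotvNl u v : dotv (- u) v = - dotv u v.
Proof. by rewrite -scaleN1r dotvZl mulN1r. Qed.

Lemma dotvNr u v : dotv u (- v) = - dotv u v.
Proof. by rewrite dotvC dotvNl dotvC. Qed.

Lemma dotvBl u v w : dotv (u - v) w = dotv u w - dotv v w.
Proof. by rewrite dotvDl dotvNl. Qed.

Lemma dotvBr u v w : dotv w (u - v) = dotv w u - dotv w v.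
Proof. by rewrite dotvDr dotvNr. Qed.

Lemma dot0v u : dotv 0 u = 0.
Proof. by rewrite -(scale0r (0 : 'cV[R]_d)) dotvZl mul0r. Qed.

Lemma dotv0 u : dotv u 0 = 0.
Proof. by rewrite dotvC dot0v. Qed.

Lemma dotvv_ge0 u : 0 <= dotv u u.
Proof. by apply: sumr_ge0 => i _; rewrite -expr2 sqr_ge0. Qed.

Lemma enorm_ge0 u : 0 <= enorm u.
Proof. exact: sqrtr_ge0. Qed.

Lemma enorm_sq u : enorm u ^+ 2 = dotv u u.
Proof.
rewrite sqr_sqrtr; last by apply: sumr_ge0 => i _; exact: sqr_ge0.
by apply: eq_bigr => i _; rewrite expr2.
Qed.

Lemma enorm0 : enorm (0 : 'cV[R]_d) = 0.
Proof. by apply/eqP; rewrite -sqrf_eq0 enorm_sq dot0v. Qed.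

Lemma enorm_le_sq u a : 0 <= a -> enorm u ^+ 2 <= a ^+ 2 -> enorm u <= a.
Proof. by move=> a0; rewrite ler_sqr // nnegrE ?enorm_ge0. Qed.

Lemma enormZ a u : enorm (a *: u) = `|a| * enorm u.
Proof.
apply/eqP; rewrite -(@eqrXn2 _ 2) ?mulr_ge0 ?enorm_ge0 //.
by rewrite exprMn !enorm_sq dotvZl dotvZr mulrA -expr2 real_normK ?num_real.
Qed.

Lemma enormN u : enorm (- u) = enorm u.
Proof. by rewrite -scaleN1r enormZ normrN1 mul1r. Qed.

Lemma enormB u v : enorm (u - v) = enorm (v - u).
Proof. by rewrite -enormN opprB. Qed.

Lemma enorm_coord u i : `|u i ord0| <= enorm u.
Proof.
rewrite -sqrtr_sqr ler_wsqrtr // (bigD1 i) //= lerDl.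
by apply: sumr_ge0 => j _; exact: sqr_ge0.
Qed.

Lemma enorm_eq0 u : enorm u = 0 -> u = 0.
Proof.
move=> u0; apply/matrixP => i j; rewrite (ord1 j) mxE; apply/eqP.
by rewrite -normr_le0 (le_trans (enorm_coord u i)) ?u0.
Qed.

Lemma dotv_delta u i : dotv u (delta_mx i ord0) = u i ord0.
Proof.
rewrite /dotv (bigD1 i) //= big1 ?addr0 => [|j ji].
  by rewrite mxE !eqxx mulr1.
by rewrite mxE (negbTE ji) mulr0.
Qed.

Lemma dotv_CS_sq u v : dotv u v ^+ 2 <= dotv u u * dotv v v.
Proof.
have [v0|v0] := eqVneq (enorm v) 0.
  by rewrite (enorm_eq0 v0) !dotv0 expr2 !mulr0.
have vv : 0 < dotv v v by rewrite -enorm_sq exprn_gt0 // lt_def v0 enorm_ge0.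
have := dotvv_ge0 (dotv v v *: u - dotv u v *: v).
rewrite !(dotvBl, dotvBr, dotvZl, dotvZr) (dotvC v u).
rewrite (_ : _ - _ = dotv v v * (dotv u u * dotv v v - dotv u v ^+ 2)); last ring.
by rewrite pmulr_rge0 // subr_ge0.
Qed.

Lemma dotv_CS u v : `|dotv u v| <= enorm u * enorm v.
Proof.
rewrite -ler_sqr ?nnegrE ?mulr_ge0 ?enorm_ge0 //.
by rewrite exprMn !enorm_sq real_normK ?num_real // dotv_CS_sq.
Qed.

Lemma dotv_le u v : dotv u v <= enorm u * enorm v.
Proof. exact: le_trans (ler_norm _) (dotv_CS u v). Qed.

Lemma enormD_sq u v :
  enorm (u + v) ^+ 2 = enorm u ^+ 2 + 2 * dotv u v + enorm v ^+ 2.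
Proof. by rewrite !enorm_sq !(dotvDl, dotvDr) (dotvC v u); ring. Qed.

Lemma ler_enormD u v : enorm (u + v) <= enorm u + enorm v.
Proof.
apply: enorm_le_sq; first by rewrite addr_ge0 ?enorm_ge0.
rewrite enormD_sq sqrrD.
have := dotv_le u v; lra.
Qed.

Lemma dotv_young (t : R) u v : 0 < t ->
  2 * dotv u v <= t * enorm u ^+ 2 + t^-1 * enorm v ^+ 2.
Proof.
move=> t0; have := dotvv_ge0 (t *: u - v).
rewrite !(dotvBl, dotvBr, dotvZl, dotvZr) (dotvC v u) -!enorm_sq => h.
rewrite -(ler_pM2l t0) mulrDr [t * (t^-1 * _)]mulrA divff ?gt_eqF //.
lra.
Qed.

Lemma enormD_sq_le u v :
  enorm (u + v) ^+ 2 <= 2 * (enorm u ^+ 2 + enorm v ^+ 2).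
Proof.
by have := dotv_young u v ltr01; rewrite enormD_sq invr1; lra.
Qed.

Lemma enormB_sq_le u v :
  enorm (u - v) ^+ 2 <= 2 * (enorm u ^+ 2 + enorm v ^+ 2).
Proof. by rewrite -(enormN v) enormD_sq_le. Qed.

Lemma enormD3_sq_le u v w :
  enorm (u + v + w) ^+ 2 <=
    3 * (enorm u ^+ 2 + enorm v ^+ 2 + enorm w ^+ 2).
Proof.
have := dotv_young u v ltr01; have := dotv_young u w ltr01.
have := dotv_young v w ltr01.
by rewrite !enormD_sq dotvDl invr1; lra.
Qed.

Lemma enorm_le_sum u : enorm u <= \sum_i `|u i ord0|.
Proof.
have s0 : 0 <= \sum_i `|u i ord0| by apply: sumr_ge0.
apply: enorm_le_sq => //; rewrite enorm_sq expr2 mulr_suml ler_sum // => i _.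
apply: le_trans (ler_norm _) _; rewrite normrM ler_wpM2l //.
by rewrite (bigD1 i) //= lerDl sumr_ge0.
Qed.

End dot.

Lemma dotv_col_mx {d e} (a a' : 'cV[R]_d) (b b' : 'cV[R]_e) :
  dotv (col_mx a b) (col_mx a' b') = dotv a a' + dotv b b'.
Proof.
rewrite /dotv big_split_ord /=; congr (_ + _); apply: eq_bigr => i _.
  by rewrite !col_mxEu.
by rewrite !col_mxEd.
Qed.

Lemma enorm_col_mx {d e} (a : 'cV[R]_d) (b : 'cV[R]_e) :
  enorm (col_mx a b) ^+ 2 = enorm a ^+ 2 + enorm b ^+ 2.
Proof. by rewrite !enorm_sq dotv_col_mx. Qed.

Lemma enorm_col_mxB_u {d e} (a a' : 'cV[R]_d) (b b' : 'cV[R]_e) :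
  enorm (a - a') ^+ 2 <= enorm (col_mx a b - col_mx a' b') ^+ 2.
Proof. by rewrite opp_col_mx add_col_mx enorm_col_mx lerDl sqr_ge0. Qed.

Lemma enorm_col_mxB_d {d e} (a a' : 'cV[R]_d) (b b' : 'cV[R]_e) :
  enorm (b - b') ^+ 2 <= enorm (col_mx a b - col_mx a' b') ^+ 2.
Proof. by rewrite opp_col_mx add_col_mx enorm_col_mx lerDr sqr_ge0. Qed.

Lemma enorm_col_mx0 {d e} (b : 'cV[R]_e) :
  enorm (col_mx (0 : 'cV[R]_d) b) = enorm b.
Proof.
apply/eqP; rewrite -(@eqrXn2 _ 2) ?enorm_ge0 // enorm_col_mx enorm0.
by rewrite expr0n add0r.
Qed.

Lemma enorm_usubmx {d e} (v : 'cV[R]_(d + e)) : enorm (usubmx v) <= enorm v.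
Proof.
apply: enorm_le_sq; rewrite ?enorm_ge0 // -{2}(vsubmxK v) enorm_col_mx.
by rewrite lerDl sqr_ge0.
Qed.

Lemma enorm_dsubmx {d e} (v : 'cV[R]_(d + e)) : enorm (dsubmx v) <= enorm v.
Proof.
apply: enorm_le_sq; rewrite ?enorm_ge0 // -{2}(vsubmxK v) enorm_col_mx.
by rewrite lerDr sqr_ge0.
Qed.

(** The operator norm is a supremum of real numbers, so it is meaningful only
    because the unit ball has a bounded image: the sum of the absolute values
    of the entries bounds it. *)
Lemma enorm_mulmx {d e} (A : 'M[R]_(d, e)) (v : 'cV[R]_e) :
  enorm (A *m v) <= opnorm A * enorm v.
Proof.
set S := [set enorm (A *m v) | v in [set v : 'cV[R]_e | enorm v <= 1]].
have Sub : has_ubound S.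
  exists (\sum_i \sum_j `|A i j|) => _ [w /= w1 <-].
  apply: le_trans (enorm_le_sum _) _; apply: ler_sum => i _.
  rewrite mxE; apply: le_trans (ler_norm_sum _ _ _) _.
  apply: ler_sum => j _; rewrite normrM ler_piMr //.
  exact: le_trans (enorm_coord w j) w1.
have [v0|v0] := eqVneq (enorm v) 0.
  by rewrite v0 (enorm_eq0 v0) mulmx0 enorm0 mulr0.
have vp : 0 < enorm v by rewrite lt_def v0 enorm_ge0.
rewrite -ler_pdivrMr // mulrC -[X in X * _]ger0_norm ?invr_ge0 ?enorm_ge0 //.
rewrite -enormZ scalemxAr; apply: ub_le_sup => //.
by exists ((enorm v)^-1 *: v) => //=; rewrite enormZ normfV ger0_norm ?mulVf // ltW.
Qed.

(** ** Projection onto a ball *)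

Section projection.
Context {d : nat} (r : R) (r0 : 0 <= r).
Implicit Types (z w : 'cV[R]_d).

(** The set defining the projection is inhabited by the radial truncation of
    the point, so that the default value never appears. *)
Lemma proj_ball_spec z : enorm (proj_ball r z) <= r /\
  forall w, enorm w <= r -> enorm (z - proj_ball r z) <= enorm (z - w).
Proof.
rewrite /proj_ball /argmin; case: xgetP => [w _ [//]|noz].
exfalso.
have [zr|rz] := leP (enorm z) r.
  by apply: (noz z); split => // w _; rewrite subrr enorm0 enorm_ge0.
have zp : 0 < enorm z := le_lt_trans r0 rz.
apply: (noz ((r / enorm z) *: z)); split => [|w wr].
  by rewrite /= enormZ ger0_norm ?divr_ge0 ?enorm_ge0 // divfK // gt_eqF.
rewrite -[X in X - _]scale1r -scalerBl enormZ ger0_norm; last first.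
  by rewrite subr_ge0 ler_pdivrMr // mul1r ltW.
rewrite mulrBl mul1r divfK ?gt_eqF //.
have := ler_enormD (z - w) w; rewrite subrK => h.
have : enorm w <= r := wr; lra.
Qed.

Lemma enorm_proj_ball z : enorm (proj_ball r z) <= r.
Proof. by case: (proj_ball_spec z). Qed.

(** The variational characterisation of the nearest point of a convex set. *)
Lemma proj_ball_obtuse z w : enorm w <= r ->
  dotv (z - proj_ball r z) (w - proj_ball r z) <= 0.
Proof.
move=> wr; have [pr pmin] := proj_ball_spec z; set q := proj_ball r z in pr pmin *.
set D := dotv _ _.
(* Moving from the projection towards w cannot decrease the distance. *)
have step t : 0 < t -> t <= 1 -> 2 * D <= t * enorm (w - q) ^+ 2.
  move=> t0 t1; have t0' := ltW t0.
  have : enorm (q + t *: (w - q)) <= r.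
    rewrite (_ : q + _ = (1 - t) *: q + t *: w); last first.
      by apply/matrixP => i j; rewrite !mxE; ring.
    apply: le_trans (ler_enormD _ _) _; rewrite !enormZ !ger0_norm ?subr_ge0 //.
    rewrite [X in _ <= X](_ : _ = (1 - t) * r + t * r); last by ring.
    by rewrite lerD // ler_wpM2l ?subr_ge0.
  move/pmin; rewrite -ler_sqr ?nnegrE ?enorm_ge0 // opprD addrA => h.
  rewrite -(ler_pM2l t0); move: h.
  rewrite (enormD_sq (z - q) (- _)) dotvNr enormN dotvZr -/D.
  rewrite enormZ exprMn real_normK ?num_real //; lra.
apply/ler_addgt0Pl => /= e e0; rewrite addr0.
have [n0|n0] := eqVneq (enorm (w - q) ^+ 2) 0.
  by have := step 1 ltr01 (lexx _); rewrite n0; lra.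
have np : 0 < enorm (w - q) ^+ 2 by rewrite lt_def n0 sqr_ge0.
have tp : 0 < Num.min 1 (e / enorm (w - q) ^+ 2) by rewrite lt_min ltr01 divr_gt0.
have := step _ tp (ltac:(by rewrite ge_min lexx)).
have : Num.min 1 (e / enorm (w - q) ^+ 2) * enorm (w - q) ^+ 2 <= e.
  by rewrite -ler_pdivlMr // ge_min lexx orbT.
lra.
Qed.

Lemma proj_ball_nonexpansive z z' :
  enorm (proj_ball r z - proj_ball r z') <= enorm (z - z').
Proof.
have h1 := proj_ball_obtuse z (enorm_proj_ball z').
have h2 := proj_ball_obtuse z' (enorm_proj_ball z).
set q := proj_ball r z in h1 h2 *; set q' := proj_ball r z' in h1 h2 *.
have h : enorm (q - q') ^+ 2 <= dotv (z - z') (q - q').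
  move: h1 h2; rewrite enorm_sq !(dotvBl, dotvBr) (dotvC q' q); lra.
have [->|n0] := eqVneq (enorm (q - q')) 0; first exact: enorm_ge0.
have np : 0 < enorm (q - q') by rewrite lt_def n0 enorm_ge0.
by rewrite -(ler_pM2r np) -expr2 (le_trans h) // dotv_le.
Qed.

Lemma proj_ball_id z : enorm z <= r -> proj_ball r z = z.
Proof.
move=> zr; have [_ /(_ z zr)] := proj_ball_spec z.
rewrite subrr enorm0 => h; apply/esym/eqP; rewrite -subr_eq0; apply/eqP.
by apply: enorm_eq0; apply/eqP; rewrite eq_le h enorm_ge0.
Qed.

End projection.
End Euclid.

(** * Calculus along segments *)

Section Calculus.
Context {R : realType}.

Lemma addrDKl {V : zmodType} (u v : V) : u + v - u = v.
Proof. by rewrite addrAC subrr add0r. Qed.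

(** Lets a linear error term go to zero; every passage to the limit on a short
    segment below is an instance. *)
Lemma ler_vanishing (a b c : R) :
  (forall t, 0 < t -> t <= 1 -> a <= b + t * c) -> a <= b.
Proof.
move=> h; apply/ler_addgt0Pl => /= e e0.
have cp : 0 < `|c| + 1 by rewrite ltr_wpDl.
have tp : 0 < Num.min 1 (e / (`|c| + 1)) by rewrite lt_min ltr01 divr_gt0.
have t1 : Num.min 1 (e / (`|c| + 1)) <= 1 by rewrite ge_min lexx.
have te : Num.min 1 (e / (`|c| + 1)) * (`|c| + 1) <= e.
  by rewrite -ler_pdivlMr // ge_min lexx orbT.
apply: le_trans (h _ tp t1) _; rewrite addrC lerD2r; apply: le_trans te.
by apply: ler_wpM2l; [exact: ltW|have := ler_norm c; lra].
Qed.

Lemma continuous_of_quadratic_bound {V : normedModType R} (N : V -> R) (c : R)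
    (f : V -> R) :
  0 <= c -> (forall v, 0 <= N v <= c * `|v|) ->
  (forall u, exists C, 0 <= C /\
     forall v, `|f v - f u| <= C * (N (v - u) + N (v - u) ^+ 2)) ->
  continuous f.
Proof.
move=> c0 hN hf u; have [C [C0 hC]] := hf u.
apply/cvgrPdist_le => e e0.
pose dl := Num.min 1 (e / (2 * C + 1)) / (c + 1).
have Cp : 0 < 2 * C + 1 by lra.
have cp : 0 < c + 1 by lra.
have mp : 0 < Num.min 1 (e / (2 * C + 1)) by rewrite lt_min ltr01 divr_gt0.
have dp : 0 < dl by rewrite divr_gt0.
near=> v.
have vu : `|v - u| <= dl.
  rewrite distrC; near: v.
  by apply: (@cvgr_dist_le _ _ _ (nbhs u) _ idfun u) => //; exact: cvg_id.
have /andP[N0 Nc] := hN (v - u).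
have Nm : N (v - u) <= Num.min 1 (e / (2 * C + 1)).
  apply: le_trans Nc _; apply: (@le_trans _ _ ((c + 1) * dl)).
    by apply: ler_pM => //; lra.
  by rewrite mulrC divfK // gt_eqF.
have N1 : N (v - u) <= 1 by apply: le_trans Nm _; rewrite ge_min lexx.
have Ne : N (v - u) * (2 * C + 1) <= e.
  by rewrite -ler_pdivlMr // (le_trans Nm) // ge_min lexx orbT.
rewrite distrC; apply: le_trans (hC v) _; apply: le_trans Ne.
have : C * (N (v - u) ^+ 2) <= C * N (v - u).
  by rewrite ler_wpM2l // expr2 ler_piMr.
lra.
Unshelve. all: by end_near. Qed.

Lemma enorm_le_mx_norm {d} (v : 'cV[R]_d) : enorm v <= d%:R * `|v|.
Proof.
apply: le_trans (enorm_le_sum v) _.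
rewrite -[X in X%:R]card_ord mulr_natl -sumr_const ler_sum // => i _.
have /mapP[j Hj ->] : `|v i ord0| \in [seq `|v x.1 x.2| | x : 'I_d * 'I_1].
  by apply/mapP; exists (i, ord0) => //=; rewrite mem_enum.
rewrite [leRHS]/Num.Def.normr /= mx_normrE; apply/bigmax_geP.
by right => /=; exists j.
Qed.

Lemma continuous_of_enorm_bound {d} (f : 'cV[R]_d -> R) :
  (forall u, exists C, 0 <= C /\
     forall v, `|f v - f u| <= C * (enorm (v - u) + enorm (v - u) ^+ 2)) ->
  continuous f.
Proof.
apply: (@continuous_of_quadratic_bound _ enorm d%:R) => // v.
by rewrite enorm_ge0 enorm_le_mx_norm.
Qed.

Section one_function.
Context {d : nat}.
Implicit Types (h : 'cV[R]_d -> R) (u v w : 'cV[R]_d).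

Lemma derive_grad h u v : differentiable h u -> 'D_v h u = dotv (grad h u) v.
Proof.
move=> dh; rewrite deriveE //.
have {1}-> : v = \sum_i v i ord0 *: delta_mx i ord0.
  by rewrite {1}(matrix_sum_delta v); apply: eq_bigr => i _; rewrite big_ord1.
rewrite linear_sum; apply: eq_bigr => i _.
by rewrite linearZ mxE /pderive deriveE // mulrC.
Qed.

Lemma is_derive_segment h u v (t : R) : (forall u, differentiable h u) ->
  is_derive t 1 (fun s : R => h (u + s *: v)) (dotv (grad h (u + t *: v)) v).
Proof.
move=> dh; rewrite -derive_grad //.
pose F1 (s : R) := s^-1 *: ((h \o shift (u + t *: v)) (s *: v) - h (u + t *: v)).
pose F2 (s : R) := s^-1 *: (((fun s : R => h (u + s *: v)) \o shift t) (s *: 1)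
   - h (u + t *: v)).
have E : F2 = F1.
  apply/funext => s; rewrite /F1 /F2 /=; congr (_ *: (h _ - _)).
  by apply/matrixP => i j; rewrite !mxE /GRing.scale /=; ring.
apply: DeriveDef.
  change (cvg (F2 @ 0^')); rewrite E; exact: diff_derivable.
by change (lim (F2 @ 0^') = lim (F1 @ 0^')); rewrite E.
Qed.

(** The Taylor estimates below only use the mean value theorem, at the price of
    a factor two in the remainders, which is harmless here. *)
Lemma mean_value_segment h u v : (forall u, differentiable h u) ->
  exists t : R, [/\ 0 <= t, t <= 1 &
    h (u + v) - h u = dotv (grad h (u + t *: v)) v].
Proof.
move=> dh; have D t := is_derive_segment u v t dh.
have [|t] := @MVT_segment R (fun s : R => h (u + s *: v)) _ 0 1 ler01
  (fun t _ => D t).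
  apply: continuous_subspaceT => t.
  by apply/differentiable_continuous/derivable1_diffP; case: (D t).
rewrite in_itv /= => /andP[t0 t1]; rewrite scale1r scale0r addr0 subr0 mulr1.
by move=> E; exists t.
Qed.

Lemma lipschitz_grad_taylor (L : R) h u v : lipschitz_grad L h ->
  `|h (u + v) - h u - dotv (grad h u) v| <= L * enorm v ^+ 2.
Proof.
move=> [dh lh]; have [t [t0 t1 ->]] := mean_value_segment u v dh.
rewrite -dotvBl; apply: le_trans (dotv_CS _ _) _.
rewrite expr2 mulrA ler_wpM2r ?enorm_ge0 //.
apply: le_trans (lh _ _) _; rewrite addrDKl enormZ ger0_norm //.
have L0 : 0 <= L * enorm v.
  have := lh (u + v) u; rewrite addrDKl; apply: le_trans; exact: enorm_ge0.
by rewrite mulrCA ler_piMl.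
Qed.

(** A directional component of the gradient is again a function with Lipschitz
    gradient, so the first-order expansion of the gradient reduces to the one
    of scalar functions. The gradient of the component along w is the product
    of the Hessian with w, in this order of the indices. *)
Lemma lipschitz_grad_component (L2 : R) h w : lipschitz_hess L2 h ->
  (forall u, grad (fun v => dotv w (grad h v)) u = hess h u *m w) /\
  lipschitz_grad (L2 * enorm w) (fun v => dotv w (grad h v)).
Proof.
move=> [dh lh].
have E : (fun v => dotv w (grad h v)) =
    \sum_(j < d) (fun v => w j ord0 *: pderive j h v).
  apply/funext => v; rewrite fct_sumE; apply: eq_bigr => j _.
  by rewrite mxE.
have dj j u : differentiable (fun v => w j ord0 *: pderive j h v) u.
  exact: differentiableZ.
have gradE u : grad (fun v => dotv w (grad h v)) u = hess h u *m w.
  apply/matrixP => i k; rewrite (ord1 k) !mxE /pderive E derive_sum; last first.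
    by move=> j; exact: diff_derivable.
  apply: eq_bigr => j _; rewrite deriveZ; last exact: diff_derivable.
  by rewrite mxE mulrC.
split=> //; split.
  by move=> u; rewrite E; apply: differentiable_sum => j; exact: dj.
move=> u v; rewrite !gradE -mulmxBl; apply: le_trans (enorm_mulmx _ _) _.
by rewrite mulrAC ler_wpM2r ?enorm_ge0.
Qed.

Lemma lipschitz_hess_taylor (L2 : R) h u v w : lipschitz_hess L2 h ->
  `|dotv w (grad h (u + v)) - dotv w (grad h u) - dotv (hess h u *m w) v|
    <= L2 * enorm w * enorm v ^+ 2.
Proof.
move=> /(lipschitz_grad_component w)[gE lw].
by rewrite -gE; exact: (lipschitz_grad_taylor _ _ lw).
Qed.

(** The Hessian is the derivative of an L1-Lipschitz map: compare the two
    bounds on the increment of the gradient over a short segment. *)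
Lemma enorm_hess_mulmx (L1 L2 : R) h u w :
  lipschitz_grad L1 h -> lipschitz_hess L2 h ->
  enorm (hess h u *m w) <= L1 * enorm w.
Proof.
move=> [_ l1] l2; set q := hess h u *m w.
have [->|q0] := eqVneq (enorm q) 0.
  by have := l1 (u + w) u; rewrite addrDKl; apply: le_trans; exact: enorm_ge0.
have qp : 0 < enorm q by rewrite lt_def q0 enorm_ge0.
rewrite -(ler_pM2r qp) -expr2 enorm_sq.
apply: (@ler_vanishing _ _ (L2 * enorm w * enorm q ^+ 2)) => t t0 t1.
rewrite -(ler_pM2l t0).
have := lipschitz_hess_taylor u (t *: q) w l2; rewrite -dotvBr -/q dotvZr.
have := dotv_le w (grad h (u + t *: q) - grad h u).
have := l1 (u + t *: q) u; rewrite addrDKl enormZ (ger0_norm (ltW t0)).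
move=> /(ler_wpM2l (enorm_ge0 w)) a b.
rewrite ler_distl => /andP[c _].
have {a} := le_trans b a; move: c; rewrite exprMn.
set D := dotv w _; set e := enorm w; set k := enorm q.
lra.
Qed.

End one_function.

(** ** Strong convexity in the second block of variables *)

Section strong_convexity.
Context {dx dy : nat} (L1 L2 mu : R) (g : 'cV[R]_(dx + dy) -> R).
Hypotheses (mu0 : 0 < mu) (l1 : lipschitz_grad L1 g) (l2 : lipschitz_hess L2 g).
Context (x : 'cV[R]_dx).
Hypothesis sc : strongly_convex mu (fun y => g (col_mx x y)).
Implicit Types (y w : 'cV[R]_dy).

Lemma dotv_col_mx0 (q : 'cV[R]_(dx + dy)) w :
  dotv q (col_mx 0 w) = dotv (dsubmx q) w.
Proof. by rewrite -{1}(vsubmxK q) dotv_col_mx dotv0 add0r. Qed.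

(** The defining inequality of strong convexity on a short segment starting at
    y', divided by the length of the segment. *)
Lemma strongly_convex_grad y y' :
  g (col_mx x y') + dotv (grad2 g x y') (y - y') + mu / 2 * enorm (y - y') ^+ 2
    <= g (col_mx x y).
Proof.
set D := dotv _ _; set N := enorm _ ^+ 2.
apply: (@ler_vanishing _ _ ((mu / 2 + L1) * N)) => t t0 t1.
have t01 : 0 <= t <= 1 by rewrite ltW.
have := sc y y' t01.
have -> : t *: y + (1 - t) *: y' = y' + t *: (y - y').
  by apply/matrixP => i j; rewrite !mxE; ring.
have := lipschitz_grad_taylor (col_mx x y') (col_mx 0 (t *: (y - y'))) l1.
rewrite add_col_mx addr0 dotv_col_mx0 dotvZr -/D enorm_col_mx0 enormZ exprMn.
rewrite (ger0_norm (ltW t0)) ler_distl => /andP[a _] b.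
rewrite -(ler_pM2l t0); move: a b; rewrite -/N.
set N' := N; set D' := D; lra.
Qed.

Lemma strongly_monotone y y' :
  mu * enorm (y - y') ^+ 2 <= dotv (grad2 g x y - grad2 g x y') (y - y').
Proof.
have := strongly_convex_grad y y'; have := strongly_convex_grad y' y.
rewrite (enormB y' y) dotvBl -(opprB y y') dotvNr; lra.
Qed.

(** Strong monotonicity of the gradient in y, to second order along a short
    segment in the direction w. *)
Lemma hess22_coercive y w :
  mu * enorm w ^+ 2 <= dotv w (hess22 g x y *m w).
Proof.
apply: (@ler_vanishing _ _ (L2 * enorm w * enorm w ^+ 2)) => t t0 t1.
have := lipschitz_hess_taylor (col_mx x y) (col_mx 0 (t *: w)) (col_mx 0 w) l2.
have := strongly_monotone (y + t *: w) y.
rewrite add_col_mx addr0 !enorm_col_mx0 !dotv_col_mx0 dotvZr.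
rewrite addrDKl enormZ exprMn (ger0_norm (ltW t0)) dotvZr dotvBl.
rewrite ![dotv (col_mx 0 w) _]dotvC !dotv_col_mx0.
have -> : dsubmx (hess g (col_mx x y) *m col_mx 0 w) = hess22 g x y *m w.
  rewrite /hess22 -{1}(submxK (hess g (col_mx x y))) mul_block_col !mulmx0.
  by rewrite !add0r col_mxKd.
rewrite (dotvC (hess22 _ _ _ *m w)) (dotvC (dsubmx _) w) ler_distl => a /andP[_ b].
rewrite -(ler_pM2l t0) -(ler_pM2l t0).
move/(ler_wpM2l (ltW t0)): b; move: a; rewrite /grad2; lra.
Qed.

Lemma hess22_unit y : hess22 g x y \in unitmx.
Proof.
rewrite -unitmx_tr -row_free_unit -kermx_eq0; apply/eqP/row_matrixP => i.
rewrite row0; set v := row i _.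
have vk : v *m (hess22 g x y)^T = 0.
  by apply/sub_kermxP; rewrite row_sub.
have : hess22 g x y *m v^T = 0 by rewrite -[LHS]trmxK trmx_mul trmxK vk trmx0.
move=> h; have := hess22_coercive y v^T; rewrite h dotv0 => n0.
have : enorm v^T = 0.
  apply/eqP; rewrite -sqrf_eq0 eq_le sqr_ge0 andbT.
  by rewrite -(ler_pM2l mu0) mulr0.
by move/enorm_eq0 => v0; rewrite -[v]trmxK v0 trmx0.
Qed.

(** A minimiser exists on a large box by compactness; outside the inscribed
    ball the quadratic lower bound of strong convexity exceeds the value at the
    centre. *)
Lemma ystar_min y : g (col_mx x (ystar g x)) <= g (col_mx x y).
Proof.
rewrite /ystar /argmin; case: xgetP => [w _ [_ ->]//|noy].
exfalso.
pose r := 2 * enorm (grad2 g x 0) / mu.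
have r0 : 0 <= r by rewrite divr_ge0 ?mulr_ge0 ?enorm_ge0 // ltW.
pose A := [set v : 'rV[R]_dy | forall i, v ord0 i \in `[- r, r]].
have A0 : A 0 by move=> i; rewrite mxE in_itv /= oppr_le0 r0.
have cA : compact A.
  apply: (@rV_compact _  _ (fun=> `[- r, r]%classic)).
  by move=> _; apply: segment_compact.
have cg : continuous (fun v : 'rV[R]_dy => g (col_mx x v^T)).
  apply: (@continuous_of_quadratic_bound _ (fun v => enorm v^T) dy%:R) => //.
    move=> v; rewrite enorm_ge0 /=; apply: le_trans (enorm_le_sum _) _.
    rewrite -[X in X%:R]card_ord mulr_natl -sumr_const ler_sum // => i _.
    rewrite mxE.
    have /mapP[j Hj ->] : `|v ord0 i| \in [seq `|v x.1 x.2| | x : 'I_1 * 'I_dy].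
      by apply/mapP; exists (ord0, i) => //=; rewrite mem_enum.
    rewrite [leRHS]/Num.Def.normr /= mx_normrE; apply/bigmax_geP.
    by right => /=; exists j.
  move=> u; exists (enorm (grad g (col_mx x u^T)) + `|L1|).
  split; first by rewrite addr_ge0 ?enorm_ge0.
  move=> v.
  have := lipschitz_grad_taylor (col_mx x u^T) (col_mx 0 (v - u)^T) l1.
  rewrite add_col_mx addr0 enorm_col_mx0 linearB /= (addrC u^T) subrK.
  have := dotv_CS (grad g (col_mx x u^T)) (col_mx 0 (v^T - u^T)).
  rewrite enorm_col_mx0; set N := enorm (v^T - u^T); set D := dotv _ _.
  set a := g _; set b := g _; set k := enorm _.
  have N0 : 0 <= N := enorm_ge0 _.
  have k0 : 0 <= k := enorm_ge0 _.
  have L1N : L1 * N ^+ 2 <= `|L1| * N ^+ 2.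
    by rewrite ler_wpM2r ?sqr_ge0 // ler_norm.
  have LN : 0 <= `|L1| * N by rewrite mulr_ge0.
  have kN : 0 <= k * N ^+ 2 by rewrite mulr_ge0 ?sqr_ge0.
  move=> h1 h2; have := ler_normD (a - b - D) D; rewrite subrK => h3.
  by lra.
have [c cA' cmin] := EVT_min_rV (ex_intro _ _ A0) cA (continuous_subspaceT cg).
apply: (noy c^T); split=> // y' _.
have [yr|ry] := leP (enorm y') r.
  rewrite -[y' in leRHS]trmxK; apply: cmin; rewrite inE => i.
  rewrite mxE in_itv /= -ler_norml; exact: le_trans (enorm_coord _ _) yr.
have := cmin 0 (mem_set A0); rewrite trmx0 => /le_trans; apply.
have := strongly_convex_grad y' 0; rewrite subr0 => h; apply: le_trans h.
have := dotv_CS (grad2 g x 0) y'; rewrite ler_norml => /andP[h _].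
have : r * mu = 2 * enorm (grad2 g x 0) by rewrite /r divfK // gt_eqF.
set k := enorm (grad2 g x 0) in h * => E.
have y0 : 0 <= enorm y' := enorm_ge0 _.
have : 0 <= (enorm y' - r) * mu * enorm y'.
  by rewrite !mulr_ge0 ?subr_ge0 // ltW.
rewrite mulrBl E; set N := enorm y' in h y0 *; nra.
Qed.

Lemma grad2_ystar : grad2 g x (ystar g x) = 0.
Proof.
set q := grad2 _ _ _; apply: enorm_eq0; apply/eqP; rewrite -sqrf_eq0.
rewrite eq_le sqr_ge0 andbT.
apply: (@ler_vanishing _ _ (L1 * enorm q ^+ 2)) => t t0 t1.
rewrite -(ler_pM2l t0) add0r.
have := lipschitz_grad_taylor (col_mx x (ystar g x)) (col_mx 0 (- t *: q)) l1.
rewrite add_col_mx addr0 enorm_col_mx0 dotv_col_mx0 -/(grad2 _ _ _) -/q.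
rewrite dotvZr -enorm_sq enormZ exprMn normrN (ger0_norm (ltW t0)).
rewrite ler_distl => /andP[_ a].
have := ystar_min (ystar g x + - t *: q); move: a.
set N := enorm q ^+ 2; lra.
Qed.

(** The minimiser is controlled by the residual gradient; this one estimate
    gives both the uniqueness and the Lipschitz continuity of ystar. *)
Lemma dist_ystar y : mu * enorm (y - ystar g x) <= enorm (grad2 g x y).
Proof.
have [->|n0] := eqVneq (enorm (y - ystar g x)) 0.
  by rewrite mulr0 enorm_ge0.
have np : 0 < enorm (y - ystar g x) by rewrite lt_def n0 enorm_ge0.
rewrite -(ler_pM2r np) -mulrA -expr2.
apply: le_trans (strongly_monotone _ _) _.
by rewrite grad2_ystar subr0 dotv_le.
Qed.

Lemma enorm_hess22_ge y w : mu * enorm w <= enorm (hess22 g x y *m w).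
Proof.
have [->|n0] := eqVneq (enorm w) 0; first by rewrite mulr0 enorm_ge0.
have np : 0 < enorm w by rewrite lt_def n0 enorm_ge0.
rewrite -(ler_pM2r np) -mulrA -expr2 mulrC.
by rewrite mulrC (le_trans (hess22_coercive y w)) // mulrC dotv_le.
Qed.

End strong_convexity.

End Calculus.

(** * The bilevel operators *)

Section operators.
Context {R : realType} {dx dy : nat}.
Implicit Types (f g : 'cV[R]_(dx + dy) -> R) (x : 'cV[R]_dx) (y z : 'cV[R]_dy).

(** The squared Lipschitz constants of the part in f and of the part in g, added
    up; one value serves the three operators, on points whose last component
    lies in the ball of radius r. *)
Definition qlip (Lf L1 L2 r : R) : R :=
  Lf ^+ 2 + 2 * (L1 ^+ 2 + L2 ^+ 2 * r ^+ 2).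

Lemma qlip_ge0 (Lf L1 L2 r : R) : 0 <= qlip Lf L1 L2 r.
Proof.
rewrite /qlip addr_ge0 ?sqr_ge0 // mulr_ge0 // addr_ge0 ?sqr_ge0 //.
by rewrite mulr_ge0 ?sqr_ge0.
Qed.

Definition dist3 x y z x' y' z' : R :=
  enorm (x' - x) ^+ 2 + enorm (y' - y) ^+ 2 + enorm (z' - z) ^+ 2.

Lemma dist3_ge0 x y z x' y' z' : 0 <= dist3 x y z x' y' z'.
Proof. by rewrite /dist3 !addr_ge0 ?sqr_ge0. Qed.

Lemma mulmx_col_mx0 (A : 'M[R]_(dx + dy)) z :
  A *m col_mx 0 z = col_mx (ursubmx A *m z) (drsubmx A *m z).
Proof. by rewrite -{1}(submxK A) mul_block_col !mulmx0 !add0r. Qed.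

Lemma hess_col_mx0 g x y z :
  hess g (col_mx x y) *m col_mx 0 z =
  col_mx (hess12 g x y *m z) (hess22 g x y *m z).
Proof. exact: mulmx_col_mx0. Qed.

Lemma enorm_ursubmx_increment (A A' : 'M[R]_(dx + dy)) z z' :
  enorm (ursubmx A' *m z' - ursubmx A *m z) ^+ 2 <=
    enorm (A' *m col_mx 0 z' - A *m col_mx 0 z) ^+ 2.
Proof. by rewrite !mulmx_col_mx0; exact: enorm_col_mxB_u. Qed.

Lemma enorm_drsubmx_increment (A A' : 'M[R]_(dx + dy)) z z' :
  enorm (drsubmx A' *m z' - drsubmx A *m z) ^+ 2 <=
    enorm (A' *m col_mx 0 z' - A *m col_mx 0 z) ^+ 2.
Proof. by rewrite !mulmx_col_mx0; exact: enorm_col_mxB_d. Qed.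

Section increments.
Context (Lf L1 L2 r : R) (Lf0 : 0 <= Lf) (L10 : 0 <= L1) (L20 : 0 <= L2)
  (r0 : 0 <= r).

Lemma grad_increment (L : R) f x y x' y' : 0 <= L -> lipschitz_grad L f ->
  enorm (grad f (col_mx x' y') - grad f (col_mx x y)) ^+ 2 <=
    L ^+ 2 * (enorm (x' - x) ^+ 2 + enorm (y' - y) ^+ 2).
Proof.
move=> L0 [_ lf]; have := lf (col_mx x' y') (col_mx x y).
rewrite opp_col_mx add_col_mx -enorm_col_mx -exprMn => h.
by rewrite ler_sqr // nnegrE ?mulr_ge0 ?enorm_ge0.
Qed.

Lemma grad1_increment (L : R) f x y x' y' : 0 <= L -> lipschitz_grad L f ->
  enorm (grad1 f x' y' - grad1 f x y) ^+ 2 <=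
    L ^+ 2 * (enorm (x' - x) ^+ 2 + enorm (y' - y) ^+ 2).
Proof.
move=> L0 lf; apply: le_trans (grad_increment x y x' y' L0 lf).
by rewrite -linearB ler_sqr ?nnegrE ?enorm_ge0 // enorm_usubmx.
Qed.

Lemma grad2_increment (L : R) f x y x' y' : 0 <= L -> lipschitz_grad L f ->
  enorm (grad2 f x' y' - grad2 f x y) ^+ 2 <=
    L ^+ 2 * (enorm (x' - x) ^+ 2 + enorm (y' - y) ^+ 2).
Proof.
move=> L0 lf; apply: le_trans (grad_increment x y x' y' L0 lf).
by rewrite -linearB ler_sqr ?nnegrE ?enorm_ge0 // enorm_dsubmx.
Qed.

(** The product of the Hessian with z is not globally Lipschitz; it is
    Lipschitz between two points as soon as one of the two z lies in the
    ball. *)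
Lemma hess_increment g x y z x' y' z' :
  lipschitz_grad L1 g -> lipschitz_hess L2 g -> enorm z <= r ->
  enorm (hess g (col_mx x' y') *m col_mx 0 z'
         - hess g (col_mx x y) *m col_mx 0 z) ^+ 2 <=
    2 * (L1 ^+ 2 + L2 ^+ 2 * r ^+ 2) * dist3 x y z x' y' z'.
Proof.
move=> l1 l2 zr.
have -> : hess g (col_mx x' y') *m col_mx 0 z'
          - hess g (col_mx x y) *m col_mx 0 z =
    hess g (col_mx x' y') *m col_mx 0 (z' - z)
    + (hess g (col_mx x' y') - hess g (col_mx x y)) *m col_mx 0 z.
  have -> : col_mx 0 (z' - z) = col_mx 0 z' - col_mx 0 z :> 'cV[R]_(dx + dy).
    by rewrite opp_col_mx add_col_mx oppr0 addr0.
  by move: (hess _ _) (hess _ _) => A A'; rewrite mulmxBr mulmxBl addrA subrK.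
apply: le_trans (enormD_sq_le _ _) _.
have h1 : enorm (hess g (col_mx x' y') *m col_mx 0 (z' - z)) ^+ 2 <=
    L1 ^+ 2 * enorm (z' - z) ^+ 2.
  rewrite -exprMn ler_sqr ?nnegrE ?mulr_ge0 ?enorm_ge0 //.
  by have := enorm_hess_mulmx (col_mx x' y') (col_mx 0 (z' - z)) l1 l2;
    rewrite enorm_col_mx0.
have h2 : enorm ((hess g (col_mx x' y') - hess g (col_mx x y)) *m col_mx 0 z)
    ^+ 2 <= L2 ^+ 2 * r ^+ 2 * (enorm (x' - x) ^+ 2 + enorm (y' - y) ^+ 2).
  rewrite -enorm_col_mx -!exprMn ler_sqr ?nnegrE ?mulr_ge0 ?enorm_ge0 //.
  apply: le_trans (enorm_mulmx _ _) _.
  have := l2.2 (col_mx x' y') (col_mx x y).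
  rewrite opp_col_mx add_col_mx enorm_col_mx0 mulrAC => h.
  apply: le_trans (ler_wpM2r (enorm_ge0 z) h) _.
  by rewrite ler_wpM2l // mulr_ge0 ?enorm_ge0.
rewrite -mulrA ler_pM2l // /dist3.
have := sqr_ge0 (enorm (x' - x)); have := sqr_ge0 (enorm (y' - y)).
have := sqr_ge0 (enorm (z' - z)); have := sqr_ge0 L1.
have : 0 <= L2 ^+ 2 * r ^+ 2 by rewrite mulr_ge0 ?sqr_ge0.
move: h1 h2; set a := enorm _ ^+ 2; set b := enorm _ ^+ 2.
set X := enorm _ ^+ 2; set Y := enorm _ ^+ 2; set Z := enorm _ ^+ 2.
set l := L1 ^+ 2; set k := L2 ^+ 2 * r ^+ 2 => *; nra.
Qed.

Lemma hess12_increment g x y z x' y' z' :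
  lipschitz_grad L1 g -> lipschitz_hess L2 g -> enorm z <= r ->
  enorm (hess12 g x' y' *m z' - hess12 g x y *m z) ^+ 2 <=
    2 * (L1 ^+ 2 + L2 ^+ 2 * r ^+ 2) * dist3 x y z x' y' z'.
Proof.
move=> l1 l2 zr; apply: le_trans (hess_increment x y x' y' z' l1 l2 zr).
exact: enorm_ursubmx_increment.
Qed.

Lemma hess22_increment g x y z x' y' z' :
  lipschitz_grad L1 g -> lipschitz_hess L2 g -> enorm z <= r ->
  enorm (hess22 g x' y' *m z' - hess22 g x y *m z) ^+ 2 <=
    2 * (L1 ^+ 2 + L2 ^+ 2 * r ^+ 2) * dist3 x y z x' y' z'.
Proof.
move=> l1 l2 zr; apply: le_trans (hess_increment x y x' y' z' l1 l2 zr).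
exact: enorm_drsubmx_increment.
Qed.

Let Q := qlip Lf L1 L2 r.

Lemma Dx_increment f g x y z x' y' z' :
  lipschitz_grad Lf f -> lipschitz_grad L1 g -> lipschitz_hess L2 g ->
  enorm z <= r ->
  enorm (Dx f g x' y' z' - Dx f g x y z) ^+ 2 <= 2 * Q * dist3 x y z x' y' z'.
Proof.
move=> lf l1 l2 zr; rewrite /Dx.
rewrite [X in enorm X](_ : _ = (grad1 f x' y' - grad1 f x y)
   - (hess12 g x' y' *m z' - hess12 g x y *m z)); last first.
  by apply/matrixP => i j; rewrite !mxE; ring.
apply: le_trans (enormB_sq_le _ _) _.
have := grad1_increment x y x' y' Lf0 lf.
have := hess12_increment x y x' y' z' l1 l2 zr.
rewrite /Q /qlip /dist3; have := mulr_ge0 (sqr_ge0 Lf) (sqr_ge0 (enorm (z' - z))).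
lra.
Qed.

Lemma Dy_increment f g x y z x' y' z' : lipschitz_grad L1 g ->
  enorm (Dy f g x' y' z' - Dy f g x y z) ^+ 2 <=
    2 * Q * (enorm (x' - x) ^+ 2 + enorm (y' - y) ^+ 2).
Proof.
move=> l1; rewrite /Dy; apply: le_trans (grad2_increment x y x' y' L10 l1) _.
rewrite ler_wpM2r ?addr_ge0 ?sqr_ge0 // /Q /qlip.
have := sqr_ge0 Lf; have := sqr_ge0 L1.
have : 0 <= L2 ^+ 2 * r ^+ 2 by rewrite mulr_ge0 ?sqr_ge0.
lra.
Qed.

Lemma Dz_increment f g x y z x' y' z' :
  lipschitz_grad Lf f -> lipschitz_grad L1 g -> lipschitz_hess L2 g ->
  enorm z <= r ->
  enorm (Dz f g x' y' z' - Dz f g x y z) ^+ 2 <= 2 * Q * dist3 x y z x' y' z'.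
Proof.
move=> lf l1 l2 zr; rewrite /Dz.
rewrite [X in enorm X](_ : _ = (hess22 g x' y' *m z' - hess22 g x y *m z)
   - (grad2 f x' y' - grad2 f x y)); last first.
  by apply/matrixP => i j; rewrite !mxE; ring.
apply: le_trans (enormB_sq_le _ _) _.
have := grad2_increment x y x' y' Lf0 lf.
have := hess22_increment x y x' y' z' l1 l2 zr.
rewrite /Q /qlip /dist3; have := mulr_ge0 (sqr_ge0 Lf) (sqr_ge0 (enorm (z' - z))).
lra.
Qed.

End increments.
End operators.

(** * The hyperobjective *)

(** The squared Lipschitz constants of the two solution maps. *)
Definition ylip2 {R : realType} (Q mu : R) : R := 2 * Q / mu ^+ 2.
Definition zlip2 {R : realType} (Q mu : R) : R :=
  2 * Q * (1 + ylip2 Q mu) / mu ^+ 2.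

Section hyperobjective.
Context {R : realType} {dx dy : nat}.
Context (Lf Cf L1 L2 mu : R).
Context (f g : 'cV[R]_(dx + dy) -> R).
Hypotheses (Lf0 : 0 <= Lf) (Cf0 : 0 <= Cf) (L10 : 0 <= L1) (L20 : 0 <= L2)
  (mu0 : 0 < mu).
Hypotheses (lf : lipschitz_grad Lf f)
  (bf : forall x, enorm (grad2 f x (ystar g x)) <= Cf)
  (l1 : lipschitz_grad L1 g) (l2 : lipschitz_hess L2 g)
  (sc : forall x : 'cV[R]_dx, strongly_convex mu (fun y => g (col_mx x y))).

Let r := Cf / mu.
Let Q := qlip Lf L1 L2 r.
Let H := hyperobj f g.
Let ys := ystar g.
Let zs := zstar f g.

Let r0 : 0 <= r. Proof. by rewrite divr_ge0 // ltW. Qed.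
Let Q0 : 0 <= Q. Proof. exact: qlip_ge0. Qed.
Let mu2 : 0 < mu ^+ 2. Proof. by rewrite exprn_gt0. Qed.

Lemma ylip2_ge0 : 0 <= ylip2 Q mu.
Proof. by rewrite divr_ge0 ?(ltW mu2) // mulr_ge0. Qed.

Lemma zlip2_ge0 : 0 <= zlip2 Q mu.
Proof.
by rewrite divr_ge0 ?(ltW mu2) // mulr_ge0 ?mulr_ge0 // addr_ge0 ?ylip2_ge0.
Qed.

Lemma hess22_zstar x : hess22 g x (ys x) *m zs x = grad2 f x (ys x).
Proof. by rewrite mulKVmx //; exact: (hess22_unit mu0 l1 l2 (sc x)). Qed.

Lemma Dz_star x : Dz f g x (ys x) (zs x) = 0.
Proof. by rewrite /Dz hess22_zstar subrr. Qed.

Lemma Dy_star x z : Dy f g x (ys x) z = 0.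
Proof. exact: (grad2_ystar mu0 l1 (sc x)). Qed.

Lemma enorm_zstar x : enorm (zs x) <= r.
Proof.
rewrite ler_pdivlMr // mulrC; apply: le_trans (bf x).
by rewrite -hess22_zstar; exact: (enorm_hess22_ge l1 l2 (sc x)).
Qed.

Lemma enorm_Dy_sq x y z :
  enorm (Dy f g x y z) ^+ 2 <= 2 * Q * enorm (y - ys x) ^+ 2.
Proof.
have := @Dy_increment _ _ _ Lf L1 L2 r L10 f g x (ys x) z x y z l1.
by rewrite (Dy_star x) subr0 subrr enorm0 expr0n add0r.
Qed.

Lemma enorm_Dz_sq x y z : enorm (Dz f g x y z) ^+ 2 <=
  2 * Q * (enorm (y - ys x) ^+ 2 + enorm (z - zs x) ^+ 2).
Proof.
have := @Dz_increment _ _ _ Lf L1 L2 r Lf0 L10 L20 r0 f g x (ys x) (zs x)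
  x y z lf l1 l2 (enorm_zstar x).
by rewrite (Dz_star x) subr0 /dist3 subrr enorm0 expr0n add0r.
Qed.

Lemma ystar_increment x x' :
  enorm (ys x' - ys x) ^+ 2 <= ylip2 Q mu * enorm (x' - x) ^+ 2.
Proof.
rewrite mulrAC ler_pdivlMr // mulrC -exprMn.
have := @Dy_increment _ _ _ Lf L1 L2 r L10 f g x (ys x) 0 x' (ys x) 0 l1.
rewrite (Dy_star x) subr0 subrr enorm0 expr0n addr0; apply: le_trans.
rewrite ler_sqr ?nnegrE ?mulr_ge0 ?enorm_ge0 ?(ltW mu0) //.
by rewrite enormB; exact: (dist_ystar mu0 l1 (sc x')).
Qed.

Lemma zstar_increment x x' :
  enorm (zs x' - zs x) ^+ 2 <= zlip2 Q mu * enorm (x' - x) ^+ 2.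
Proof.
rewrite mulrAC ler_pdivlMr // mulrC -exprMn.
have := @Dz_increment _ _ _ Lf L1 L2 r Lf0 L10 L20 r0 f g x (ys x) (zs x) x' (ys x')
  (zs x) lf l1 l2 (enorm_zstar x).
rewrite (Dz_star x) subr0 /dist3 subrr enorm0 expr0n addr0 => h.
apply: (@le_trans _ _ (enorm (Dz f g x' (ys x') (zs x)) ^+ 2)).
  rewrite ler_sqr ?nnegrE ?mulr_ge0 ?enorm_ge0 ?(ltW mu0) //.
  rewrite enormB -[Dz f g x' _ (zs x)]subr0 -(Dz_star x') /Dz.
  rewrite [X in _ <= enorm X](_ : _ = hess22 g x' (ys x') *m (zs x - zs x')).
    exact: (enorm_hess22_ge l1 l2 (sc x')).
  by rewrite mulmxBr opprB addrA subrK.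
apply: le_trans h _; rewrite -[leRHS]mulrA ler_wpM2l ?mulr_ge0 //.
have := ystar_increment x x'; lra.
Qed.

(** The hyperobjective differs from its linearisation by at most this constant
    times the squared displacement. *)
Definition Hlip : R := (Lf + L2 * r) * (1 + ylip2 Q mu).

Lemma Hlip_ge0 : 0 <= Hlip.
Proof.
have y0 := ylip2_ge0; have := mulr_ge0 L20 r0 => h.
by apply: mulr_ge0; apply: addr_ge0.
Qed.

(** The gradient of the hyperobjective, by [grad_hyperobj]. *)
Definition hypergrad x := Dx f g x (ys x) (zs x).

(** The lower-level optimality condition holds both at x and at x'; expanding
    it in the direction of zstar eliminates the unknown increment of ystar
    from the first-order expansion of f. The estimate is two-sided and
    quadratic, hence gives at once the gradient of the hyperobjective and the
    descent inequality. *)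
Lemma hyperobj_increment x x' :
  `|H x' - H x - dotv (hypergrad x) (x' - x)| <= Hlip * enorm (x' - x) ^+ 2.
Proof.
set u := col_mx x (ys x); set dl := col_mx (x' - x) (ys x' - ys x).
have ul : u + dl = col_mx x' (ys x').
  by rewrite add_col_mx [x + _]addrC [ys x + _]addrC !subrK.
have dn : enorm dl ^+ 2 <= (1 + ylip2 Q mu) * enorm (x' - x) ^+ 2.
  by rewrite enorm_col_mx mulrDl mul1r lerD2l ystar_increment.
have tf := lipschitz_grad_taylor u dl lf.
have tg := lipschitz_hess_taylor u dl (col_mx 0 (zs x)) l2.
move: tg; rewrite ul hess_col_mx0 dotv_col_mx enorm_col_mx0.
rewrite ![dotv (col_mx 0 _) _]dotvC !dotv_col_mx0.
have gu x1 : dsubmx (grad g (col_mx x1 (ys x1))) = 0 := Dy_star x1 0.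
rewrite !gu.
rewrite dot0v subrr sub0r normrN hess22_zstar => tg.
move: tf; rewrite ul -(vsubmxK (grad f u)) dotv_col_mx.
rewrite -[usubmx _]/(grad1 f x (ys x)) -[dsubmx _]/(grad2 f x (ys x)) => tf.
rewrite /hypergrad /Dx dotvBl.
have E : H x' - H x - (dotv (grad1 f x (ys x)) (x' - x)
     - dotv (hess12 g x (ys x) *m zs x) (x' - x)) =
  (f (col_mx x' (ys x')) - f u - (dotv (grad1 f x (ys x)) (x' - x)
     + dotv (grad2 f x (ys x)) (ys x' - ys x)))
  + (dotv (hess12 g x (ys x) *m zs x) (x' - x)
     + dotv (grad2 f x (ys x)) (ys x' - ys x)).
  by rewrite /H /hyperobj -/u; ring.
rewrite E; apply: le_trans (ler_normD _ _) _.
apply: le_trans (lerD tf tg) _.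
rewrite -mulrDl /Hlip -mulrA; apply: ler_pM => //.
- by rewrite addr_ge0 ?mulr_ge0 ?enorm_ge0.
- exact: sqr_ge0.
- by rewrite lerD2l ler_wpM2l // enorm_zstar.
Qed.

Lemma grad_hyperobj x : grad H x = hypergrad x.
Proof.
apply/matrixP => i k; rewrite (ord1 k) mxE /pderive /derive.
apply/cvg_lim => //; apply/cvgrPdist_le => e e0.
pose C := Hlip + 1.
have C0 : 0 < C by rewrite ltr_wpDl ?Hlip_ge0.
near=> t.
have t0 : t != 0 by near: t; exact: nbhs_dnbhs_neq.
have te : `|t| <= e / C.
  near: t; apply: dnbhs0_le; exact: divr_gt0.
have := hyperobj_increment x (t *: delta_mx i ord0 + x).
rewrite /= addrK dotvZr enormZ exprMn real_normK ?num_real //.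
rewrite enorm_sq !dotv_delta [delta_mx _ _ _ _]mxE !eqxx.
rewrite mulr1; set A := H _ - H x => h.
rewrite distrC.
have -> : t^-1 *: A - hypergrad x i ord0 = t^-1 * (A - t * hypergrad x i ord0).
  by rewrite mulrBr mulKf.
rewrite normrM normfV ler_pdivrMl ?normr_gt0 //.
apply: le_trans h _.
rewrite -[t ^+ 2]real_normK ?num_real // expr2 mulrCA ler_wpM2l //.
rewrite ler_pdivlMr // in te; apply: le_trans te; rewrite mulrC ler_wpM2l //.
by rewrite lerDl.
Unshelve. all: by end_near. Qed.

(** ** Progress of one iteration in each of the three variables *)

(** The direction vx is an inexact gradient: its distance to the hypergradient
    splits into the estimator error and the inexactness of y and z. *)
Lemma x_progress (alpha : R) x y z v : 0 <= alpha ->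
  H (x - alpha *: v) + alpha / 2 * enorm (grad H x) ^+ 2
    + alpha / 2 * enorm v ^+ 2 <=
  H x + alpha * enorm (v - Dx f g x y z) ^+ 2
    + alpha * (2 * Q) * (enorm (y - ys x) ^+ 2 + enorm (z - zs x) ^+ 2)
    + Hlip * alpha ^+ 2 * enorm v ^+ 2.
Proof.
move=> a0; rewrite grad_hyperobj.
have := hyperobj_increment x (x - alpha *: v).
rewrite addrDKl enormN enormZ exprMn real_normK ?num_real //.
rewrite dotvNr dotvZr => /(le_trans (ler_norm _)) h.
have := enormD_sq_le (v - Dx f g x y z) (Dx f g x y z - hypergrad x).
rewrite addrA subrK => h2.
have := @Dx_increment _ _ _ Lf L1 L2 r Lf0 L10 L20 r0 f g x (ys x) (zs x) x y z
  lf l1 l2 (enorm_zstar x).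
rewrite /dist3 subrr enorm0 expr0n add0r => h3.
have {}h3 : enorm (Dx f g x y z - hypergrad x) ^+ 2 <=
  2 * Q * (enorm (y - ys x) ^+ 2 + enorm (z - zs x) ^+ 2) := h3.
have h4 G : enorm (v - G) ^+ 2 =
    enorm v ^+ 2 - 2 * dotv G v + enorm G ^+ 2.
  by rewrite !enorm_sq !(dotvBl, dotvBr) (dotvC v G); ring.
have : alpha / 2 * enorm (v - hypergrad x) ^+ 2 <= alpha / 2 *
   (2 * (enorm (v - Dx f g x y z) ^+ 2 +
    2 * Q * (enorm (y - ys x) ^+ 2 + enorm (z - zs x) ^+ 2))).
  by apply: ler_wpM2l; [rewrite divr_ge0|apply: le_trans h2 _; lra].
rewrite h4; lra.
Qed.

(** One perturbed gradient step for an operator D that is monotone up to the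
    perturbation q: the expanded square, with Young's inequality applied to the
    three cross terms so that they consume a fixed share of the contraction. *)
Lemma monotone_step {d : nat} (b Y : R) (a D q e s : 'cV[R]_d) :
  0 < b -> b * mu <= 1 -> 24 * b * Q <= mu -> 0 <= Y ->
  mu * enorm a ^+ 2 + dotv a q <= dotv a D ->
  enorm q ^+ 2 <= 2 * Q * Y ->
  enorm D ^+ 2 <= 2 * Q * (enorm a ^+ 2 + Y) ->
  enorm (a - b *: (D + e) - s) ^+ 2 <=
    (1 - b * mu) * enorm a ^+ 2 + b * (8 * Q / mu + mu / 4) * Y
    + 7 / mu * b * enorm e ^+ 2 + 7 / (b * mu) * enorm s ^+ 2.
Proof.
move=> b0 bmu bQ Y0 mono hq hD.
have E : enorm (a - b *: (D + e) - s) ^+ 2 =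
    enorm a ^+ 2 - 2 * b * dotv a D - 2 * b * dotv a e - 2 * dotv a s
    + enorm (b *: D + b *: e + s) ^+ 2.
  rewrite -addrA -opprD scalerDr (enormD_sq a (- _)) enormN dotvNr !dotvDr.
  by rewrite !dotvZr; ring.
have tri := enormD3_sq_le (b *: D) (b *: e) s.
rewrite !enormZ !exprMn !real_normK ?num_real // in tri.
have m4 : 0 < mu / 4 by rewrite divr_gt0.
have Yq := dotv_young a (- q) m4; have Ye := dotv_young a (- e) m4.
have Ys := dotv_young a (- s) (mulr_gt0 b0 m4).
rewrite !enormN !dotvNr !invfM !invrK in Yq Ye Ys.
set A := enorm a ^+ 2 in mono hD E Yq Ye Ys *.
set ee := enorm e ^+ 2 in tri Ye *; set ss := enorm s ^+ 2 in tri Ys *.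
set DD := enorm D ^+ 2 in hD tri; set qq := enorm q ^+ 2 in hq Yq.
have A0 : 0 <= A := sqr_ge0 _.
have ee0 : 0 <= ee := sqr_ge0 _.
have ss0 : 0 <= ss := sqr_ge0 _.
have im : 0 < mu^-1 by rewrite invr_gt0.
have ib : 0 < b^-1 by rewrite invr_gt0.
have bn : b != 0 by rewrite gt_eqF.
have mn : mu != 0 by rewrite gt_eqF.
have hb : b ^+ 2 * DD <= b * (mu / 12) * (A + Y).
  apply: (@le_trans _ _ (b ^+ 2 * (2 * Q * (A + Y)))).
    by rewrite ler_wpM2l ?sqr_ge0.
  rewrite !mulrA ler_wpM2r ?addr_ge0 // expr2 -!mulrA ler_wpM2l ?(ltW b0) //; lra.
have hbe : b ^+ 2 * ee <= b * mu^-1 * ee.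
  rewrite ler_wpM2r // expr2 ler_wpM2l ?(ltW b0) // -[mu^-1]mul1r.
  by rewrite ler_pdivlMr.
have hs : ss <= b^-1 * mu^-1 * ss.
  rewrite -[X in X <= _]mul1r ler_wpM2r // -invfM -div1r.
  by rewrite ler_pdivlMr ?mulr_gt0 // mul1r.
have hbq := ler_wpM2l (ltW b0) Yq; have hbee := ler_wpM2l (ltW b0) Ye.
have hbm := ler_wpM2l (ltW b0) mono.
have hqq : b * mu^-1 * qq <= b * mu^-1 * (2 * Q * Y).
  by rewrite ler_wpM2l // mulr_ge0 // ltW.
rewrite E !invfM.
move: tri hb hbe hs hbq hbee hbm hqq Ys; lra.
Qed.

(** The target moves from ystar x to ystar x', which is the displacement s of
    the general step. *)
Lemma y_progress (beta : R) x x' y z v :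
  0 < beta -> beta * mu <= 1 -> 24 * beta * Q <= mu ->
  enorm (y - beta *: v - ys x') ^+ 2 <=
    (1 - beta * mu) * enorm (y - ys x) ^+ 2
    + 7 / mu * beta * enorm (v - Dy f g x y z) ^+ 2
    + 7 / (beta * mu) * (ylip2 Q mu * enorm (x' - x) ^+ 2).
Proof.
move=> b0 bmu bQ; set e := v - _.
have hD : enorm (Dy f g x y z) ^+ 2 <= 2 * Q * (enorm (y - ys x) ^+ 2 + 0).
  by rewrite addr0 enorm_Dy_sq.
have mono : mu * enorm (y - ys x) ^+ 2 + dotv (y - ys x) 0 <=
    dotv (y - ys x) (Dy f g x y z).
  rewrite dotv0 addr0 dotvC -[Dy f g x y z]subr0 -(Dy_star x z).
  exact: (strongly_monotone l1 (sc x)).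
have hq : enorm (0 : 'cV[R]_dy) ^+ 2 <= 2 * Q * 0 by rewrite enorm0 expr0n mulr0.
have := monotone_step e (ys x' - ys x) b0 bmu bQ (lexx 0) mono hq hD.
rewrite mulr0 addr0 /e [Dy _ _ _ _ _ + _]addrC subrK.
rewrite (_ : y - ys x - _ - _ = y - beta *: v - ys x'); last first.
  by move: (ys x) (ys x') => a a'; apply/matrixP => i j; rewrite !mxE; ring.
move=> h; apply: le_trans h _; rewrite lerD2l ler_wpM2l ?ystar_increment //.
by rewrite divr_ge0 ?mulr_ge0 // ltW.
Qed.

(** The operator of z is monotone only at y = ystar x; elsewhere the defect is
    the value of Dz at zstar. The new target also lies in the ball, so the
    projection does not increase the distance to it. *)
Lemma z_progress (gamma : R) x x' y z v :
  0 < gamma -> gamma * mu <= 1 -> 24 * gamma * Q <= mu ->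
  enorm (proj_ball r (z - gamma *: v) - zs x') ^+ 2 <=
    (1 - gamma * mu) * enorm (z - zs x) ^+ 2
    + gamma * (8 * Q / mu + mu / 4) * enorm (y - ys x) ^+ 2
    + 7 / mu * gamma * enorm (v - Dz f g x y z) ^+ 2
    + 7 / (gamma * mu) * (zlip2 Q mu * enorm (x' - x) ^+ 2).
Proof.
move=> b0 bmu bQ; set e := v - _.
have hD : enorm (Dz f g x y z) ^+ 2 <=
    2 * Q * (enorm (z - zs x) ^+ 2 + enorm (y - ys x) ^+ 2).
  by rewrite [_ + enorm (y - _) ^+ 2]addrC enorm_Dz_sq.
have hq : enorm (Dz f g x y (zs x)) ^+ 2 <= 2 * Q * enorm (y - ys x) ^+ 2.
  by have := enorm_Dz_sq x y (zs x); rewrite subrr enorm0 expr0n addr0.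
have mono : mu * enorm (z - zs x) ^+ 2
      + dotv (z - zs x) (Dz f g x y (zs x)) <=
    dotv (z - zs x) (Dz f g x y z).
  rewrite -lerBrDr -dotvBr (_ : Dz f g x y z - _ = hess22 g x y *m (z - zs x)).
    exact: (hess22_coercive l1 l2 (sc x)).
  by rewrite mulmxBr /Dz opprB addrA subrK.
have := monotone_step e (zs x' - zs x) b0 bmu bQ (sqr_ge0 _) mono hq hD.
rewrite /e [Dz _ _ _ _ _ + _]addrC subrK.
rewrite (_ : z - zs x - _ - _ = z - gamma *: v - zs x'); last first.
  by move: (zs x) (zs x') => a a'; apply/matrixP => i j; rewrite !mxE; ring.
move=> h; apply: (@le_trans _ _ (enorm (z - gamma *: v - zs x') ^+ 2)).
  rewrite ler_sqr ?nnegrE ?enorm_ge0 //.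
  rewrite -{1}(proj_ball_id r0 (enorm_zstar x')).
  exact: proj_ball_nonexpansive.
apply: le_trans h _; rewrite lerD2l ler_wpM2l ?zstar_increment //.
by rewrite divr_ge0 ?mulr_ge0 // ltW.
Qed.

Lemma y_move (beta : R) x y z v :
  enorm (y - beta *: v - y) ^+ 2 <= beta ^+ 2 *
    (4 * Q * enorm (y - ys x) ^+ 2 + 2 * enorm (v - Dy f g x y z) ^+ 2).
Proof.
rewrite addrDKl enormN enormZ exprMn real_normK ?num_real //.
apply: ler_wpM2l; first exact: sqr_ge0.
have := enorm_Dy_sq x y z.
have := enormD_sq_le (v - Dy f g x y z) (Dy f g x y z); rewrite subrK.
move: (Dy f g x y z) (Dz f g x y z) => D D'; lra.
Qed.

Lemma z_move (gamma : R) x y z v : enorm z <= r ->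
  enorm (proj_ball r (z - gamma *: v) - z) ^+ 2 <= gamma ^+ 2 *
    (4 * Q * (enorm (y - ys x) ^+ 2 + enorm (z - zs x) ^+ 2)
     + 2 * enorm (v - Dz f g x y z) ^+ 2).
Proof.
move=> zr; apply: (@le_trans _ _ (enorm (z - gamma *: v - z) ^+ 2)).
  rewrite ler_sqr ?nnegrE ?enorm_ge0 // -{2}(proj_ball_id r0 zr).
  exact: proj_ball_nonexpansive.
rewrite addrDKl enormN enormZ exprMn real_normK ?num_real //.
apply: ler_wpM2l; first exact: sqr_ge0.
have := enorm_Dz_sq x y z.
have := enormD_sq_le (v - Dz f g x y z) (Dz f g x y z); rewrite subrK.
move: (Dy f g x y z) (Dz f g x y z) => D D'; lra.
Qed.

End hyperobjective.

(** * The Lyapunov function *)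

Section constants.
Context {R : realType}.
Implicit Type M : R.

(** The constants are functions of one number M >= 1 that dominates all the
    Lipschitz constants of the problem. The rates are the products of the
    weight of the squared distance of y, resp. z, with the ratio of its step
    size to the one of x; they fix how fast these distances contract. *)
Definition rate_z M : R := M * (M + 1).
Definition rate_y M : R := M * (M + 1 + M * rate_z M).
Definition step_y M : R := 8 * M * rate_y M.
Definition step_z M : R := 8 * M * rate_z M.
Definition weight_v M : R := 1 + M * (rate_y M + rate_z M).
Definition weight_yz M : R := (8 * M)^-1.
Definition step_x M : R :=
  (24 * weight_v M * M ^+ 2 * (step_y M ^+ 2 + step_z M ^+ 2))^-1.

Lemma rate_z_ge1 M : 1 <= M -> 1 <= rate_z M.
Proof.
move=> M1; have h := ler_pM ler01 ler01 M1 M1; rewrite mulr1 in h.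
by rewrite /rate_z; lra.
Qed.

Lemma rate_y_ge1 M : 1 <= M -> 1 <= rate_y M.
Proof.
move=> M1; have M0 := lt_le_trans ltr01 M1.
have := rate_z_ge1 M1; rewrite /rate_y => z1.
have Mz : 0 <= M * rate_z M by rewrite mulr_ge0 // ?(ltW M0) // (le_trans ler01).
have h : 1 <= M + 1 + M * rate_z M by lra.
by have := ler_pM ler01 ler01 M1 h; rewrite mulr1; lra.
Qed.

Lemma step_y_ge1 M : 1 <= M -> 1 <= step_y M.
Proof.
move=> M1; have h : 1 <= 8 * M by lra.
by have := ler_pM ler01 ler01 h (rate_y_ge1 M1); rewrite mulr1.
Qed.

Lemma step_z_ge1 M : 1 <= M -> 1 <= step_z M.
Proof.
move=> M1; have h : 1 <= 8 * M by lra.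
by have := ler_pM ler01 ler01 h (rate_z_ge1 M1); rewrite mulr1.
Qed.

Lemma weight_v_ge M : 1 <= M -> [/\ 1 <= weight_v M, M * rate_y M + 1 <= weight_v M
  & M * rate_z M + 1 <= weight_v M].
Proof.
move=> M1; have M0 := lt_le_trans ltr01 M1.
have := rate_z_ge1 M1; have := rate_y_ge1 M1; rewrite /weight_v => y1 z1.
have Mz : 0 <= M * rate_z M by rewrite mulr_ge0 // ?(ltW M0) // (le_trans ler01).
have My : 0 <= M * rate_y M by rewrite mulr_ge0 // ?(ltW M0) // (le_trans ler01).
by split; lra.
Qed.

(** The step size of x is the inverse of a product into which all the other
    constants enter, hence small against each of the second-order terms. *)
Lemma step_x_small M : 1 <= M -> [/\ 0 < step_x M, M * step_x M <= 8^-1,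
  M * (step_y M * step_x M) <= 1, M * (step_z M * step_x M) <= 1 &
  [/\ 3 * weight_v M * M * step_x M ^+ 2 <= 8^-1,
      3 * weight_v M * M * step_x M ^+ 2 * (M * step_y M ^+ 2) <= 8^-1 &
      3 * weight_v M * M * step_x M ^+ 2 * (M * step_z M ^+ 2) <= 8^-1]].
Proof.
move=> M1; have M0 := lt_le_trans ltr01 M1.
have y1 := step_y_ge1 M1; have z1 := step_z_ge1 M1.
have [k1 _ _] := weight_v_ge M1.
set cy := step_y M in y1 *; set cz := step_z M in z1 *.
set k := weight_v M in k1 *.
have cyy : cy <= cy ^+ 2 by rewrite expr2 ler_peMl // (le_trans ler01).
have czz : cz <= cz ^+ 2 by rewrite expr2 ler_peMl // (le_trans ler01).
have MM : M <= M ^+ 2 by rewrite expr2 ler_peMl // ltW.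
set S := cy ^+ 2 + cz ^+ 2.
have S1 : 1 <= S by rewrite /S; lra.
have D0 : 0 < 24 * k * M ^+ 2 * S.
  by rewrite !mulr_gt0 ?exprn_gt0 // ?(lt_le_trans ltr01).
set c := step_x M.
have c0 : 0 < c by rewrite invr_gt0.
have cE : 24 * k * M ^+ 2 * S * c = 1 by rewrite /c /step_x mulfV // gt_eqF.
have k0 : 0 <= k by lra.
have S0 : 0 <= S by lra.
have kc : 0 <= k * c by rewrite mulr_ge0 // ltW.
(* Each claim follows from the identity above by dropping factors that are at
   least one. *)
have MSc : M ^+ 2 * S * c <= 24^-1.
  have : 1 * (M ^+ 2 * S * c) <= k * (M ^+ 2 * S * c).
    by rewrite ler_wpM2r // !mulr_ge0 ?sqr_ge0 // ltW.
  by lra.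
have Mc (t : R) : 0 <= t -> t <= S -> M * (t * c) <= 24^-1.
  move=> t0 tS; apply: le_trans MSc; rewrite mulrA ler_wpM2r ?(ltW c0) //.
  by apply: ler_pM => //; exact: ltW.
have c1 : c <= 1.
  have := Mc 1 ler01 S1; rewrite mul1r => h.
  have : 1 * c <= M * c by rewrite ler_wpM2r // ltW.
  by lra.
have kMSc : 3 * k * M ^+ 2 * S * c ^+ 2 <= 8^-1.
  have -> : 3 * k * M ^+ 2 * S * c ^+ 2 = (24 * k * M ^+ 2 * S * c) * (8^-1 * c).
    by field.
  by rewrite cE mul1r; lra.
have kMt (t : R) : 0 <= t -> t <= M * S -> 3 * k * M * c ^+ 2 * t <= 8^-1.
  move=> t0 tS; apply: le_trans kMSc.
  have -> : 3 * k * M ^+ 2 * S * c ^+ 2 = 3 * k * M * c ^+ 2 * (M * S) by ring.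
  rewrite ler_wpM2l // !mulr_ge0 ?sqr_ge0 //; exact: ltW.
split=> //.
- by have := Mc 1 ler01 S1; rewrite mul1r; lra.
- by have := Mc cy; rewrite /S; lra.
- by have := Mc cz; rewrite /S; lra.
split.
- have := kMt 1 ler01; rewrite mulr1; apply.
  by have := ler_pM ler01 ler01 M1 S1; rewrite mulr1.
- apply: kMt; first by rewrite mulr_ge0 ?sqr_ge0 // ltW.
  by rewrite ler_wpM2l ?(ltW M0) // lerDl sqr_ge0.
- apply: kMt; first by rewrite mulr_ge0 ?sqr_ge0 // ltW.
  by rewrite ler_wpM2l ?(ltW M0) // lerDr sqr_ge0.
Qed.

(** The weights are fixed backwards. The distance of z must absorb what it
    costs the objective, then the distance of y must absorb in addition what it
    costs z, and the estimator errors absorb the rest; large ratios of the step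
    sizes of y and z to the one of x make the motion of the two solution maps
    negligible against the decrease of order alpha |vx|^2. *)
Lemma lyapunov_real M (alpha s H H' A X Y Y' Z Z' Ex Ey Ez N : R) :
  1 <= M -> 0 < alpha <= step_x M -> 0 <= s -> alpha ^+ 2 * s <= step_x M ^+ 2 ->
  0 <= X -> 0 <= Y -> 0 <= Z -> 0 <= Ex -> 0 <= Ey -> 0 <= Ez ->
  let beta := step_y M * alpha in let gamma := step_z M * alpha in
  H' + alpha / 2 * A + alpha / 2 * X
    <= H + alpha * Ex + alpha * M * (Y + Z) + M * alpha ^+ 2 * X ->
  Y' + beta / M * Y <= Y + M * beta * Ey + M / beta * (alpha ^+ 2 * X) ->
  Z' + gamma / M * Z <=
    Z + M * gamma * Y + M * gamma * Ez + M / gamma * (alpha ^+ 2 * X) ->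
  N <= alpha ^+ 2 * X + M * beta ^+ 2 * (Y + Ey) + M * gamma ^+ 2 * (Y + Z + Ez) ->
  H' + weight_yz M * (Y' + Z') + 3 * weight_v M * M * alpha * s * N
    + alpha / 2 * A <=
  H + weight_yz M * (Y + Z) + weight_v M * alpha * (Ex + Ey + Ez).
Proof.
move=> M1 /andP[a0 ac] s0 as2 X0 Y0 Z0 Ex0 Ey0 Ez0.
have M0 := lt_le_trans ltr01 M1.
have [c0 c1 _ _ [k1 k2 k3]] := step_x_small M1.
have [kv kvy kvz] := weight_v_ge M1.
have y1 := step_y_ge1 M1; have z1 := step_z_ge1 M1.
have ry1 := rate_y_ge1 M1; have rz1 := rate_z_ge1 M1.
set cy := step_y M in y1 k2 *; set cz := step_z M in z1 k3 *.
move=> beta gamma hH hY hZ hN.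
have cy0 : 0 < cy by lra.
have cz0 : 0 < cz by lra.
have Mn : M != 0 by rewrite gt_eqF.
have an : alpha != 0 by rewrite gt_eqF.
have cyn : cy != 0 by rewrite gt_eqF.
have czn : cz != 0 by rewrite gt_eqF.
have w0 : 0 < weight_yz M by rewrite invr_gt0; lra.
have rny : rate_y M != 0 by rewrite gt_eqF //; lra.
have rnz : rate_z M != 0 by rewrite gt_eqF //; lra.
have wb : weight_yz M * beta = rate_y M * alpha.
  by rewrite /beta /cy /step_y /weight_yz; field.
have wg : weight_yz M * gamma = rate_z M * alpha.
  by rewrite /gamma /cz /step_z /weight_yz; field.
have wbX : weight_yz M * (M / beta * (alpha ^+ 2 * X)) <= 8^-1 * alpha * X.
  have -> : weight_yz M * (M / beta * (alpha ^+ 2 * X)) = 8^-1 * alpha * X * cy^-1.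
    by rewrite /beta /weight_yz; field; rewrite cyn an Mn.
  by rewrite ler_piMr ?invf_le1 // !mulr_ge0 ?invr_ge0 // ltW.
have wgX : weight_yz M * (M / gamma * (alpha ^+ 2 * X)) <= 8^-1 * alpha * X.
  have -> : weight_yz M * (M / gamma * (alpha ^+ 2 * X)) = 8^-1 * alpha * X * cz^-1.
    by rewrite /gamma /weight_yz; field; rewrite czn an Mn.
  by rewrite ler_piMr ?invf_le1 // !mulr_ge0 ?invr_ge0 // ltW.
have aX : 0 <= alpha * X by rewrite mulr_ge0 // ltW.
have MX : M * alpha ^+ 2 * X <= 8^-1 * (alpha * X).
  have -> : M * alpha ^+ 2 * X = M * alpha * (alpha * X) by ring.
  rewrite ler_wpM2r //; apply: le_trans c1.
  by rewrite ler_wpM2l // ltW.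
have NN : 3 * weight_v M * M * alpha * s * N <=
    8^-1 * (alpha * (X + (Y + Ey) + (Y + Z + Ez))).
  set W := X + M * cy ^+ 2 * (Y + Ey) + M * cz ^+ 2 * (Y + Z + Ez).
  have M0' := ltW M0.
  have W0 : 0 <= W.
    have Mt (t u : R) : 0 <= u -> 0 <= M * t ^+ 2 * u.
      by move=> u0; rewrite mulr_ge0 // mulr_ge0 ?sqr_ge0.
    by rewrite /W; apply: addr_ge0; [apply: addr_ge0 => //|];
      apply: Mt; rewrite ?addr_ge0.
  have hN' : N <= alpha ^+ 2 * W.
    by apply: le_trans hN _; rewrite /W /beta /gamma !exprMn; lra.
  have kM0 : 0 <= 3 * weight_v M * M by rewrite !mulr_ge0 //; lra.
  apply: (@le_trans _ _ (3 * weight_v M * M * alpha * (step_x M ^+ 2 * W))).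
    rewrite -[leLHS]mulrA ler_wpM2l //; first by rewrite mulr_ge0 // ltW.
    apply: (@le_trans _ _ (s * (alpha ^+ 2 * W))); first exact: ler_wpM2l.
    by rewrite mulrA ler_wpM2r // mulrC.
  have -> : 3 * weight_v M * M * alpha * (step_x M ^+ 2 * W) = alpha *
    (3 * weight_v M * M * step_x M ^+ 2 * X
     + 3 * weight_v M * M * step_x M ^+ 2 * (M * cy ^+ 2) * (Y + Ey)
     + 3 * weight_v M * M * step_x M ^+ 2 * (M * cz ^+ 2) * (Y + Z + Ez)).
    by rewrite /W; ring.
  rewrite [leRHS]mulrCA ler_wpM2l ?(ltW a0) //.
  apply: (@le_trans _ _ (8^-1 * X + 8^-1 * (Y + Ey)
     + 8^-1 * (Y + Z + Ez))); last by lra.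
  by apply: lerD; [apply: lerD|]; rewrite ler_wpM2r ?addr_ge0.
have hY' := ler_wpM2l (ltW w0) hY; have hZ' := ler_wpM2l (ltW w0) hZ.
have eY : weight_yz M * (Y' + beta / M * Y) =
    weight_yz M * Y' + alpha * (M + 1 + M * rate_z M) * Y.
  rewrite mulrDr (_ : _ * (_ * Y) = (weight_yz M * beta) / M * Y); last by ring.
  by rewrite wb /rate_y; field; exact: Mn.
have eY2 : weight_yz M * (Y + M * beta * Ey + M / beta * (alpha ^+ 2 * X)) =
    weight_yz M * Y + M * (rate_y M * alpha) * Ey
    + weight_yz M * (M / beta * (alpha ^+ 2 * X)).
  by rewrite -wb; ring.
have eZ : weight_yz M * (Z' + gamma / M * Z) =
    weight_yz M * Z' + alpha * (M + 1) * Z.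
  rewrite mulrDr (_ : _ * (_ * Z) = (weight_yz M * gamma) / M * Z); last by ring.
  by rewrite wg /rate_z; field; exact: Mn.
have eZ2 : weight_yz M * (Z + M * gamma * Y + M * gamma * Ez
      + M / gamma * (alpha ^+ 2 * X)) =
    weight_yz M * Z + M * (rate_z M * alpha) * (Y + Ez)
    + weight_yz M * (M / gamma * (alpha ^+ 2 * X)).
  by rewrite -wg; ring.
rewrite eY eY2 in hY'; rewrite eZ eZ2 in hZ'.
have a0' := ltW a0.
have kEx : alpha * Ex <= weight_v M * alpha * Ex.
  by rewrite -mulrA ler_peMl // mulr_ge0.
have kEy : (M * rate_y M + 1) * (alpha * Ey) <= weight_v M * (alpha * Ey).
  by rewrite ler_wpM2r // mulr_ge0.
have kEz : (M * rate_z M + 1) * (alpha * Ez) <= weight_v M * (alpha * Ez).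
  by rewrite ler_wpM2r // mulr_ge0.
have aY : 0 <= alpha * Y by rewrite mulr_ge0.
have aZ : 0 <= alpha * Z by rewrite mulr_ge0.
have aEy : 0 <= alpha * Ey by rewrite mulr_ge0.
have aEz : 0 <= alpha * Ez by rewrite mulr_ge0.
move: hH hY' hZ' wbX wgX MX NN kEx kEy kEz aX aY aZ aEy aEz.
move: (weight_yz M * (M / beta * _)) (weight_yz M * (M / gamma * _)) => t1 t2.
clear; lra.
Qed.

End constants.

Section lyapunov_step.
Context {R : realType} {dx dy : nat}.
Context (Lf Cf L1 L2 mu : R).
Context (f g : 'cV[R]_(dx + dy) -> R).

(** One bound for every constant of the progress inequalities; the quotient by
    mu bounds the coefficients of the contraction steps. *)
Definition spaba_const : R :=
  let Q := qlip Lf L1 L2 (Cf / mu) in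
  3 + 4 * Q + Hlip Lf Cf L1 L2 mu + mu
  + (32 * Q + 7 + 7 * ylip2 Q mu + 7 * zlip2 Q mu) / mu.

Definition potential (x : 'cV[R]_dx) (y z : 'cV[R]_dy) : R :=
  hyperobj f g x - inf (range (hyperobj f g))
  + weight_yz spaba_const *
    (enorm (y - ystar g x) ^+ 2 + enorm (z - zstar f g x) ^+ 2).

Hypotheses (Lf0 : 0 <= Lf) (Cf0 : 0 <= Cf) (L10 : 0 <= L1) (L20 : 0 <= L2)
  (mu0 : 0 < mu).

Let Q := qlip Lf L1 L2 (Cf / mu).
Let M := spaba_const.

Lemma spaba_const_ge : [/\ 3 <= M, 4 * Q + 2 <= M, Hlip Lf Cf L1 L2 mu <= M,
    mu <= M & (32 * Q + 7 + 7 * ylip2 Q mu + 7 * zlip2 Q mu) / mu <= M].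
Proof.
have Q0 : 0 <= Q := qlip_ge0 _ _ _ _.
have H0 : 0 <= Hlip Lf Cf L1 L2 mu by exact: Hlip_ge0.
have y0 : 0 <= ylip2 Q mu by exact: ylip2_ge0.
have z0 : 0 <= zlip2 Q mu by exact: zlip2_ge0.
have D0 : 0 <= (32 * Q + 7 + 7 * ylip2 Q mu + 7 * zlip2 Q mu) / mu.
  by rewrite divr_ge0 // ?ltW //; lra.
have m0 : 0 < mu := mu0.
by split; rewrite /M /spaba_const -/Q; lra.
Qed.

Hypotheses (lf : lipschitz_grad Lf f)
  (bf : forall x, enorm (grad2 f x (ystar g x)) <= Cf)
  (l1 : lipschitz_grad L1 g) (l2 : lipschitz_hess L2 g)
  (sc : forall x : 'cV[R]_dx, strongly_convex mu (fun y => g (col_mx x y))).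

(** Deterministic part of the descent. The squared motion of the iterates is
    kept on the left because the variance of the minibatch increments is
    proportional to it. *)
Lemma lyapunov_step (alpha s : R) x y z vx vy vz x' y' z' :
  0 < alpha <= step_x M -> 0 <= s -> alpha ^+ 2 * s <= step_x M ^+ 2 ->
  enorm z <= Cf / mu ->
  x' = x - alpha *: vx -> y' = y - (step_y M * alpha) *: vy ->
  z' = proj_ball (Cf / mu) (z - (step_z M * alpha) *: vz) ->
  potential x' y' z' + 3 * weight_v M * M * alpha * s * dist3 x y z x' y' z'
    + alpha / 2 * enorm (grad (hyperobj f g) x) ^+ 2 <=
  potential x y z + weight_v M * alpha *
    (enorm (vx - Dx f g x y z) ^+ 2 + enorm (vy - Dy f g x y z) ^+ 2
     + enorm (vz - Dz f g x y z) ^+ 2).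
Proof.
have m0 : 0 < mu := mu0.
have shift (h h' i q q' t u v : R) : h' + q' + t + u <= h + q + v ->
    h' - i + q' + t + u <= h - i + q + v by lra.
move=> /[dup] ha /andP[a0 ac] s0 as2 zr xE yE zE.
have [M3 MQ MH Mmu MD] := spaba_const_ge.
have M1 : 1 <= M by lra.
have M0 : 0 < M by lra.
have Q0 : 0 <= Q := qlip_ge0 _ _ _ _.
have yl0 : 0 <= ylip2 Q mu by exact: ylip2_ge0.
have zl0 : 0 <= zlip2 Q mu by exact: zlip2_ge0.
have [c0 _ cby cbz _] := step_x_small M1.
have y1 := step_y_ge1 M1; have z1 := step_z_ge1 M1.
have MDmu : 32 * Q + 7 + 7 * ylip2 Q mu + 7 * zlip2 Q mu <= M * mu.
  by rewrite -ler_pdivrMr.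
have small (t : R) : 1 <= t -> M * (t * step_x M) <= 1 ->
    [/\ 0 < t * alpha, t * alpha * mu <= 1 & 24 * (t * alpha) * Q <= mu].
  move=> t1 Mt; have t0 : 0 < t by lra.
  have ta0 : 0 < t * alpha by rewrite mulr_gt0.
  have Mta : M * (t * alpha) <= 1.
    apply: le_trans Mt; rewrite ler_wpM2l ?(ltW M0) //.
    by rewrite ler_wpM2l ?(ltW t0).
  split=> //.
    by apply: le_trans Mta; rewrite mulrC ler_wpM2r // ltW.
  have h1 : (t * alpha) * (32 * Q) <= (t * alpha) * (M * mu).
    by rewrite ler_wpM2l ?(ltW ta0) //; lra.
  have h2 : mu * (M * (t * alpha)) <= mu * 1 by rewrite ler_wpM2l ?(ltW mu0).
  have h3 : 0 <= t * alpha * Q by rewrite mulr_ge0 ?(ltW ta0).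
  by lra.
have [b0 bmu bQ] := small _ y1 cby; have [g0 gmu gQ] := small _ z1 cbz.
set beta := step_y M * alpha in b0 bmu bQ yE *.
set gamma := step_z M * alpha in g0 gmu gQ zE *.
have im : mu^-1 <= M.
  by rewrite -[mu^-1]mul1r ler_pdivrMr //; lra.
have iM : M^-1 <= mu by rewrite -[mu]invrK lef_pV2 // posrE ?invr_gt0.
have i7 : 7 / mu <= M by rewrite ler_pdivrMr //; lra.
have xx : enorm (x' - x) ^+ 2 = alpha ^+ 2 * enorm vx ^+ 2.
  by rewrite xE addrDKl enormN enormZ exprMn real_normK ?num_real.
set Y := enorm (y - ystar g x) ^+ 2; set Z := enorm (z - zstar f g x) ^+ 2.
set Ex := enorm (vx - _) ^+ 2; set Ey := enorm (vy - _) ^+ 2.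
set Ez := enorm (vz - _) ^+ 2; set X := enorm vx ^+ 2 in xx.
have Y0 : 0 <= Y := sqr_ge0 _. have Z0 : 0 <= Z := sqr_ge0 _.
have X0 : 0 <= X := sqr_ge0 _. have Ex0 : 0 <= Ex := sqr_ge0 _.
have Ey0 : 0 <= Ey := sqr_ge0 _. have Ez0 : 0 <= Ez := sqr_ge0 _.
have hH : hyperobj f g x' + alpha / 2 * enorm (grad (hyperobj f g) x) ^+ 2
    + alpha / 2 * X <= hyperobj f g x + alpha * Ex + alpha * (2 * Q) * (Y + Z)
    + Hlip Lf Cf L1 L2 mu * alpha ^+ 2 * X.
  rewrite xE.
  exact: (x_progress Lf0 Cf0 L10 L20 mu0 lf bf l1 l2 sc x y z vx (ltW a0)).
have hY : enorm (y' - ystar g x') ^+ 2 <= (1 - beta * mu) * Y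
    + 7 / mu * beta * Ey + 7 / (beta * mu) * (ylip2 Q mu * (alpha ^+ 2 * X)).
  rewrite -xx yE.
  exact: (y_progress f L10 mu0 l1 sc x x' y z vy b0 bmu bQ).
have hZ : enorm (z' - zstar f g x') ^+ 2 <= (1 - gamma * mu) * Z
    + gamma * (8 * Q / mu + mu / 4) * Y + 7 / mu * gamma * Ez
    + 7 / (gamma * mu) * (zlip2 Q mu * (alpha ^+ 2 * X)).
  rewrite -xx zE.
  exact: (z_progress Lf0 Cf0 L10 L20 mu0 lf bf l1 l2 sc x x' y z vz g0 gmu gQ).
have mY : enorm (y' - y) ^+ 2 <= beta ^+ 2 * (4 * Q * Y + 2 * Ey).
  rewrite yE; exact: (y_move Lf Cf L2 f L10 mu0 l1 sc beta x y z vy).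
have mZ : enorm (z' - z) ^+ 2 <= gamma ^+ 2 * (4 * Q * (Y + Z) + 2 * Ez).
  rewrite zE; exact: (z_move Lf0 Cf0 L10 L20 mu0 lf bf l1 l2 sc gamma x y vz zr).
rewrite /potential -/M.
have h7 (t E : R) : 0 < t -> 0 <= E -> 7 / mu * t * E <= M * t * E.
  by move=> t0 E0; rewrite ler_wpM2r // ler_wpM2r // ltW.
have hl (t l : R) : 0 < t -> 7 * l <= M * mu ->
   7 / (t * mu) * (l * (alpha ^+ 2 * X)) <= M / t * (alpha ^+ 2 * X).
  move=> t0 lM; have W0 : 0 <= alpha ^+ 2 * X by rewrite mulr_ge0 ?sqr_ge0.
  move: (alpha ^+ 2 * X) W0 => W W0.
  rewrite (_ : _ * (l * W) = 7 * l / mu / t * W); last by rewrite invfM; ring.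
  by rewrite ler_wpM2r // ler_wpM2r ?ler_pdivrMr // ltW // invr_gt0.
have hm (t E : R) : 0 < t -> 0 <= E -> t / M * E <= t * mu * E.
  by move=> t0 E0; rewrite ler_wpM2r // ler_wpM2l // ltW.
have := @lyapunov_real _ M alpha s (hyperobj f g x) (hyperobj f g x')
  (enorm (grad (hyperobj f g) x) ^+ 2) X Y (enorm (y' - ystar g x') ^+ 2)
  Z (enorm (z' - zstar f g x') ^+ 2) Ex Ey Ez (dist3 x y z x' y' z')
  M1 ha s0 as2 X0 Y0 Z0 Ex0 Ey0 Ez0.
rewrite -/beta -/gamma => LR.
have {}LR : hyperobj f g x' + weight_yz M *
   (enorm (y' - ystar g x') ^+ 2 + enorm (z' - zstar f g x') ^+ 2)
   + 3 * weight_v M * M * alpha * s * dist3 x y z x' y' z'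
   + alpha / 2 * enorm (grad (hyperobj f g) x) ^+ 2 <=
   hyperobj f g x + weight_yz M * (Y + Z) + weight_v M * alpha * (Ex + Ey + Ez).
  apply: LR.
  - apply: le_trans hH _; apply: lerD.
      rewrite lerD2l ler_wpM2r ?addr_ge0 // ler_wpM2l ?(ltW a0) //; lra.
    by rewrite ler_wpM2r // ler_wpM2r ?sqr_ge0.
  - have k1 := hm _ _ b0 Y0; have k2 := h7 _ _ b0 Ey0.
    have k3 : 7 * ylip2 Q mu <= M * mu by lra.
    have := hl _ _ b0 k3; lra.
  - have k1 := hm _ _ g0 Z0; have k2 := h7 _ _ g0 Ez0.
    have k3 : 7 * zlip2 Q mu <= M * mu by lra.
    have := hl _ _ g0 k3.
    have k4 : gamma * (8 * Q / mu + mu / 4) * Y <= M * gamma * Y.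
      rewrite ler_wpM2r // mulrC ler_wpM2r ?(ltW g0) //.
      have : 8 * Q / mu + 3 / 4 * mu <= M.
        have e : (32 * Q + 7 + 7 * ylip2 Q mu + 7 * zlip2 Q mu) / mu =
          4 * (8 * Q / mu) + (7 + 7 * ylip2 Q mu + 7 * zlip2 Q mu) / mu.
          by field; rewrite gt_eqF.
        have : 0 <= 8 * Q / mu by rewrite divr_ge0 ?mulr_ge0 ?(ltW mu0).
        have : 0 <= (7 + 7 * ylip2 Q mu + 7 * zlip2 Q mu) / mu.
          by rewrite divr_ge0 ?(ltW mu0) //; lra.
        have h0 : 0 <= Hlip Lf Cf L1 L2 mu by exact: Hlip_ge0.
        rewrite /M /spaba_const -/Q e; lra.
      by lra.
    by lra.
  - rewrite /dist3 xx; apply: lerD; first (rewrite lerD2l).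
      apply: le_trans mY _; apply: (@le_trans _ _ (beta ^+ 2 * (M * (Y + Ey)))).
        apply: ler_wpM2l; first exact: sqr_ge0.
        have := ler_wpM2r Y0 MQ; have := ler_wpM2r Ey0 MQ.
        by have := mulr_ge0 Q0 Ey0; lra.
      by rewrite mulrCA mulrA.
    apply: le_trans mZ _.
    apply: (@le_trans _ _ (gamma ^+ 2 * (M * (Y + Z + Ez)))).
      apply: ler_wpM2l; first exact: sqr_ge0.
      have := ler_wpM2r Y0 MQ; have := ler_wpM2r Z0 MQ.
      have := ler_wpM2r Ez0 MQ; by have := mulr_ge0 Q0 Ez0; lra.
    by rewrite mulrCA mulrA.
exact: shift LR.
Qed.

End lyapunov_step.

(** * Variance of a minibatch mean *)

Section minibatch.
Context {R : realType}.

Section one_batch.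
Context {N b : nat} (N0 : (0 < N)%N) (b0 : (0 < b)%N).

Let NR : (N%:R : R) != 0. Proof. by rewrite pnatr_eq0 -lt0n. Qed.
Let bR : (b%:R : R) != 0. Proof. by rewrite pnatr_eq0 -lt0n. Qed.

(** A sum over all minibatches of a product of functions of the single draws is
    a product of sums; the two moments needed are of this form. *)
Lemma sum_batch_marginal (phi : 'I_N -> R) (l : 'I_b) :
  \sum_(f : {ffun 'I_b -> 'I_N}) phi (f l) =
    N%:R ^+ b * (N%:R^-1 * \sum_s phi s).
Proof.
pose Fm (k : 'I_b) (s : 'I_N) := if k == l then phi s else 1.
transitivity (\sum_(f : {ffun 'I_b -> 'I_N}) \prod_k Fm k (f k)).
  apply: eq_bigr => f _; rewrite (bigD1 l) //= big1 ?mulr1 /Fm ?eqxx // => k kl.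
  by rewrite (negbTE kl).
rewrite -bigA_distr_bigA /= (bigD1 l) //= {1}/Fm eqxx.
have -> : N%:R ^+ b = \prod_(k < b) N%:R :> R by rewrite prodr_const card_ord.
rewrite [\prod_(k < b) N%:R](bigD1 l) //=.
have -> : \prod_(k < b | k != l) \sum_s Fm k s = \prod_(k < b | k != l) N%:R.
  apply: eq_bigr => k kl; rewrite /Fm (negbTE kl) sumr_const card_ord.
  by [].
by rewrite mulrACA divff // mul1r mulrC.
Qed.

Lemma sum_batch_cross (phi psi : 'I_N -> R) (l l' : 'I_b) : l != l' ->
  \sum_s phi s = 0 ->
  \sum_(f : {ffun 'I_b -> 'I_N}) phi (f l) * psi (f l') = 0.
Proof.
move=> ll phi0.
pose Fm (k : 'I_b) (s : 'I_N) :=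
  (if k == l then phi s else 1) * (if k == l' then psi s else 1).
transitivity (\sum_(f : {ffun 'I_b -> 'I_N}) \prod_k Fm k (f k)).
  apply: eq_bigr => f _; rewrite (bigD1 l) //= (bigD1 l') 1?eq_sym //=.
  rewrite big1 ?mulr1 => [|k /andP[kl kl']].
    rewrite /Fm !eqxx (negbTE ll) (negbTE (_ : l' != l)) 1?eq_sym //.
    by rewrite mulr1 mul1r.
  by rewrite /Fm (negbTE kl) (negbTE kl') mulr1.
rewrite -bigA_distr_bigA /= (bigD1 l) //= /Fm eqxx (negbTE ll).
under eq_bigr do rewrite mulr1.
by rewrite phi0 mul0r.
Qed.

Lemma scalar_batch_variance (a : R) (c : 'I_N -> R) : \sum_s c s = 0 ->
  \sum_(f : {ffun 'I_b -> 'I_N}) (a + b%:R^-1 * \sum_l c (f l)) ^+ 2 =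
    N%:R ^+ b * (a ^+ 2 + b%:R^-1 * (N%:R^-1 * \sum_s c s ^+ 2)).
Proof.
move=> c0.
have E (f : {ffun 'I_b -> 'I_N}) : (a + b%:R^-1 * \sum_l c (f l)) ^+ 2 =
    a ^+ 2 + 2 * a * b%:R^-1 * (\sum_l c (f l))
    + b%:R^-1 ^+ 2 * (\sum_l \sum_l' c (f l) * c (f l')).
  have -> : \sum_l \sum_l' c (f l) * c (f l') = (\sum_l c (f l)) ^+ 2.
    by rewrite expr2 mulr_suml; apply: eq_bigr => l _; rewrite mulr_sumr.
  by ring.
under eq_bigr do rewrite E.
rewrite !big_split /= -!mulr_sumr sumr_const card_ffun !card_ord.
have -> : \sum_(f : {ffun 'I_b -> 'I_N}) \sum_l c (f l) = 0.
  rewrite exchange_big /= big1 // => l _.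
  by rewrite sum_batch_marginal c0 !mulr0.
have -> : \sum_(f : {ffun 'I_b -> 'I_N}) \sum_l \sum_l' c (f l) * c (f l') =
    b%:R * (N%:R ^+ b * (N%:R^-1 * \sum_s c s ^+ 2)).
  rewrite exchange_big /= -[b in b%:R]card_ord mulr_natl -sumr_const.
  apply: eq_bigr => l _; rewrite exchange_big /= (bigD1 l) //=.
  rewrite [X in _ + X]big1 ?addr0 => [|l' ll'].
    by rewrite (sum_batch_marginal (fun s => c s * c s) l).
  by apply: sum_batch_cross; rewrite // eq_sym.
by rewrite mulr0 addr0 -[_ *+ (N ^ b)]mulr_natl natrX; field; rewrite ?bR ?NR.
Qed.

(** Coordinatewise, the independent centred draws have no covariance, so the
    second moment of their mean carries the factor 1/b. *)
Lemma batch_variance {e : nat} (a : 'cV[R]_e) (q : 'I_N -> 'cV[R]_e) :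
  \sum_(f : {ffun 'I_b -> 'I_N})
     enorm (a + (b%:R^-1 *: \sum_l q (f l) - N%:R^-1 *: \sum_s q s)) ^+ 2 <=
    N%:R ^+ b * (enorm a ^+ 2 + b%:R^-1 * (N%:R^-1 * \sum_s enorm (q s) ^+ 2)).
Proof.
pose c (i : 'I_e) (s : 'I_N) := q s i ord0 - N%:R^-1 * \sum_s q s i ord0.
have c0 i : \sum_s c i s = 0.
  rewrite /c sumrB sumr_const card_ord -[(_ * _) *+ N]mulr_natl mulVKf //.
  by rewrite subrr.
have E (f : {ffun 'I_b -> 'I_N}) :
   enorm (a + (b%:R^-1 *: \sum_l q (f l) - N%:R^-1 *: \sum_s q s)) ^+ 2 =
   \sum_(i < e) (a i ord0 + b%:R^-1 * \sum_l c i (f l)) ^+ 2.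
  rewrite enorm_sq; apply: eq_bigr => i _; rewrite -expr2 !mxE !summxE.
  congr ((_ + _) ^+ 2); rewrite /c sumrB sumr_const card_ord mulrBr.
  by congr (_ - _); rewrite -[(_ * _) *+ b]mulr_natl mulKf.
under eq_bigr do rewrite E.
rewrite exchange_big /=.
under eq_bigr do rewrite scalar_batch_variance //.
rewrite -mulr_sumr ler_wpM2l ?exprn_ge0 // big_split /= lerD //.
  by rewrite enorm_sq; under [leRHS]eq_bigr do rewrite -expr2.
rewrite -!mulr_sumr ler_wpM2l ?invr_ge0 // ler_wpM2l ?invr_ge0 //.
under [leRHS]eq_bigr do rewrite enorm_sq.
rewrite /dotv [leRHS]exchange_big /= ler_sum // => i _.
have -> : \sum_s c i s ^+ 2 = \sum_s c i s * q s i ord0.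
  transitivity (\sum_s (c i s * q s i ord0 - c i s * (N%:R^-1 * \sum_s q s i ord0))).
    by apply: eq_bigr => s _; rewrite -mulrBr expr2.
  by rewrite sumrB -mulr_suml c0 mul0r subr0.
have -> : \sum_s c i s * q s i ord0 = \sum_s q s i ord0 * q s i ord0
    - N%:R^-1 * (\sum_s q s i ord0) ^+ 2.
  under eq_bigr do rewrite /c mulrBl.
  by rewrite sumrB -mulr_sumr -mulrA expr2.
by rewrite lerBlDr lerDl mulr_ge0 ?invr_ge0 ?sqr_ge0.
Qed.

End one_batch.

(** The two minibatches are handled one after the other, the fluctuation of
    the second being part of the constant vector for the first. *)
Lemma two_batch_variance {n m b e : nat} (a : 'cV[R]_e)
    (q : 'I_n -> 'cV[R]_e) (r : 'I_m -> 'cV[R]_e) :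
  (0 < n)%N -> (0 < m)%N -> (0 < b)%N ->
  \sum_(i : {ffun 'I_b -> 'I_n}) \sum_(j : {ffun 'I_b -> 'I_m})
     enorm (a + (b%:R^-1 *: \sum_l q (i l) - n%:R^-1 *: \sum_s q s)
              + (b%:R^-1 *: \sum_l r (j l) - m%:R^-1 *: \sum_s r s)) ^+ 2 <=
    n%:R ^+ b * m%:R ^+ b * (enorm a ^+ 2
      + b%:R^-1 * (n%:R^-1 * \sum_s enorm (q s) ^+ 2
                   + m%:R^-1 * \sum_s enorm (r s) ^+ 2)).
Proof.
move=> n0 m0 b0.
apply: (@le_trans _ _ (\sum_(i : {ffun 'I_b -> 'I_n}) (m%:R ^+ b *
   (enorm (a + (b%:R^-1 *: \sum_l q (i l) - n%:R^-1 *: \sum_s q s)) ^+ 2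
    + b%:R^-1 * (m%:R^-1 * \sum_s enorm (r s) ^+ 2))))).
  by apply: ler_sum => i _; exact: batch_variance.
rewrite -mulr_sumr big_split /= sumr_const card_ffun !card_ord.
rewrite -[_ *+ (n ^ b)]mulr_natl natrX.
rewrite (mulrC (n%:R ^+ b) (m%:R ^+ b)) -[leRHS]mulrA ler_wpM2l ?exprn_ge0 //.
have := batch_variance n0 b0 a q; lra.
Qed.

End minibatch.

(** * Measurability of random vectors *)

Definition measurable_vec {R : realType} {d : measure_display}
    {T : measurableType d} {e : nat} (u : T -> 'cV[R]_e) : Prop :=
  forall i, measurable_fun [set: T] (fun w => u w i ord0).

Section measurable_vec.
Context {R : realType} {d : measure_display} {T : measurableType d}.

(** An open set of R^e is a countable union of rational cubes, whose preimages
    only involve the coordinates. *)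
Lemma measurable_continuous_vec {e : nat} (h : 'cV[R]_e -> R)
    (u : T -> 'cV[R]_e) :
  continuous h -> measurable_vec u -> measurable_fun [set: T] (fun w => h (u w)).
Proof.
move=> ch mu; apply: (measurability _ (RGenOpens.measurableE R)).
move=> _ [_ [a [b ->] <-]]; rewrite setTI.
pose O : set 'cV[R]_e := h @^-1` `]a, b[.
have oO : open O by move/continuousP: ch; apply; exact: interval_open.
pose box (c : {ffun 'I_e -> rat} * nat) : set 'cV[R]_e :=
  [set v | forall i, `|v i ord0 - ratr (c.1 i)| < c.2.+1%:R^-1].
pose F (c : {ffun 'I_e -> rat} * nat) : set T :=
  if `[< box c `<=` O >] then [set w | box c (u w)] else set0.
have -> : (fun w => h (u w)) @^-1` `]a, b[ = \bigcup_c F c.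
  apply/seteqP; split => [w Ow|w [c _]]; last first.
    rewrite /F; case: asboolP => // cO cw; exact: (cO _ cw).
  have /nbhs_ballP[eps /= e0 eO] : nbhs (u w) O by apply: open_nbhs_nbhs.
  have [k kP] : exists k : nat, 2 * (k.+1%:R^-1) < eps :> R.
    exists (Num.truncn (2 / eps)).
    rewrite ltr_pdivrMr ?ltr0Sn // mulrC -ltr_pdivrMr //.
    exact: truncnS_gt.
  have qP i : exists q : rat, `|u w i ord0 - ratr q| < k.+1%:R^-1.
    have k0 : (0 : R) < k.+1%:R^-1 by rewrite invr_gt0 ltr0Sn.
    have /rat_in_itvoo[q] : u w i ord0 - k.+1%:R^-1 < u w i ord0 + k.+1%:R^-1.
      by rewrite ltrBlDr -addrA ltrDl addr_gt0.
    rewrite in_itv /= => /andP[q1 q2]; exists q; rewrite ltr_distlC.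
    by rewrite q1 q2.
  pose c : {ffun 'I_e -> rat} * nat := ([ffun i => xchoose (qP i)], k).
  have cw : box c (u w).
    by move=> i; rewrite /c /= ffunE; exact: (xchooseP (qP i)).
  exists c => //; rewrite /F asboolT //= => v cv.
  apply: eO; split => // i j; rewrite (ord1 j) /ball /=.
  apply: lt_trans kP.
  have := cw i; have := cv i; rewrite /c /= ffunE; set q : R := ratr _.
  move=> h1 h2; have := ler_distD q (u w i ord0) (v i ord0).
  rewrite (distrC q) => h3; apply: le_lt_trans h3 _.
  by rewrite mulr_natl mulr2n ltrD.
apply: countable_bigcupT_measurable => [|c].
  exact: countableP.
rewrite /F; case: asboolP => // _.
have -> : [set w | box c (u w)] = \bigcap_(i in [set: 'I_e])
    [set w | `|u w i ord0 - ratr (c.1 i)| < c.2.+1%:R^-1].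
  by apply/seteqP; split => w /= cw i => [_|]; apply: cw.
apply: fin_bigcap_measurable => [|i _]; first exact: finite_finset.
have m : measurable_fun [set: T] (fun w => `|u w i ord0 - ratr (c.1 i)|).
  apply: measurableT_comp => //; apply: measurable_funB => //; exact: mu.
have := m measurableT _ (measurable_itv `]-oo, c.2.+1%:R^-1[).
rewrite setTI; congr (measurable _).
Qed.

Lemma measurable_vec_continuous {e e' : nat} (h : 'cV[R]_e -> 'cV[R]_e')
    (u : T -> 'cV[R]_e) :
  (forall i, continuous (fun v => h v i ord0)) -> measurable_vec u ->
  measurable_vec (fun w => h (u w)).
Proof. by move=> ch mu i; exact: (measurable_continuous_vec (ch i)). Qed.

Lemma measurable_vec_cst {e : nat} (v : 'cV[R]_e) :
  measurable_vec (fun _ : T => v).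
Proof. by move=> i; exact: measurable_cst. Qed.

Lemma measurable_vecD {e : nat} (u v : T -> 'cV[R]_e) :
  measurable_vec u -> measurable_vec v -> measurable_vec (fun w => u w + v w).
Proof.
move=> mu mv i; under eq_fun do rewrite mxE.
exact: measurable_funD.
Qed.

Lemma measurable_vecZ {e : nat} (a : R) (u : T -> 'cV[R]_e) :
  measurable_vec u -> measurable_vec (fun w => a *: u w).
Proof.
move=> mu i; under eq_fun do rewrite mxE.
by apply: measurable_funM => //; exact: measurable_cst.
Qed.

Lemma measurable_vecB {e : nat} (u v : T -> 'cV[R]_e) :
  measurable_vec u -> measurable_vec v -> measurable_vec (fun w => u w - v w).
Proof.
move=> mu mv; apply: measurable_vecD => //.
by under eq_fun do rewrite -scaleN1r; exact: measurable_vecZ.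
Qed.

Lemma measurable_vec_col_mx {e e' : nat} (u : T -> 'cV[R]_e)
    (v : T -> 'cV[R]_e') :
  measurable_vec u -> measurable_vec v ->
  measurable_vec (fun w => col_mx (u w) (v w)).
Proof.
move=> mu mv i; rewrite -(splitK i); case: (fintype.split i) => j /=.
  by under eq_fun do rewrite col_mxEu; exact: mu.
by under eq_fun do rewrite col_mxEd; exact: mv.
Qed.

Lemma measurable_enorm_sq {e : nat} (u : T -> 'cV[R]_e) :
  measurable_vec u -> measurable_fun [set: T] (fun w => enorm (u w) ^+ 2).
Proof.
move=> mu; under eq_fun do rewrite enorm_sq.
by apply: measurable_sum => i; exact: measurable_funM.
Qed.

(** The preimages are finite unions of pieces on which the index is constant. *)
Lemma measurable_select {S : finType} (xi : T -> S) (f : S -> T -> R) :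
  (forall s, measurable [set w | xi w = s]) ->
  (forall s, measurable_fun [set: T] (f s)) ->
  measurable_fun [set: T] (fun w => f (xi w) w).
Proof.
move=> mxi mf _ B mB; rewrite setTI.
have -> : (fun w => f (xi w) w) @^-1` B =
    \bigcup_(s in [set: S]) ([set w | xi w = s] `&` f s @^-1` B).
  apply/seteqP; split => [w Bw|w [s _ [/= <-]]] //.
  by exists (xi w).
apply: fin_bigcup_measurable => [|s _]; first exact: finite_finset.
by apply: measurableI => //; rewrite -[X in measurable X]setTI; exact: mf.
Qed.

Lemma measurable_vec_select {S : finType} {e : nat} (xi : T -> S)
    (u : S -> T -> 'cV[R]_e) :
  (forall s, measurable [set w | xi w = s]) ->
  (forall s, measurable_vec (u s)) -> measurable_vec (fun w => u (xi w) w).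
Proof.
move=> mxi mu i.
by apply: (measurable_select (f := fun s w => u s w i ord0) mxi) => s; exact: mu.
Qed.

End measurable_vec.

(** * Integration against an independent choice *)

Section independence.
Context {R : realType} {d : measure_display} {T : measurableType d}
  (P : probability T R).
Context (G : set (set T)) (Gs : sigma_algebra setT G) (Gm : G `<=` measurable).

Let TG : measurableType G.-sigma := g_sigma_algebraType G.

Lemma measurable_sub_sigma (A : set T) : measurable (A : set TG) -> measurable A.
Proof. by rewrite measurable_g_measurableTypeE //; exact: Gm. Qed.

Lemma measurable_fun_sub_sigma {d' : measure_display} {U : measurableType d'}
    (f : T -> U) :
  measurable_fun [set: TG] f -> measurable_fun [set: T] f.
Proof.
move=> mf _ B mB; apply: measurable_sub_sigma.
exact: (mf measurableT B mB).
Qed.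

Let mid : measurable_fun [set: T] (id : T -> TG).
Proof.
by move=> _ B mB; rewrite setTI; exact: measurable_sub_sigma.
Qed.

Local Open Scope ereal_scope.

(** On the events of G the measures A |-> P (A n S) and A |-> q P(A) coincide,
    so that they integrate G-measurable functions alike. *)
Lemma independent_integral (S : set T) (q : R) (f : T -> R) :
  measurable S -> (0 <= q)%R ->
  (forall A, G A -> P (A `&` S) = P A * q%:E) ->
  (forall w, (0 <= f w)%R) -> measurable_fun [set: TG] f ->
  \int[P]_(w in S) (f w)%:E = q%:E * \int[P]_w (f w)%:E.
Proof.
move=> mS q0 hS f0 mf.
have mfT : measurable_fun [set: T] f by exact: measurable_fun_sub_sigma.
have mfE : measurable_fun [set: T] (fun w => (f w)%:E) by exact/measurable_EFinP.
have mfG : measurable_fun [set: TG] (fun w => (f w)%:E) by exact/measurable_EFinP.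
have -> : \int[P]_(w in S) (f w)%:E = \int[mrestr P mS]_w (f w)%:E.
  have mU : measurable_fun (S `|` ~` S) (fun w => (f w)%:E).
    exact: measurable_funTS.
  have U0 w : (S `|` ~` S) w -> 0 <= (f w)%:E by rewrite lee_fin.
  have dS : [disjoint S & ~` S] by apply/disj_setPS => w [].
  have -> : \int[mrestr P mS]_w (f w)%:E =
      \int[mrestr P mS]_(w in S `|` ~` S) (f w)%:E by rewrite setUv.
  rewrite (ge0_integral_setU _ mS (measurableC mS) mU U0 dS).
  rewrite [X in _ + X](_ : _ = 0) ?adde0.
    apply: eq_measure_integral => A mA AS; rewrite /= /mrestr; congr (P _).
    by apply/seteqP; split => w; [split => //; exact: AS|case].
  rewrite (eq_measure_integral mzero) ?integral_measure_zero //.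
  move=> A mA AS; rewrite /= /mrestr /mzero (_ : A `&` S = set0) ?measure0 //.
  by apply/seteqP; split => w // [Aw Sw]; exact: (AS _ Aw Sw).
have -> : \int[mrestr P mS]_w (f w)%:E =
    \int[pushforward (mrestr P mS) (id : T -> TG)]_w (f w)%:E.
  by rewrite ge0_integral_pushforward // => w _; rewrite lee_fin.
rewrite (eq_measure_integral
   (mscale (NngNum q0) (pushforward P (id : T -> TG)))); last first.
  move=> A mA _; rewrite /= /mscale /pushforward /mrestr /= muleC; apply: hS.
  by move: mA; rewrite measurable_g_measurableTypeE.
rewrite ge0_integral_mscale //= ?ge0_integral_pushforward //.
- by move=> w _; rewrite lee_fin.
- by move=> w _; rewrite lee_fin.
Qed.

(** Averaging out a finite random index independent of G: the expectation given
    the past is a finite sum. *)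
Lemma independent_expectation {S : finType} (xi : T -> S) (q : S -> R)
    (f : S -> T -> R) :
  (forall s, measurable [set w | xi w = s]) -> (forall s, (0 <= q s)%R) ->
  (forall s A, G A -> P (A `&` [set w | xi w = s]) = P A * (q s)%:E) ->
  (forall s w, (0 <= f s w)%R) -> (forall s, measurable_fun [set: TG] (f s)) ->
  \int[P]_w (f (xi w) w)%:E = \int[P]_w (\sum_s q s * f s w)%:E.
Proof.
move=> mxi q0 hxi f0 mf.
have mfT s : measurable_fun [set: T] (f s) by exact: measurable_fun_sub_sigma.
have mI s : measurable_fun [set: T]
    (fun w => ((f s w)%:E * (\1_[set w | xi w = s] w)%:E)).
  by apply: emeasurable_funM; apply/measurable_EFinP => //; exact: measurable_indic.
transitivity (\int[P]_w \sum_s ((f s w)%:E * (\1_[set w | xi w = s] w)%:E)).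
  apply: eq_integral => w _; rewrite (bigD1 (xi w)) //= big1 ?adde0 => [|s sw].
    by rewrite indicE mem_set // mule1.
  by rewrite indicE memNset ?mule0 //= => /esym/eqP; rewrite (negbTE sw).
rewrite ge0_integral_sum //; last first.
  by move=> s w _; rewrite mule_ge0 // lee_fin.
transitivity (\int[P]_w \sum_s ((q s)%:E * (f s w)%:E)).
  rewrite ge0_integral_sum //.
  - apply: eq_bigr => s _; rewrite ge0_integralZl_EFin //; last 2 first.
    + by move=> w _; rewrite lee_fin.
    + exact/measurable_EFinP.
    rewrite -(@independent_integral [set w | xi w = s]) //; last exact: hxi.
    rewrite [RHS]integral_mkcond; apply: eq_integral => w _.
    rewrite patchE indicE; case: ifPn => ws; first by rewrite mule1.
    by rewrite mule0.
  - by move=> s; apply: emeasurable_funM => //; apply/measurable_EFinP.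
  - by move=> s w _; rewrite mule_ge0 // lee_fin.
by apply: eq_integral => w _; rewrite -sumEFin; apply: eq_bigr => s _.
Qed.

End independence.

(** * Minibatch estimators of the operators *)

Section average.
Context {R : realType} {d N : nat}.
Implicit Types (F : 'I_N -> 'cV[R]_d -> R).

Lemma pderive_avg F k u : (forall i, differentiable (F i) u) ->
  pderive k (avg F) u = avg (fun i => pderive k (F i)) u.
Proof.
move=> dF; rewrite /pderive /avg.
have -> : (fun u => N%:R^-1 * \sum_(i < N) F i u) =
    N%:R^-1 *: (\sum_(i < N) F i).
  by apply/funext => v; rewrite fctE fct_sumE.
have dv i : derivable (F i) u (delta_mx k ord0) by exact: diff_derivable.
rewrite deriveZ; last by apply: derivable_sum.
by rewrite derive_sum.
Qed.

Lemma grad_avg F u : (forall i, differentiable (F i) u) ->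
  grad (avg F) u = N%:R^-1 *: \sum_i grad (F i) u.
Proof.
move=> dF; apply/matrixP => k j; rewrite !mxE summxE pderive_avg //.
by congr (_ * _); apply: eq_bigr => i _; rewrite mxE.
Qed.

Lemma hess_avg F u : (forall i v, differentiable (F i) v) ->
  (forall i k v, differentiable (pderive k (F i)) v) ->
  hess (avg F) u = N%:R^-1 *: \sum_i hess (F i) u.
Proof.
move=> dF d2F; apply/matrixP => k j; rewrite !mxE summxE.
have -> : pderive j (avg F) = avg (fun i => pderive j (F i)).
  by apply/funext => v; rewrite pderive_avg.
rewrite pderive_avg //.
by congr (_ * _); apply: eq_bigr => i _; rewrite mxE.
Qed.

End average.

Section average_blocks.
Context {R : realType} {dx dy N : nat}.
Implicit Types (F : 'I_N -> 'cV[R]_(dx + dy) -> R) (x : 'cV[R]_dx)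
  (y z : 'cV[R]_dy).

Lemma grad1_avg F x y : (forall i u, differentiable (F i) u) ->
  grad1 (avg F) x y = N%:R^-1 *: \sum_i grad1 (F i) x y.
Proof. by move=> dF; rewrite /grad1 grad_avg // linearZ linear_sum. Qed.

Lemma grad2_avg F x y : (forall i u, differentiable (F i) u) ->
  grad2 (avg F) x y = N%:R^-1 *: \sum_i grad2 (F i) x y.
Proof. by move=> dF; rewrite /grad2 grad_avg // linearZ linear_sum. Qed.

Lemma hess12_avg F x y z : (forall i u, differentiable (F i) u) ->
  (forall i k u, differentiable (pderive k (F i)) u) ->
  hess12 (avg F) x y *m z = N%:R^-1 *: \sum_i hess12 (F i) x y *m z.
Proof.
move=> dF d2F; rewrite -mulmx_suml scalemxAl; congr (_ *m _).
rewrite /hess12 hess_avg //; apply/matrixP => i j; rewrite !mxE !summxE.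
by congr (_ * _); apply: eq_bigr => l _; rewrite !mxE.
Qed.

Lemma hess22_avg F x y z : (forall i u, differentiable (F i) u) ->
  (forall i k u, differentiable (pderive k (F i)) u) ->
  hess22 (avg F) x y *m z = N%:R^-1 *: \sum_i hess22 (F i) x y *m z.
Proof.
move=> dF d2F; rewrite -mulmx_suml scalemxAl; congr (_ *m _).
rewrite /hess22 hess_avg //; apply/matrixP => i j; rewrite !mxE !summxE.
by congr (_ * _); apply: eq_bigr => l _; rewrite !mxE.
Qed.

End average_blocks.

Section continuity.
Context {R : realType} {dd : nat}.

Lemma continuous_of_lipschitz (L : R) (h : 'cV[R]_dd -> R) : 0 <= L ->
  (forall u v, `|h u - h v| <= L * enorm (u - v)) -> continuous h.
Proof.
move=> L0 hl; apply: continuous_of_enorm_bound => u; exists L; split=> // v.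
apply: le_trans (hl v u) _.
by rewrite ler_wpM2l // lerDl sqr_ge0.
Qed.

Lemma continuous_grad (L : R) (h : 'cV[R]_dd -> R) i : 0 <= L ->
  lipschitz_grad L h -> continuous (fun u => grad h u i ord0).
Proof.
move=> L0 [_ lh]; apply: (continuous_of_lipschitz L0) => u v.
apply: le_trans (lh u v).
by have := enorm_coord (grad h u - grad h v) i; rewrite !mxE.
Qed.

Lemma continuous_hess (L : R) (h : 'cV[R]_dd -> R) i j : 0 <= L ->
  lipschitz_hess L h -> continuous (fun u => hess h u i j).
Proof.
move=> L0 [_ lh]; apply: (continuous_of_lipschitz L0) => u v.
apply: le_trans (lh u v).
pose e : 'cV[R]_dd := delta_mx j ord0.
have e1 : enorm e = 1.
  apply/eqP; rewrite -(@eqrXn2 _ 2) ?enorm_ge0 // expr1n enorm_sq.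
  by rewrite dotv_delta /e mxE !eqxx.
have := enorm_mulmx (hess h u - hess h v) e; rewrite e1 mulr1.
apply: le_trans; apply: le_trans (enorm_coord _ i).
have colE' (C : 'M[R]_dd) : (C *m e) i ord0 = C i j by rewrite /e -colE mxE.
have subE (C C' : 'M[R]_dd) : (C - C') i j = C i j - C' i j by rewrite !mxE.
by rewrite colE' subE.
Qed.

Lemma continuous_of_sq_lipschitz {e' : nat} (c : R)
    (h : 'cV[R]_dd -> 'cV[R]_e') i : 0 <= c ->
  (forall u v, enorm (h u - h v) ^+ 2 <= c * enorm (u - v) ^+ 2) ->
  continuous (fun u => h u i ord0).
Proof.
move=> c0 hc; apply: (continuous_of_lipschitz (sqrtr_ge0 c)) => u v.
apply: (@le_trans _ _ (enorm (h u - h v))).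
  by have := enorm_coord (h u - h v) i; rewrite !mxE.
apply: enorm_le_sq; first by rewrite mulr_ge0 ?sqrtr_ge0 ?enorm_ge0.
by rewrite exprMn (sqr_sqrtr c0); exact: hc.
Qed.

End continuity.

Section operator_parts.
Context {R : realType} {dx dy : nat}.
Context {n m : nat} (F : 'I_n -> 'cV[R]_(dx + dy) -> R)
  (G : 'I_m -> 'cV[R]_(dx + dy) -> R).

Let E := 'cV[R]_(dx + dy) -> R.
Let U : Type := ('cV[R]_dx * 'cV[R]_dy * 'cV[R]_dy)%type.

Definition distU (u u' : U) : R := dist3 u.1.1 u.1.2 u.2 u'.1.1 u'.1.2 u'.2.

(** What the analysis of the estimator of an operator uses. The operator is
    the sum of a part linear in f and a part linear in g, so that its minibatch
    version is a minibatch mean; the increment bound holds for every single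
    index, which is what the variance of the minibatch mean is made of. *)
Record operator_parts {e : nat} (D : E -> E -> U -> 'cV[R]_e)
    (A B : E -> U -> 'cV[R]_e) (r Q : R) : Prop := {
  op_avg : forall N (i : 'I_N -> 'I_n) N' (j : 'I_N' -> 'I_m) u,
    D (avg (fun l => F (i l))) (avg (fun l => G (j l))) u =
    N%:R^-1 *: (\sum_l A (F (i l)) u) + N'%:R^-1 *: (\sum_l B (G (j l)) u);
  op_measurable : forall (d : measure_display) (T : measurableType d)
    (x : T -> 'cV[R]_dx) (y z : T -> 'cV[R]_dy),
    measurable_vec x -> measurable_vec y -> measurable_vec z ->
    (forall i, measurable_vec (fun w => A (F i) (x w, y w, z w))) /\
    (forall j, measurable_vec (fun w => B (G j) (x w, y w, z w)));
  op_increment : forall i j u u', enorm u.2 <= r ->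
    enorm (A (F i) u' - A (F i) u) ^+ 2 + enorm (B (G j) u' - B (G j) u) ^+ 2
      <= Q * distU u u'
}.

Section instances.
Context (Lf L1 L2 r : R) (Lf0 : 0 <= Lf) (L10 : 0 <= L1) (L20 : 0 <= L2)
  (r0 : 0 <= r).
Hypotheses (lF : forall i, lipschitz_grad Lf (F i))
  (l1G : forall j, lipschitz_grad L1 (G j))
  (l2G : forall j, lipschitz_hess L2 (G j)).

Let Q := qlip Lf L1 L2 r.

Lemma distU_xy u u' :
  enorm (u'.1.1 - u.1.1) ^+ 2 + enorm (u'.1.2 - u.1.2) ^+ 2 <= distU u u'.
Proof. by rewrite lerDl sqr_ge0. Qed.

Let dG j u : differentiable (G j) u. Proof. by case: (l1G j). Qed.
Let d2G j k u : differentiable (pderive k (G j)) u.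
Proof. by case: (l2G j). Qed.
Let dF i u : differentiable (F i) u. Proof. by case: (lF i). Qed.

Lemma measurable_grad (L : R) h {d : measure_display} {T : measurableType d}
    (x : T -> 'cV[R]_dx) (y : T -> 'cV[R]_dy) : 0 <= L -> lipschitz_grad L h ->
  measurable_vec x -> measurable_vec y ->
  measurable_vec (fun w => grad1 h (x w) (y w)) /\
  measurable_vec (fun w => grad2 h (x w) (y w)).
Proof.
move=> L0 lh mx my; have mu := measurable_vec_col_mx mx my.
have mg k : measurable_fun [set: T]
    (fun w => grad h (col_mx (x w) (y w)) k ord0).
  exact: (measurable_continuous_vec (continuous_grad L0 lh) mu).
by split=> i; under eq_fun do rewrite mxE; exact: mg.
Qed.

Lemma measurable_hess (L : R) h {d : measure_display} {T : measurableType d}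
    (x : T -> 'cV[R]_dx) (y z : T -> 'cV[R]_dy) :
  0 <= L -> lipschitz_hess L h ->
  measurable_vec x -> measurable_vec y -> measurable_vec z ->
  measurable_vec (fun w => hess12 h (x w) (y w) *m z w) /\
  measurable_vec (fun w => hess22 h (x w) (y w) *m z w).
Proof.
move=> L0 lh mx my mz; have mu := measurable_vec_col_mx mx my.
have mh k l : measurable_fun [set: T]
    (fun w => hess h (col_mx (x w) (y w)) k l).
  exact: (measurable_continuous_vec (continuous_hess L0 lh) mu).
split=> i; under eq_fun do rewrite mxE; apply: measurable_sum => k;
  (apply: measurable_funM; last exact: mz).
- have -> : (fun w => hess12 h (x w) (y w) i k) =
      (fun w => hess h (col_mx (x w) (y w)) (lshift dy i) (rshift dx k)).
    by apply/funext => w; rewrite /hess12 /ursubmx /usubmx /rsubmx !mxE.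
  exact: mh.
- have -> : (fun w => hess22 h (x w) (y w) i k) =
      (fun w => hess h (col_mx (x w) (y w)) (rshift dx i) (rshift dx k)).
    by apply/funext => w; rewrite /hess22 /drsubmx /dsubmx /rsubmx !mxE.
  exact: mh.
Qed.

Lemma increment_le (a b D d1 : R) : 0 <= D -> 0 <= d1 <= D ->
  a <= Lf ^+ 2 * d1 -> b <= 2 * (L1 ^+ 2 + L2 ^+ 2 * r ^+ 2) * D ->
  a + b <= Q * D.
Proof.
move=> D0 /andP[d10 d1D] ha hb; rewrite /Q /qlip.
have := ler_wpM2l (sqr_ge0 Lf) d1D; lra.
Qed.

Lemma Dx_parts : operator_parts (fun f g u => Dx f g u.1.1 u.1.2 u.2)
  (fun f u => grad1 f u.1.1 u.1.2)
  (fun g u => - (hess12 g u.1.1 u.1.2 *m u.2)) r Q.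
Proof.
split.
- move=> N i N' j u.
  have gE := grad1_avg u.1.1 u.1.2 (fun l => dF (i l)).
  have hE := hess12_avg u.1.1 u.1.2 u.2 (fun l => dG (j l)) (fun l => d2G (j l)).
  rewrite sumrN scalerN.
  exact: (congr2 (fun v w : 'cV[R]_dx => v - w) gE hE).
- move=> d T x y z mx my mz; split=> i /=.
    by have [] := measurable_grad Lf0 (lF i) mx my.
  under eq_fun do rewrite -scaleN1r; apply: measurable_vecZ.
  by have [] := measurable_hess L20 (l2G i) mx my mz.
- move=> i j u u' ur.
  have D0 : 0 <= distU u u' := dist3_ge0 _ _ _ _ _ _.
  have h1 := grad1_increment u.1.1 u.1.2 u'.1.1 u'.1.2 Lf0 (lF i).
  have h2 := hess12_increment L10 L20 r0 u.1.1 u.1.2 u'.1.1 u'.1.2 u'.2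
    (l1G j) (l2G j) ur.
  apply: (increment_le D0 _ h1); last by rewrite -opprD enormN.
  by rewrite distU_xy addr_ge0 ?sqr_ge0.
Qed.

Lemma Dy_parts : operator_parts (fun f g u => Dy f g u.1.1 u.1.2 u.2)
  (fun f u => 0) (fun g u => grad2 g u.1.1 u.1.2) r Q.
Proof.
split.
- move=> N i N' j u; rewrite /Dy grad2_avg; last by move=> l v; exact: dG.
  by rewrite [X in _ = _ *: X + _]big1 // scaler0 add0r.
- move=> d T x y z mx my mz; split=> i /=; first exact: measurable_vec_cst.
  by have [] := measurable_grad L10 (l1G i) mx my.
- move=> i j u u' ur; rewrite subrr enorm0 expr0n add0r.
  apply: le_trans (grad2_increment _ _ _ _ L10 (l1G j)) _.
  have D0 : 0 <= distU u u' := dist3_ge0 _ _ _ _ _ _.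
  apply: (@le_trans _ _ (L1 ^+ 2 * distU u u')).
    by rewrite ler_wpM2l ?sqr_ge0 // distU_xy.
  rewrite ler_wpM2r // /Q /qlip.
  have := sqr_ge0 Lf; have := sqr_ge0 L1.
  have : 0 <= L2 ^+ 2 * r ^+ 2 by rewrite mulr_ge0 ?sqr_ge0.
  lra.
Qed.

Lemma Dz_parts : operator_parts (fun f g u => Dz f g u.1.1 u.1.2 u.2)
  (fun f u => - grad2 f u.1.1 u.1.2)
  (fun g u => hess22 g u.1.1 u.1.2 *m u.2) r Q.
Proof.
split.
- move=> N i N' j u.
  have gE := grad2_avg u.1.1 u.1.2 (fun l => dF (i l)).
  have hE := hess22_avg u.1.1 u.1.2 u.2 (fun l => dG (j l)) (fun l => d2G (j l)).
  rewrite sumrN scalerN addrC.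
  exact: (congr2 (fun v w : 'cV[R]_dy => v - w) hE gE).
- move=> d T x y z mx my mz; split=> i /=; last first.
    by have [] := measurable_hess L20 (l2G i) mx my mz.
  under eq_fun do rewrite -scaleN1r; apply: measurable_vecZ.
  by have [] := measurable_grad Lf0 (lF i) mx my.
- move=> i j u u' ur.
  have D0 : 0 <= distU u u' := dist3_ge0 _ _ _ _ _ _.
  have h1 := grad2_increment u.1.1 u.1.2 u'.1.1 u'.1.2 Lf0 (lF i).
  have h2 := hess22_increment L10 L20 r0 u.1.1 u.1.2 u'.1.1 u'.1.2 u'.2
    (l1G j) (l2G j) ur.
  apply: (increment_le D0 _ _ h2); last by rewrite -opprD enormN; exact: h1.
  by rewrite distU_xy addr_ge0 ?sqr_ge0.
Qed.

End instances.

Section page_error.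
Context {e b : nat} (D : E -> E -> U -> 'cV[R]_e) (A B : E -> U -> 'cV[R]_e)
  (r Q : R) (parts : operator_parts D A B r Q).
Context (n0 : (0 < n)%N) (m0 : (0 < m)%N) (b0 : (0 < b)%N).

Let Df u := D (avg F) (avg G) u.

Lemma Df_parts u :
  Df u = n%:R^-1 *: (\sum_l A (F l) u) + m%:R^-1 *: (\sum_l B (G l) u).
Proof. exact: (op_avg parts id id u). Qed.

Lemma measurable_page_step {d : measure_display} {T : measurableType d}
    (coin : bool) (I : 'I_b -> 'I_n) (J : 'I_b -> 'I_m)
    (x x' : T -> 'cV[R]_dx) (y z y' z' : T -> 'cV[R]_dy) (v : T -> 'cV[R]_e) :
  measurable_vec x -> measurable_vec y -> measurable_vec z ->
  measurable_vec x' -> measurable_vec y' -> measurable_vec z' ->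
  measurable_vec v ->
  measurable_vec (fun w => page_step D F G coin I J
    (x' w, y' w, z' w) (x w, y w, z w) (v w)) /\
  measurable_vec (fun w => Df (x' w, y' w, z' w)).
Proof.
move=> mx my mz mx' my' mz' mv.
have [mA mB] := op_measurable parts mx my mz.
have [mA' mB'] := op_measurable parts mx' my' mz'.
have msum N (f : 'I_N -> T -> 'cV[R]_e) (c : R) :
    (forall l, measurable_vec (f l)) ->
    measurable_vec (fun w => c *: \sum_l f l w).
  move=> mf; apply: measurable_vecZ => i; under eq_fun do rewrite summxE.
  by apply: measurable_sum => l; exact: mf.
have mD : measurable_vec (fun w => Df (x' w, y' w, z' w)).
  under eq_fun do rewrite Df_parts.
  by apply: measurable_vecD; apply: msum => l.
split=> //; rewrite /page_step; case: coin => //.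
under eq_fun do rewrite !(op_avg parts).
apply: measurable_vecB; last by apply: measurable_vecD; apply: msum => l.
apply: measurable_vecD => //.
by apply: measurable_vecD; apply: msum => l.
Qed.

(** One step of the recursive estimator, conditionally on the past: the old
    error is kept and the fluctuation of the minibatch increment, which is
    centred, adds its variance. *)
Lemma page_error_mean (u u' : U) (v : 'cV[R]_e) : enorm u.2 <= r ->
  \sum_(i : {ffun 'I_b -> 'I_n}) \sum_(j : {ffun 'I_b -> 'I_m})
    enorm (page_step D F G false i j u' u v - Df u') ^+ 2 <=
  n%:R ^+ b * m%:R ^+ b * (enorm (v - Df u) ^+ 2 + b%:R^-1 * (Q * distU u u')).
Proof.
move=> ur; pose q l := A (F l) u' - A (F l) u; pose s l := B (G l) u' - B (G l) u.
have h : \sum_(i : {ffun 'I_b -> 'I_n}) \sum_(j : {ffun 'I_b -> 'I_m})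
    enorm (page_step D F G false i j u' u v - Df u') ^+ 2 =
  \sum_(i : {ffun 'I_b -> 'I_n}) \sum_(j : {ffun 'I_b -> 'I_m})
    enorm (v - Df u + (b%:R^-1 *: \sum_l q (i l) - n%:R^-1 *: \sum_l q l)
              + (b%:R^-1 *: \sum_l s (j l) - m%:R^-1 *: \sum_l s l)) ^+ 2.
  apply: eq_bigr => i _; apply: eq_bigr => j _; congr (enorm _ ^+ 2).
  rewrite /page_step /= !(op_avg parts) !Df_parts /q /s !sumrB.
  by apply/matrixP => k l; rewrite !mxE; ring.
rewrite h; apply: le_trans (two_batch_variance (v - Df u) q s n0 m0 b0) _.
rewrite ler_wpM2l ?mulr_ge0 ?exprn_ge0 // lerD2l ler_wpM2l ?invr_ge0 //.
have nR : (n%:R : R) != 0 by rewrite pnatr_eq0 -lt0n.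
have mR : (m%:R : R) != 0 by rewrite pnatr_eq0 -lt0n.
(* Average over the indices the bound on each pair of summands. *)
have avgc N (c : R) (N1 : (N%:R : R) != 0) : N%:R^-1 * \sum_(l < N) c = c.
  by rewrite sumr_const card_ord -[c *+ N]mulr_natl mulKf.
have -> : n%:R^-1 * \sum_s0 enorm (q s0) ^+ 2 = m%:R^-1 * \sum_(j < m)
    (n%:R^-1 * \sum_(i < n) enorm (q i) ^+ 2) by rewrite avgc.
rewrite -mulrDr -big_split /= -[leRHS](avgc m) //.
rewrite ler_wpM2l ?invr_ge0 // ler_sum // => j _.
rewrite -[enorm (s j) ^+ 2](avgc n) // -mulrDr -big_split /= -[leRHS](avgc n) //.
rewrite ler_wpM2l ?invr_ge0 // ler_sum // => i _.
exact: (op_increment parts).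
Qed.

End page_error.

End operator_parts.

(** * One random step of an estimator *)

Section probabilities.
Context {R : realType} {d : measure_display} {T : measurableType d}
  (P : probability T R).

Lemma probability_select {S : finType} (xi : T -> S) (Q : pred S) :
  (forall s, measurable [set w | xi w = s]) ->
  (P [set w | Q (xi w)] = \sum_(s | Q s) P [set w | xi w = s])%E.
Proof.
move=> mxi.
have mQ : measurable [set w | Q (xi w)].
  have -> : [set w | Q (xi w)] = \bigcup_(s in [set s | Q s]) [set w | xi w = s].
    apply/seteqP; split => [w Qw|w [s /= Qs ws]]; last by rewrite ws.
    by exists (xi w).
  by apply: fin_bigcup_measurable => [|s _]; [exact: finite_finset|exact: mxi].
have ind A : measurable A -> P A = (\int[P]_w (\1_A w)%:E)%E.
  by move=> mA; rewrite integral_indic // setIT.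
rewrite ind // big_mkcond /=.
transitivity (\int[P]_w
    (\sum_s (if Q s then (\1_[set w | xi w = s] w)%:E else 0)))%E.
  apply: eq_integral => w _; rewrite (bigD1 (xi w)) //= big1 ?adde0.
    case: ifPn => Qw; rewrite !indicE; first by rewrite !mem_set.
    by rewrite memNset //=; exact/negP.
  move=> s sw; case: ifP => // _; rewrite indicE memNset //=.
  by move=> E; move: sw; rewrite -E eqxx.
rewrite ge0_integral_sum //.
- apply: eq_bigr => s _; case: ifP => _; first by rewrite -ind.
  by rewrite integral0.
- move=> s; case: (Q s); last exact: measurable_cst.
  by apply/measurable_EFinP; exact: measurable_indic.
- by move=> s w _; case: ifP => // _; rewrite lee_fin indicE.
Qed.

End probabilities.

Section sampling.
Context {R : realType} {d : measure_display} {T : measurableType d}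
  (P : probability T R) (p : R) {n m b : nat}
  (I : nat -> T -> 'I_b -> 'I_n) (J : nat -> T -> 'I_b -> 'I_m)
  (cx cy cz : nat -> T -> bool) (past : nat -> set (set T)).
Hypothesis smp : spaba_sampling P p I J cx cy cz past.

Let Tp k := g_sigma_algebraType (past k).
Let coins k w := (cx k w, cy k w, cz k w).
Let S : finType :=
  ({ffun 'I_b -> 'I_n} * {ffun 'I_b -> 'I_m} * (bool * bool * bool))%type.

Definition batch k w : S :=
  ([ffun l => I k w l], [ffun l => J k w l], coins k w).

Lemma past_measurableE k (A : set T) : past k A -> measurable (A : set (Tp k)).
Proof.
by move=> pA; rewrite measurable_g_measurableTypeE //; exact: (ss_past_sigma smp).
Qed.

Lemma measurable_pastE k (A : set T) : measurable (A : set (Tp k)) -> past k A.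
Proof.
by rewrite measurable_g_measurableTypeE //; exact: (ss_past_sigma smp).
Qed.

Lemma past_coin k (c : nat -> T -> bool) t :
  (forall k, past k [set w | c k w]) ->
  measurable ([set w | c k w = t] : set (Tp k)).
Proof.
move=> pc; have mc := past_measurableE (pc k); case: t.
  by rewrite (_ : [set w | c k w = true] = [set w | c k w]).
rewrite (_ : [set w | c k w = false] = ~` [set w | c k w]).
  exact: measurableC.
by apply/seteqP; split => w /=; [move=> ->|move/negP/negbTE].
Qed.

Lemma batch_eq k (s : S) : [set w | batch k w = s] =
  [set w | forall l, I k w l = s.1.1 l] `&` [set w | forall l, J k w l = s.1.2 l]
    `&` [set w | coins k w = s.2].
Proof.
apply/seteqP; split => w /=.
  by rewrite /batch => <- /=; split=> //; split=> l; rewrite ffunE.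
move=> [[hI hJ] hc]; case: s hI hJ hc => [[i j] c] /= hI hJ <-.
by congr (_, _, _); apply/ffunP => l; rewrite ffunE.
Qed.

Lemma measurable_batch_past k (s : S) :
  measurable ([set w | batch k w = s] : set (Tp k)).
Proof.
rewrite batch_eq; apply: measurableI; first apply: measurableI.
- rewrite (_ : [set w | _] = \bigcap_(l in [set: 'I_b])
      [set w | I k w l = s.1.1 l]); last first.
    by apply/seteqP; split => w /= h l => [_|]; apply: h.
  apply: fin_bigcap_measurable => [|l _]; first exact: finite_finset.
  exact: (past_measurableE (ss_I_past smp k l (s.1.1 l))).
- rewrite (_ : [set w | _] = \bigcap_(l in [set: 'I_b])
      [set w | J k w l = s.1.2 l]); last first.
    by apply/seteqP; split => w /= h l => [_|]; apply: h.
  apply: fin_bigcap_measurable => [|l _]; first exact: finite_finset.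
  exact: (past_measurableE (ss_J_past smp k l (s.1.2 l))).
- case: s => [_ [[a1 a2] a3]] /=.
  rewrite (_ : [set w | _] = [set w | cx k w = a1] `&` [set w | cy k w = a2]
     `&` [set w | cz k w = a3]); last first.
    apply/seteqP; split => w /=; rewrite /coins; first by case=> -> -> ->.
    by case=> [[-> ->] ->].
  by apply: measurableI; [apply: measurableI|]; apply: past_coin;
    [exact: (ss_cx_past smp)|exact: (ss_cy_past smp)|exact: (ss_cz_past smp)].
Qed.

Lemma measurable_batch k (s : S) : measurable [set w | batch k w = s].
Proof.
have h := ss_past_measurable smp.
by apply: (h k); apply: measurable_pastE; exact: measurable_batch_past.
Qed.

Lemma measurable_coins k t : measurable [set w | coins k w = t].
Proof.
rewrite (_ : [set w | _] = \bigcup_(s in [set s : S | s.2 = t])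
    [set w | batch k w = s]); last first.
  apply/seteqP; split => [w wt|w [s /= st ws]]; last by rewrite -st -ws.
  by exists (batch k w).
apply: fin_bigcup_measurable => [|s _]; first exact: finite_finset.
exact: measurable_batch.
Qed.

Let rho k t : R := fine (P [set w | coins k w = t]).

Let rhoE k t : ((rho k t)%:E = P [set w | coins k w = t])%E.
Proof. by rewrite /rho fineK // fin_num_measure //; exact: measurable_coins. Qed.

(** The joint law of the three coins is free, so the probability of one coin is
    recovered by summing over the other two. *)
Lemma sum_rho (sel : bool * bool * bool -> bool) k :
  (P [set w | sel (coins k w)] = p%:E)%E ->
  \sum_(t | ~~ sel t) rho k t = 1 - p.
Proof.
move=> hp; apply: EFin_inj; rewrite -sumEFin.
under eq_bigr do rewrite rhoE.
rewrite -(@probability_select _ _ _ P _ (coins k) (fun t => ~~ sel t)); last first.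
  exact: measurable_coins.
rewrite (_ : [set w | _] = ~` [set w | sel (coins k w)]); last first.
  by apply/seteqP; split => w /=; move/negP.
have ms : measurable [set w | sel (coins k w)].
  rewrite (_ : [set w | _] = \bigcup_(t in [set t | sel t])
      [set w | coins k w = t]); last first.
    apply/seteqP; split => [w wt|w [t /= st wt]]; last by rewrite wt.
    by exists (coins k w).
  apply: fin_bigcup_measurable => [|t _]; first exact: finite_finset.
  exact: measurable_coins.
by rewrite probability_setC // hp.
Qed.

Let q k (s : S) : R := n%:R^-1 ^+ b * m%:R^-1 ^+ b * rho k s.2.

Lemma batch_independent k (s : S) (A : set T) : past k A ->
  (P (A `&` [set w | batch k.+1 w = s]) = P A * (q k.+1 s)%:E)%E.
Proof.
move=> pA; rewrite batch_eq !setIA (ss_indep smp _ _ _ pA) -rhoE /q.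
have cst (N : nat) (c : R) : (\big[*%E/1]_(l < N) c%:E = (c ^+ N)%:E)%E.
  by rewrite -(big_morph EFin EFinM (erefl _)) prodr_const card_ord.
under eq_bigr do rewrite (ss_I_unif smp).
under [X in (_ * X * _)%E]eq_bigr do rewrite (ss_J_unif smp).
by rewrite !cst !EFinM !muleA.
Qed.

Section estimator.
Context {dx dy e : nat} (F : 'I_n -> 'cV[R]_(dx + dy) -> R)
  (G : 'I_m -> 'cV[R]_(dx + dy) -> R)
  (D : ('cV[R]_(dx + dy) -> R) -> ('cV[R]_(dx + dy) -> R) ->
       'cV[R]_dx * 'cV[R]_dy * 'cV[R]_dy -> 'cV[R]_e)
  (A B : ('cV[R]_(dx + dy) -> R) ->
       'cV[R]_dx * 'cV[R]_dy * 'cV[R]_dy -> 'cV[R]_e)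
  (r Q : R) (parts : operator_parts F G D A B r Q).
Context (n0 : (0 < n)%N) (m0 : (0 < m)%N) (b0 : (0 < b)%N).
Context (sel : bool * bool * bool -> bool) (k : nat)
  (hsel : (P [set w | sel (coins k.+1 w)] = p%:E)%E).
Context (x x' : T -> 'cV[R]_dx) (y z y' z' : T -> 'cV[R]_dy) (v : T -> 'cV[R]_e).
Hypotheses (mx : measurable_vec (x : Tp k -> _))
  (my : measurable_vec (y : Tp k -> _)) (mz : measurable_vec (z : Tp k -> _))
  (mx' : measurable_vec (x' : Tp k -> _))
  (my' : measurable_vec (y' : Tp k -> _)) (mz' : measurable_vec (z' : Tp k -> _))
  (mv : measurable_vec (v : Tp k -> _)) (zr : forall w, enorm (z w) <= r).

Let Df u := D (avg F) (avg G) u.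
Let u w := (x w, y w, z w).
Let u' w := (x' w, y' w, z' w).
Let vnew w := page_step D F G (sel (coins k.+1 w)) (I k.+1 w) (J k.+1 w)
  (u' w) (u w) (v w).

Let ffunK' N N' (f : 'I_N -> 'I_N') : [ffun l => f l] = f :> ('I_N -> 'I_N').
Proof. by apply/funext => l; rewrite ffunE. Qed.

Let vnewE w : vnew w = page_step D F G (sel (batch k.+1 w).2)
  (batch k.+1 w).1.1 (batch k.+1 w).1.2 (u' w) (u w) (v w).
Proof. by rewrite /vnew /batch /= !ffunK'. Qed.

Lemma past_le j l (C : set T) : (j <= l)%N -> past j C -> past l C.
Proof.
move=> jl; rewrite -(subnKC jl); elim: (l - j)%N => [|N IH]; first by rewrite addn0.
by rewrite addnS => /IH; exact: (ss_past_mono smp).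
Qed.

Lemma measurable_fun_past_le {d' : measure_display} {V : measurableType d'} j l
    (f : T -> V) : (j <= l)%N ->
  measurable_fun [set: Tp j] f -> measurable_fun [set: Tp l] f.
Proof.
move=> jl mf _ C mC; apply: past_measurableE; apply: (past_le jl).
exact: (measurable_pastE (mf measurableT C mC)).
Qed.

Lemma measurable_vec_past_le {N} j l (f : T -> 'cV[R]_N) : (j <= l)%N ->
  measurable_vec (f : Tp j -> _) -> measurable_vec (f : Tp l -> _).
Proof. by move=> jl mf i; exact: (measurable_fun_past_le jl (mf i)). Qed.

(** The minibatches enter through finitely many values, on each of which the
    update is a measurable function of vectors known before. *)
Lemma measurable_estimator : measurable_vec (vnew : Tp k.+1 -> _).
Proof.
have h : vnew = fun w => (fun (s : S) w => page_step D F G (sel s.2) s.1.1 s.1.2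
    (u' w) (u w) (v w)) (batch k.+1 w) w by apply/funext => w; exact: vnewE.
rewrite h.
apply: (@measurable_vec_select _ _ (Tp k.+1) S e (batch k.+1)
  (fun (s : S) w => page_step D F G (sel s.2) s.1.1 s.1.2 (u' w) (u w) (v w))).
  exact: measurable_batch_past.
move=> s; apply: (measurable_vec_past_le (leqnSn k)).
exact: (measurable_page_step parts _ _ _ mx my mz mx' my' mz' mv).1.
Qed.

(** Conditionally on the past the minibatches are uniform, and only the coin
    outcomes without full evaluation, of total probability 1 - p, leave an
    error. *)
Lemma estimator_step :
  (\int[P]_w (enorm (vnew w - Df (u' w)) ^+ 2)%:E <=
   \int[P]_w ((1 - p) * (enorm (v w - Df (u w)) ^+ 2
      + b%:R^-1 * (Q * distU (u w) (u' w))))%:E)%E.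
Proof.
have pm := ss_past_measurable smp.
pose f (s : S) w := enorm (page_step D F G (sel s.2) s.1.1 s.1.2
    (u' w) (u w) (v w) - Df (u' w)) ^+ 2.
have mf s : measurable_fun [set: Tp k] (f s).
  have [m1 m2] := measurable_page_step parts (sel s.2) s.1.1 s.1.2
    mx my mz mx' my' mz' mv.
  exact: (measurable_enorm_sq (measurable_vecB m1 m2)).
have rho0 t : 0 <= rho k.+1 t by rewrite fine_ge0.
have q0 s : 0 <= q k.+1 s.
  by rewrite /q !mulr_ge0 ?exprn_ge0 ?invr_ge0.
have f0 s w : 0 <= f s w by exact: sqr_ge0.
have ie := @independent_expectation _ _ _ P (past k) (ss_past_sigma smp k)
  (pm k) S (batch k.+1) (q k.+1) f (@measurable_batch k.+1) q0
  (fun s C pC => batch_independent s pC) f0 mf.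
have -> : (\int[P]_w (enorm (vnew w - Df (u' w)) ^+ 2)%:E =
    \int[P]_w (\sum_s q k.+1 s * f s w)%:E)%E.
  by rewrite -ie; apply: eq_integral => w _; rewrite vnewE.
apply: ge0_le_integral => //.
- by move=> w _; rewrite lee_fin sumr_ge0 // => s _; rewrite mulr_ge0 ?sqr_ge0.
- have mfT s : measurable_fun [set: T] (fun w => q k.+1 s * f s w).
    apply: measurable_funM; first exact: measurable_cst.
    exact: (measurable_fun_sub_sigma (ss_past_sigma smp k) (pm k) (mf s)).
  apply/measurable_EFinP; exact: measurable_sum.
- have [_ mD] := measurable_page_step parts true
    ((fun=> Ordinal n0) : 'I_b -> _) (fun=> Ordinal m0) mx my mz mx my mz mv.
  have m1 := measurable_enorm_sq (measurable_vecB mv mD).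
  have m2 : measurable_fun [set: Tp k] (fun w => distU (u w) (u' w)).
    exact: (measurable_funD (measurable_funD
      (measurable_enorm_sq (measurable_vecB mx' mx))
      (measurable_enorm_sq (measurable_vecB my' my)))
      (measurable_enorm_sq (measurable_vecB mz' mz))).
  have m3 : measurable_fun [set: Tp k] (fun w => (1 - p) *
      (enorm (v w - Df (u w)) ^+ 2 + b%:R^-1 * (Q * distU (u w) (u' w)))).
    apply: measurable_funM; first exact: measurable_cst.
    apply: measurable_funD; first exact: m1.
    apply: measurable_funM; first exact: measurable_cst.
    by apply: measurable_funM => //; exact: measurable_cst.
  apply/measurable_EFinP.
  exact: (measurable_fun_sub_sigma (ss_past_sigma smp k) (pm k) m3).
move=> w _; rewrite lee_fin -(sum_rho hsel) mulr_suml.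
have -> : \sum_s q k.+1 s * f s w = \sum_t \sum_i \sum_j
    q k.+1 (i, j, t) * f (i, j, t) w.
  transitivity (\sum_ij \sum_t q k.+1 (ij, t) * f (ij, t) w).
    by rewrite pair_bigA /=; apply: eq_bigr => [[ij t]].
  rewrite exchange_big /=; apply: eq_bigr => t _.
  by rewrite pair_bigA /=; apply: eq_bigr => [[i j]].
rewrite [leRHS]big_mkcond /= ler_sum // => t _; case: ifP => st.
  have -> : \sum_i \sum_j q k.+1 (i, j, t) * f (i, j, t) w =
     rho k.+1 t * (n%:R^-1 ^+ b * m%:R^-1 ^+ b *
     \sum_(i : {ffun 'I_b -> 'I_n}) \sum_(j : {ffun 'I_b -> 'I_m})
       enorm (page_step D F G false i j (u' w) (u w) (v w) - Df (u' w)) ^+ 2).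
    rewrite !mulr_sumr; apply: eq_bigr => i _; rewrite !mulr_sumr.
    apply: eq_bigr => j _; rewrite /f /q /= (negbTE st).
    by rewrite [RHS]mulrA; congr (_ * _); rewrite mulrC.
  rewrite ler_wpM2l //.
  have nm : 0 < n%:R ^+ b * m%:R ^+ b :> R.
    by rewrite mulr_gt0 ?exprn_gt0 ?ltr0n.
  rewrite !exprVn -invfM mulrC ler_pdivrMr // [leRHS]mulrC.
  by apply: (page_error_mean parts n0 m0 b0); exact: zr.
rewrite big1 // => i _; rewrite big1 // => j _.
by rewrite /f /= (negbFE st) /page_step subrr enorm0 expr0n mulr0.
Qed.

End estimator.
End sampling.

(** * Expectations of nonnegative functions *)

Section nonneg_expectation.
Context {R : realType} {d : measure_display} {T : measurableType d}
  (P : probability T R).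
Implicit Type h : T -> R.

Definition nonneg_measurable h : Prop :=
  (forall w, 0 <= h w) /\ measurable_fun [set: T] h.

Definition mean h : \bar R := (\int[P]_w (h w)%:E)%E.

Lemma mean_ge0 h : (forall w, 0 <= h w) -> (0 <= mean h)%E.
Proof. by move=> h0; apply: integral_ge0 => w _; rewrite lee_fin. Qed.

Lemma nonneg_measurableD h h' : nonneg_measurable h -> nonneg_measurable h' ->
  nonneg_measurable (fun w => h w + h' w).
Proof.
move=> [h0 mh] [h0' mh']; split=> [w|]; first exact: addr_ge0.
exact: measurable_funD.
Qed.

Lemma nonneg_measurableZ c h : 0 <= c -> nonneg_measurable h ->
  nonneg_measurable (fun w => c * h w).
Proof.
move=> c0 [h0 mh]; split=> [w|]; first exact: mulr_ge0.
by apply: measurable_funM => //; exact: measurable_cst.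
Qed.

Lemma nonneg_measurable_cst c : 0 <= c -> nonneg_measurable (fun=> c).
Proof. by move=> c0; split=> // ; exact: measurable_cst. Qed.

Lemma meanD h h' : nonneg_measurable h -> nonneg_measurable h' ->
  (mean (fun w => (h w + h' w)%R) = mean h + mean h')%E.
Proof.
move=> [h0 mh] [h0' mh']; rewrite /mean; under eq_integral do rewrite EFinD.
rewrite ge0_integralD //; try (by move=> w _; rewrite lee_fin);
  exact/measurable_EFinP.
Qed.

Lemma meanZ c h : 0 <= c -> nonneg_measurable h ->
  (mean (fun w => (c * h w)%R) = c%:E * mean h)%E.
Proof.
move=> c0 [h0 mh]; rewrite /mean; under eq_integral do rewrite EFinM.
rewrite ge0_integralZl_EFin // => [w _|]; first by rewrite lee_fin.
exact/measurable_EFinP.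
Qed.

Lemma mean_le h h' : nonneg_measurable h -> measurable_fun [set: T] h' ->
  (forall w, h w <= h' w) -> (mean h <= mean h')%E.
Proof.
move=> [h0 mh] mh' hh; apply: ge0_le_integral => //; try exact/measurable_EFinP.
  by move=> w _; rewrite lee_fin.
by move=> w _; rewrite lee_fin.
Qed.

Lemma mean_cst c : (mean (fun=> c) = c%:E)%E.
Proof. by rewrite -(expectation_cst P c) unlock. Qed.

Lemma mean_sum (N : nat) (h : 'I_N -> T -> R) :
  (forall k, nonneg_measurable (h k)) ->
  (mean (fun w => (\sum_(k < N) h k w)%R) = \sum_(k < N) mean (h k))%E.
Proof.
move=> mh; rewrite /mean; under eq_integral do rewrite -sumEFin.
rewrite ge0_integral_sum // => k; first by apply/measurable_EFinP; case: (mh k).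
by move=> w _; rewrite lee_fin; case: (mh k).
Qed.

Lemma expectationE h : ('E_P[h] = mean h)%E.
Proof. by rewrite unlock. Qed.

End nonneg_expectation.

(** * The run of the method *)

Lemma telescope_le {R : realType} (u v : nat -> \bar R) (c : R) (K : nat) :
  (forall k, 0 <= v k)%E -> (forall k, u k.+1 + c%:E * v k <= u k)%E ->
  (u K + c%:E * \sum_(k < K) v k <= u 0%N)%E.
Proof.
move=> v0 hu; elim: K => [|K IH]; first by rewrite big_ord0 mule0 adde0.
apply: le_trans IH; rewrite big_ord_recr /= ge0_muleDr //; last first.
  exact: sume_ge0.
by rewrite addeA addeAC leeD2r.
Qed.

Lemma scaled_initial_bound {R : realType} (a q c k D : R) (S : \bar R) :
  (0 <= S)%E -> 0 < c -> q <= k * a -> (a%:E + c%:E * S = D%:E)%E ->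
  (q%:E + (k * c)%:E * S <= (k * D)%:E)%E.
Proof.
move=> S0 c0 qa; case: S S0 => [S|_|] //; last first.
  by rewrite gt0_muley ?lte_fin // addey.
move=> S0; rewrite -EFinM -EFinD => [[<-]].
by rewrite -EFinM -EFinD lee_fin mulrDr mulrA lerD2r.
Qed.

Lemma weighted_sum_le {R : realType} (k c h Y Z : R) : 1 <= k -> c <= 1 ->
  0 <= h -> 0 <= Y -> 0 <= Z -> h + c * (Y + Z) <= k * (h + Y + Z).
Proof.
move=> k1 c1 h0 Y0 Z0; have YZ0 : 0 <= Y + Z by exact: addr_ge0.
have h1 := ler_wpM2r YZ0 c1; have h2 := ler_wpM2r (addr_ge0 h0 YZ0) k1; lra.
Qed.

Lemma absorb_error {R : realType} (t t' q q' a S c k : R) : t <= t' ->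
  q' + t' + a <= q + k * S -> q' + ((c - k) * S + t) + a <= q + c * S.
Proof. lra. Qed.

Section run.
Context {R : realType} (Lf Cf L1 L2 mu : R).
Context (hLf : 0 <= Lf) (hCf : 0 <= Cf) (hL1 : 0 <= L1) (hL2 : 0 <= L2)
  (hmu : 0 < mu).
Context {dx dy n m b : nat} (F : 'I_n -> 'cV[R]_(dx + dy) -> R)
  (G : 'I_m -> 'cV[R]_(dx + dy) -> R).
Context (n0 : (0 < n)%N) (m0 : (0 < m)%N) (b0 : (0 < b)%N).
Hypothesis fsa : finite_sum_assumptions Lf Cf L1 L2 mu F G.

Let f := avg F.
Let g := avg G.
Let r := Cf / mu.
Let M := spaba_const Lf Cf L1 L2 mu.
Let Q := qlip Lf L1 L2 r.
Let H := hyperobj f g.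

Let r0 : 0 <= r. Proof. by rewrite divr_ge0 // ltW. Qed.
Let lf : lipschitz_grad Lf f := fsa_f_grad fsa.
Let bf := fsa_f_bound fsa.
Let l1 : lipschitz_grad L1 g := fsa_g_grad fsa.
Let l2 : lipschitz_hess L2 g := fsa_g_hess fsa.
Let sc := fsa_g_convex fsa.

Let px := Dx_parts hLf hL1 hL2 r0 (fsa_F_grad fsa) (fsa_G_grad fsa) (fsa_G_hess fsa).
Let py := Dy_parts F Lf L2 r hL1 (fsa_G_grad fsa).
Let pz := Dz_parts hLf hL1 hL2 r0 (fsa_F_grad fsa) (fsa_G_grad fsa) (fsa_G_hess fsa).

Lemma continuous_hyperobj : continuous H.
Proof.
apply: continuous_of_enorm_bound => x.
have Hl0 := Hlip_ge0 L1 hLf hCf hL2 hmu.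
exists (enorm (hypergrad f g x) + Hlip Lf Cf L1 L2 mu).
split; first by rewrite addr_ge0 ?enorm_ge0.
move=> v; have := hyperobj_increment hLf hL1 hL2 hmu lf bf l1 l2 sc x v.
have := dotv_CS (hypergrad f g x) (v - x).
rewrite -/H; set N := enorm (v - x); set D := dotv _ _.
set k := enorm _; set K := Hlip _ _ _ _ _ => h1 h2.
have N0 : 0 <= N := enorm_ge0 _. have k0 : 0 <= k := enorm_ge0 _.
have K0 : 0 <= K := Hl0.
have := mulr_ge0 K0 N0; have := mulr_ge0 k0 (sqr_ge0 N).
have := ler_normD (H v - H x - D) D; rewrite subrK; move: h1 h2.
by lra.
Qed.

Section measurable_potential.
Context {d : measure_display} {T : measurableType d}
  (x : T -> 'cV[R]_dx) (y z : T -> 'cV[R]_dy).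
Hypotheses (mx : measurable_vec x) (my : measurable_vec y)
  (mz : measurable_vec z).

Lemma measurable_ystar : measurable_vec (fun w => ystar g (x w)).
Proof.
apply: measurable_vec_continuous mx => i.
apply: (@continuous_of_sq_lipschitz _ _ _ (ylip2 Q mu)); first exact: ylip2_ge0.
by move=> u v; exact: (ystar_increment Lf Cf L2 f hL1 hmu l1 sc).
Qed.

Lemma measurable_zstar : measurable_vec (fun w => zstar f g (x w)).
Proof.
apply: measurable_vec_continuous mx => i.
apply: (@continuous_of_sq_lipschitz _ _ _ (zlip2 Q mu)); first exact: zlip2_ge0.
by move=> u v; exact: (zstar_increment hLf hCf hL1 hL2 hmu lf bf l1 l2 sc).
Qed.

Lemma potential_nonneg_measurable :
  nonneg_measurable (fun w => potential Lf Cf L1 L2 mu f g (x w) (y w) (z w)).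
Proof.
have w0 : 0 <= weight_yz M.
  have [M3 _ _ _ _] := spaba_const_ge L1 hLf hCf hL2 hmu.
  by rewrite invr_ge0 mulr_ge0 //; apply: le_trans M3.
split=> [w|].
  rewrite addr_ge0 //; last by rewrite mulr_ge0 // addr_ge0 ?sqr_ge0.
  by rewrite subr_ge0; apply: ge_inf; [exact: (fsa_H_lbound fsa)|exists (x w)].
apply: measurable_funD.
  apply: measurable_funB; last exact: measurable_cst.
  exact: (measurable_continuous_vec continuous_hyperobj mx).
apply: measurable_funM; first exact: measurable_cst.
apply: measurable_funD; apply: measurable_enorm_sq; apply: measurable_vecB => //.
  exact: measurable_ystar.
exact: measurable_zstar.
Qed.

Lemma hypergrad_nonneg_measurable :
  nonneg_measurable (fun w => enorm (grad H (x w)) ^+ 2).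
Proof.
split=> [w|]; first exact: sqr_ge0.
apply: measurable_enorm_sq.
have -> : (fun w => grad H (x w)) = (fun w => Dx f g (x w) (ystar g (x w))
    (zstar f g (x w))).
  apply/funext => w.
  exact: (grad_hyperobj hLf hCf hL1 hL2 hmu lf bf l1 l2 sc).
have [_] := measurable_page_step px true ((fun=> Ordinal n0) : 'I_b -> _)
  (fun=> Ordinal m0) mx my mz mx measurable_ystar measurable_zstar mx.
by [].
Qed.

Lemma error_nonneg_measurable {e : nat} (v : T -> 'cV[R]_e) D A B c :
  operator_parts F G D A B r c -> measurable_vec v ->
  nonneg_measurable (fun w => enorm (v w - D f g (x w, y w, z w)) ^+ 2).
Proof.
move=> parts mv; split=> [w|]; first exact: sqr_ge0.
have [_ mD] := measurable_page_step parts true ((fun=> Ordinal n0) : 'I_b -> _)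
  (fun=> Ordinal m0) mx my mz mx my mz mv.
exact: (measurable_enorm_sq (measurable_vecB mv mD)).
Qed.

End measurable_potential.

Let p : R := b%:R / (n + m + b)%:R.
Context (alpha : R) (ha : 0 < alpha <= step_x M).
Let s := (1 - p) / (p * b%:R).
Hypothesis has : alpha ^+ 2 * s <= step_x M ^+ 2.

Context {d : measure_display} {T : measurableType d} (P : probability T R)
  (I : nat -> T -> 'I_b -> 'I_n) (J : nat -> T -> 'I_b -> 'I_m)
  (cx cy cz : nat -> T -> bool) (past : nat -> set (set T))
  (x0 : 'cV[R]_dx) (y0 z0 : 'cV[R]_dy)
  (x : nat -> T -> 'cV[R]_dx) (y z : nat -> T -> 'cV[R]_dy)
  (vx : nat -> T -> 'cV[R]_dx) (vy vz : nat -> T -> 'cV[R]_dy).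
Hypothesis smp : spaba_sampling P p I J cx cy cz past.
Hypothesis rn : spaba_run F G r (fun=> alpha) (fun=> step_y M * alpha)
  (fun=> step_z M * alpha) x0 y0 z0 I J cx cy cz past x y z vx vy vz.

Let Tp k := g_sigma_algebraType (past k).

Lemma z_in_ball k w : enorm (z k w) <= r.
Proof.
case: k => [|k]; first by rewrite (sr_z0 rn); exact: (sr_z0_ball rn).
by rewrite (sr_z rn); exact: enorm_proj_ball.
Qed.

Definition known k : Prop :=
  [/\ measurable_vec (x k : Tp k -> _), measurable_vec (y k : Tp k -> _),
      measurable_vec (z k : Tp k -> _) &
  [/\ measurable_vec (vx k : Tp k -> _), measurable_vec (vy k : Tp k -> _) &
      measurable_vec (vz k : Tp k -> _)]].

Lemma next_known k : known k ->
  [/\ measurable_vec (x k.+1 : Tp k -> _), measurable_vec (y k.+1 : Tp k -> _) &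
      measurable_vec (z k.+1 : Tp k -> _)].
Proof.
move=> [mx my mz [mvx mvy mvz]]; split.
- have -> : x k.+1 = fun w => x k w - alpha *: vx k w.
    by apply/funext => w; exact: (sr_x rn).
  by apply: measurable_vecB => //; exact: measurable_vecZ.
- have -> : y k.+1 = fun w => y k w - (step_y M * alpha) *: vy k w.
    by apply/funext => w; exact: (sr_y rn).
  by apply: measurable_vecB => //; exact: measurable_vecZ.
- have -> : z k.+1 = fun w => proj_ball r (z k w - (step_z M * alpha) *: vz k w).
    by apply/funext => w; exact: (sr_z rn).
  apply: measurable_vec_continuous; last first.
    by apply: measurable_vecB => //; exact: measurable_vecZ.
  move=> i; apply: (@continuous_of_sq_lipschitz _ _ _ 1) => // u v.
  rewrite mul1r ler_sqr ?nnegrE ?enorm_ge0 //.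
  exact: proj_ball_nonexpansive.
Qed.

Lemma run_known k : known k.
Proof.
elim: k => [|k IH].
  have init e (v : T -> 'cV[R]_e) : (forall i (B : set R), measurable B ->
      past 0%N [set w | B (v w i ord0)]) -> measurable_vec (v : Tp 0%N -> _).
    move=> hv i _ B mB; rewrite setTI.
    exact: (past_measurableE smp (hv i B mB)).
  split; last by split; apply: init; [exact: (sr_vx0 rn)|exact: (sr_vy0 rn)|
    exact: (sr_vz0 rn)].
  - have -> : x 0%N = fun=> x0 by apply/funext => w; exact: (sr_x0 rn).
    exact: measurable_vec_cst.
  - have -> : y 0%N = fun=> y0 by apply/funext => w; exact: (sr_y0 rn).
    exact: measurable_vec_cst.
  - have -> : z 0%N = fun=> z0 by apply/funext => w; exact: (sr_z0 rn).
    exact: measurable_vec_cst.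
have [mx' my' mz'] := next_known IH.
have [mx my mz [mvx mvy mvz]] := IH.
have up e (v : T -> 'cV[R]_e) :
    measurable_vec (v : Tp k -> _) -> measurable_vec (v : Tp k.+1 -> _).
  exact: (measurable_vec_past_le smp (leqnSn k)).
split; [exact: up|exact: up|exact: up|split].
- have -> := funext (sr_vx rn k).
  exact: (measurable_estimator smp px (fun t => t.1.1) mx my mz mx' my' mz' mvx).
- have -> := funext (sr_vy rn k).
  exact: (measurable_estimator smp py (fun t => t.1.2) mx my mz mx' my' mz' mvy).
- have -> := funext (sr_vz rn k).
  exact: (measurable_estimator smp pz (fun t => t.2) mx my mz mx' my' mz' mvz).
Qed.

Lemma p_gt0 : 0 < p.
Proof. by rewrite divr_gt0 // ltr0n // addnC ltn_addr. Qed.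

Lemma p_le1 : p <= 1.
Proof.
by rewrite ler_pdivrMr ?mul1r ?ler_nat ?leq_addl // ltr0n addnC ltn_addr.
Qed.

Lemma known_measurable k :
  [/\ measurable_vec (x k), measurable_vec (y k), measurable_vec (z k) &
  [/\ measurable_vec (vx k), measurable_vec (vy k) & measurable_vec (vz k)]].
Proof.
have down e (v : T -> 'cV[R]_e) : measurable_vec (v : Tp k -> _) ->
    measurable_vec v.
  move=> mv i; apply: (measurable_fun_sub_sigma (ss_past_sigma smp k)).
    exact: (ss_past_measurable smp).
  exact: mv.
have [mx my mz [mvx mvy mvz]] := run_known k.
by split; [exact: down..|split; exact: down].
Qed.

Let Ex k w := enorm (vx k w - Dx f g (x k w) (y k w) (z k w)) ^+ 2.
Let Ey k w := enorm (vy k w - Dy f g (x k w) (y k w) (z k w)) ^+ 2.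
Let Ez k w := enorm (vz k w - Dz f g (x k w) (y k w) (z k w)) ^+ 2.
Let pot k w := potential Lf Cf L1 L2 mu f g (x k w) (y k w) (z k w).
Let A k w := enorm (grad H (x k w)) ^+ 2.
Let kap := weight_v M.
Let c1 := kap * alpha / p.
Let lyap k w := pot k w + c1 * (Ex k w + Ey k w + Ez k w).

Let M1 : 1 <= M.
Proof.
have [M3 _ _ _ _] := spaba_const_ge L1 hLf hCf hL2 hmu.
by apply: le_trans M3; rewrite ler1n.
Qed.

Let a0 : 0 < alpha. Proof. by case/andP: ha. Qed.
Let kap1 : 1 <= kap. Proof. by case: (weight_v_ge M1). Qed.
Let kap0 : 0 <= kap. Proof. exact: le_trans kap1. Qed.
Let c10 : 0 <= c1.
Proof. by rewrite divr_ge0 ?(ltW p_gt0) // mulr_ge0 // ltW. Qed.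
Let Q0 : 0 <= Q. Proof. exact: qlip_ge0. Qed.

Lemma nonneg_measurable_pot k : nonneg_measurable (pot k).
Proof.
have [mx my mz _] := known_measurable k.
exact: potential_nonneg_measurable.
Qed.

Lemma nonneg_measurable_sq_grad k : nonneg_measurable (A k).
Proof.
have [mx my mz _] := known_measurable k.
exact: (hypergrad_nonneg_measurable mx my mz).
Qed.

Lemma nonneg_measurable_errors k :
  [/\ nonneg_measurable (Ex k), nonneg_measurable (Ey k) &
  nonneg_measurable (Ez k)].
Proof.
have [mx my mz [mvx mvy mvz]] := known_measurable k.
split; [exact: (error_nonneg_measurable mx my mz px mvx)
       |exact: (error_nonneg_measurable mx my mz py mvy)
       |exact: (error_nonneg_measurable mx my mz pz mvz)].
Qed.

Lemma mean_lyap k : (mean P (lyap k) = mean P (pot k)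
  + c1%:E * (mean P (Ex k) + mean P (Ey k) + mean P (Ez k)))%E.
Proof.
have [ox oy oz] := nonneg_measurable_errors k; have oxy := nonneg_measurableD ox oy.
have oxyz := nonneg_measurableD oxy oz.
rewrite (meanD P (nonneg_measurable_pot k) (nonneg_measurableZ c10 oxyz)).
by rewrite (meanZ P c10 oxyz) (meanD P oxy oz) (meanD P ox oy).
Qed.

Lemma nonneg_measurable_lyap k : nonneg_measurable (lyap k).
Proof.
have [ox oy oz] := nonneg_measurable_errors k.
apply: nonneg_measurableD; first exact: nonneg_measurable_pot.
apply: nonneg_measurableZ => //.
by apply: nonneg_measurableD => //; apply: nonneg_measurableD.
Qed.

(** The estimator errors contract by the factor 1 - p in expectation while
    they feed on the motion of the iterates; the deterministic inequality
    pays for both. *)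
Lemma lyapunov_mean k :
  (mean P (lyap k.+1) + (alpha / 2)%:E * mean P (A k) <= mean P (lyap k))%E.
Proof.
have [mx my mz [mvx mvy mvz]] := run_known k.
have [mx' my' mz'] := next_known (run_known k).
have [ox oy oz] := nonneg_measurable_errors k.
have pg0 := p_gt0; have pl1 := p_le1.
pose N w := distU (x k w, y k w, z k w) (x k.+1 w, y k.+1 w, z k.+1 w).
pose a (E : T -> R) w := (1 - p) * (E w + b%:R^-1 * (Q * N w)).
have hx : (mean P (Ex k.+1) <= mean P (a (Ex k)))%E.
  have := estimator_step smp px n0 m0 b0 (sel := fun t => t.1.1)
    (ss_cx_law smp k.+1) mx my mz mx' my' mz' mvx (z_in_ball k).
  apply: le_trans; rewrite le_eqVlt; apply/orP; left; apply/eqP.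
  by apply: eq_integral => w _; rewrite /Ex (sr_vx rn).
have hy : (mean P (Ey k.+1) <= mean P (a (Ey k)))%E.
  have := estimator_step smp py n0 m0 b0 (sel := fun t => t.1.2)
    (ss_cy_law smp k.+1) mx my mz mx' my' mz' mvy (z_in_ball k).
  apply: le_trans; rewrite le_eqVlt; apply/orP; left; apply/eqP.
  by apply: eq_integral => w _; rewrite /Ey (sr_vy rn).
have hz : (mean P (Ez k.+1) <= mean P (a (Ez k)))%E.
  have := estimator_step smp pz n0 m0 b0 (sel := fun t => t.2)
    (ss_cz_law smp k.+1) mx my mz mx' my' mz' mvz (z_in_ball k).
  apply: le_trans; rewrite le_eqVlt; apply/orP; left; apply/eqP.
  by apply: eq_integral => w _; rewrite /Ez (sr_vz rn).
have oN : nonneg_measurable N.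
  have [tx ty tz _] := known_measurable k.
  have [tx' ty' tz' _] := known_measurable k.+1.
  split=> [w|]; first exact: dist3_ge0.
  exact: (measurable_funD (measurable_funD
      (measurable_enorm_sq (measurable_vecB tx' tx))
      (measurable_enorm_sq (measurable_vecB ty' ty)))
      (measurable_enorm_sq (measurable_vecB tz' tz))).
have oa E : nonneg_measurable E -> nonneg_measurable (a E).
  move=> oE; apply: nonneg_measurableZ; first by rewrite subr_ge0.
  apply: nonneg_measurableD => //.
  by apply: nonneg_measurableZ; [rewrite invr_ge0|apply: nonneg_measurableZ].
have oax := oa _ ox; have oay := oa _ oy; have oaz := oa _ oz.
have oaxy := nonneg_measurableD oax oay.
have oaxyz := nonneg_measurableD oaxy oaz.
have osum := nonneg_measurableD (nonneg_measurable_pot k.+1)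
  (nonneg_measurableZ c10 oaxyz).
have al2 : 0 <= alpha / 2 by rewrite divr_ge0 // ltW.
have oA2 := nonneg_measurableZ al2 (nonneg_measurable_sq_grad k).
apply: (@le_trans _ _ (mean P (fun w => (pot k.+1 w
   + c1 * (a (Ex k) w + a (Ey k) w + a (Ez k) w) + alpha / 2 * A k w)%R))).
  rewrite (meanD P osum oA2) (meanZ P al2 (nonneg_measurable_sq_grad k)).
  rewrite (meanD P (nonneg_measurable_pot k.+1) (nonneg_measurableZ c10 oaxyz)).
  rewrite (meanZ P c10 oaxyz) (meanD P oaxy oaz) (meanD P oax oay) mean_lyap.
  apply: leeD => //; apply: leeD => //; apply: lee_wpmul2l => //.
  exact: (leeD (leeD hx hy) hz).
apply: mean_le; first exact: (nonneg_measurableD osum oA2).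
  by case: (nonneg_measurable_lyap k).
move=> w.
have s0 : 0 <= s by rewrite divr_ge0 ?subr_ge0 // mulr_ge0 // ltW.
have := lyapunov_step hLf hCf hL1 hL2 hmu lf bf l1 l2 sc ha s0 has
  (z_in_ball k w) (sr_x rn k w) (sr_y rn k w) (sr_z rn k w).
rewrite -/M -/kap -/(Ex k w) -/(Ey k w) -/(Ez k w) -/(pot k w) -/(pot k.+1 w).
rewrite -/(A k w) -/(N w) /lyap /a.
have NM : 3 * kap * Q * alpha * s * N w <= 3 * kap * M * alpha * s * N w.
  have [_ MQ _ _ _] := spaba_const_ge L1 hLf hCf hL2 hmu.
  have QM : Q <= M by apply: le_trans MQ; rewrite -/Q; have := Q0; lra.
  have N0 : 0 <= N w by case: oN.
  rewrite ler_wpM2r // ler_wpM2r // ler_wpM2r ?(ltW a0) // ler_wpM2l //.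
  by rewrite mulr_ge0.
have e1 : c1 * (1 - p) * (3 * (b%:R^-1 * (Q * N w))) = 3 * kap * Q * alpha * s * N w.
  have bn : b%:R != 0 :> R by rewrite pnatr_eq0 -lt0n.
  have pn : p != 0 by rewrite gt_eqF.
  by rewrite /c1 /s; field; rewrite ?bn ?pn.
have e2 : c1 * (1 - p) = c1 - kap * alpha.
  by rewrite /c1; field; rewrite gt_eqF.
have e3 : c1 * ((1 - p) * (Ex k w + b%:R^-1 * (Q * N w)) +
     (1 - p) * (Ey k w + b%:R^-1 * (Q * N w)) +
     (1 - p) * (Ez k w + b%:R^-1 * (Q * N w))) =
   (c1 - kap * alpha) * (Ex k w + Ey k w + Ez k w)
   + 3 * kap * Q * alpha * s * N w.
  by rewrite -e1 -e2; ring.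
rewrite e3; exact: absorb_error NM.
Qed.

Lemma lyapunov_telescope K :
  (mean P (lyap K) + (alpha / 2)%:E * \sum_(k < K) mean P (A k)
     <= mean P (lyap 0%N))%E.
Proof.
apply: (@telescope_le _ (fun k => mean P (lyap k)) (fun k => mean P (A k))).
  by move=> k; apply: mean_ge0 => w; exact: sqr_ge0.
exact: lyapunov_mean.
Qed.

(** A finite initial value forces the initial estimator errors to have finite
    expectation. *)
Lemma lyapunov_initial Delta :
  initial_value P p alpha f g x0 y0 z0 (vx 0%N) (vy 0%N) (vz 0%N) = Delta%:E ->
  (mean P (lyap 0%N) <= (kap * Delta)%:E)%E.
Proof.
have ex : Ex 0%N = fun w => enorm (vx 0%N w - Dx f g x0 y0 z0) ^+ 2.
  by apply/funext => w; rewrite /Ex (sr_x0 rn) (sr_y0 rn) (sr_z0 rn).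
have ey : Ey 0%N = fun w => enorm (vy 0%N w - Dy f g x0 y0 z0) ^+ 2.
  by apply/funext => w; rewrite /Ey (sr_x0 rn) (sr_y0 rn) (sr_z0 rn).
have ez : Ez 0%N = fun w => enorm (vz 0%N w - Dz f g x0 y0 z0) ^+ 2.
  by apply/funext => w; rewrite /Ez (sr_x0 rn) (sr_y0 rn) (sr_z0 rn).
have ep : pot 0%N = fun=> potential Lf Cf L1 L2 mu f g x0 y0 z0.
  by apply/funext => w; rewrite /pot (sr_x0 rn) (sr_y0 rn) (sr_z0 rn).
rewrite mean_lyap ep mean_cst /initial_value !expectationE -ex -ey -ez.
have S0 : (0 <= mean P (Ex 0%N) + mean P (Ey 0%N) + mean P (Ez 0%N))%E.
  have [[ex0 _] [ey0 _] [ez0 _]] := nonneg_measurable_errors 0%N.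
  exact: (adde_ge0 (adde_ge0 (mean_ge0 P ex0) (mean_ge0 P ey0)) (mean_ge0 P ez0)).
have -> : c1 = kap * (alpha / p) by rewrite /c1 mulrA.
apply: (scaled_initial_bound S0 (divr_gt0 a0 p_gt0)).
have w1 : weight_yz M <= 1.
  have M1' : 1 <= M := M1.
  by rewrite invf_le1; lra.
have H0 : 0 <= hyperobj f g x0 - inf (range (hyperobj f g)).
  by rewrite subr_ge0; apply: ge_inf; [exact: (fsa_H_lbound fsa)|exists x0].
have Y0 := sqr_ge0 (enorm (y0 - ystar g x0)).
have Z0 := sqr_ge0 (enorm (z0 - zstar f g x0)).
exact: weighted_sum_le kap1 w1 H0 Y0 Z0.
Qed.

Lemma stationarity Delta K : (0 < K)%N ->
  initial_value P p alpha f g x0 y0 z0 (vx 0%N) (vy 0%N) (vz 0%N) = Delta%:E ->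
  ((K%:R^-1)%:E * \sum_(k < K) 'E_P[A k]
     <= (K%:R^-1 * (2 * kap * Delta / alpha))%:E)%E.
Proof.
move=> K0 /lyapunov_initial h0; rewrite EFinM; apply: lee_wpmul2l.
  by rewrite lee_fin invr_ge0.
under eq_bigr do rewrite expectationE.
have := le_trans (lyapunov_telescope K) h0.
move=> /(le_trans (leeDr _ (mean_ge0 P (nonneg_measurable_lyap K).1))).
rewrite -lee_pdivlMl ?divr_gt0 // -EFinM => h.
apply: le_trans h _; rewrite lee_fin le_eqVlt; apply/orP; left; apply/eqP.
by field; rewrite gt_eqF // a0.
Qed.

(** The choice of p balances the two branches: p (n + m) is at most b. *)
Lemma coin_cost (c : nat -> T -> bool) k : measurable [set w | c k w] ->
  (P [set w | c k w] = p%:E)%E ->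
  nonneg_measurable (fun w => (if c k w then (n + m)%N else b)%:R : R) /\
  (mean P (fun w => ((if c k w then (n + m)%N else b)%:R)%R)
     <= (2 * b%:R)%:E)%E.
Proof.
move=> mc hc.
have oI : nonneg_measurable (\1_[set w | c k w] : T -> R).
  by split=> [w|]; [rewrite indicE|exact: measurable_indic].
have nm0 : 0 <= (n + m)%:R :> R by [].
have bb0 : 0 <= b%:R :> R by [].
have mcb t : measurable [set w | c k w = t].
  case: t; first by rewrite (_ : [set w | c k w = true] = [set w | c k w]).
  rewrite (_ : [set w | c k w = false] = ~` [set w | c k w]).
    exact: measurableC.
  by apply/seteqP; split => w /=; [move=> ->|move/negP/negbTE].
have oc : nonneg_measurable (fun w => (if c k w then (n + m)%N else b)%:R : R).
  split=> [w|]; first by [].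
  apply: (measurable_select (xi := c k)
    (f := fun t (_ : T) => (if t then (n + m)%N else b)%:R) mcb) => t.
  exact: measurable_cst.
split=> //.
have oN := nonneg_measurableZ nm0 oI.
have oS := nonneg_measurableD (nonneg_measurable_cst bb0) oN.
apply: (@le_trans _ _ (mean P
    (fun w => (b%:R + (n + m)%:R * \1_[set w | c k w] w)%R))).
  apply: mean_le => //; first by case: oS.
  move=> w; rewrite indicE; case: ifP => cw.
    by rewrite mem_set // mulr1 lerDr.
  by rewrite lerDl mulr_ge0.
rewrite (meanD P (nonneg_measurable_cst bb0) oN) mean_cst (meanZ P nm0 oI).
have -> : mean P \1_[set w | c k w] = p%:E.
  by rewrite -hc -(expectation_indic P mc) unlock.
rewrite -EFinM -EFinD lee_fin mulr_natl mulr2n.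
rewrite lerD2l /p mulrA ler_pdivrMr; last by rewrite ltr0n addnC ltn_addr.
by rewrite mulrC -!natrM ler_nat leq_mul2l leq_addr orbT.
Qed.

Lemma sample_count_mean K :
  ('E_P[sample_count R n m b cx cy cz K] <= (6 * b%:R * K%:R)%:E)%E.
Proof.
have past_meas k (B : set T) : past k B -> measurable B.
  exact: (ss_past_measurable smp).
have hx k := coin_cost (past_meas k _ (ss_cx_past smp k)) (ss_cx_law smp k).
have hy k := coin_cost (past_meas k _ (ss_cy_past smp k)) (ss_cy_law smp k).
have hz k := coin_cost (past_meas k _ (ss_cz_past smp k)) (ss_cz_law smp k).
pose cost (c : bool) : R := (if c then (n + m)%N else b)%:R.
have oxy k := nonneg_measurableD (hx k).1 (hy k).1.
have oxyz k := nonneg_measurableD (oxy k) (hz k).1.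
have -> : ('E_P[sample_count R n m b cx cy cz K] =
   mean P (fun w => (\sum_(k < K)
     (cost (cx k w) + cost (cy k w) + cost (cz k w)))%R))%E.
  rewrite expectationE; congr (mean P _); apply/funext => w.
  by rewrite /sample_count natr_sum; apply: eq_bigr => k _; rewrite !natrD.
rewrite (mean_sum P (h := fun k w => cost (cx k w) + cost (cy k w) + cost (cz k w)));
  last by move=> k; exact: oxyz.
apply: (@le_trans _ _ (\sum_(k < K) (6 * b%:R)%:E)%E).
  apply: lee_sum => k _.
  rewrite (meanD P (oxy k) (hz k).1) (meanD P (hx k).1 (hy k).1).
  apply: le_trans (leeD (leeD (hx k).2 (hy k).2) (hz k).2) _.
  by rewrite -!EFinD lee_fin; lra.
by rewrite sumEFin sumr_const card_ord lee_fin (mulr_natr (6 * b%:R) K).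
Qed.

End run.

(** * Complexity *)

Lemma step_ratio {R : realType} (n m b : nat) :
  (0 < n)%N -> (0 < m)%N -> (0 < b)%N ->
  let p : R := b%:R / (n + m + b)%:R in
  Num.sqrt ((1 - p) / (p * b%:R)) = Num.sqrt (n + m)%:R / b%:R.
Proof.
move=> n0 m0 b0 p.
have bn : b%:R != 0 :> R by rewrite pnatr_eq0 -lt0n.
have nn : (n + m + b)%:R != 0 :> R.
  by rewrite pnatr_eq0 -lt0n addnC ltn_addr.
have -> : (1 - p) / (p * b%:R) = (Num.sqrt (n + m)%:R / b%:R) ^+ 2.
  rewrite expr_div_n sqr_sqrtr ?ler0n // /p.
  by rewrite !natrD in nn *; field; rewrite ?bn ?nn.
by rewrite sqrtr_sqr ger0_norm // divr_ge0 ?sqrtr_ge0 ?ler0n.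
Qed.

(** Here b / a = (b + S) / c <= 2 S / c, so that the minibatch size cancels in
    the product of the number of iterations with the cost of one. The rounding
    up of K costs b <= S / eps because eps is at most one. *)
Lemma iteration_count {R : realType} (a eps S b c D : R) :
  0 < eps <= 1 -> 0 < c -> 0 < b -> b <= S -> 0 <= D ->
  a = c / (1 + S / b) ->
  exists K : nat, [/\ (0 < K)%N, K%:R^-1 * (2 * D / a) <= eps &
    6 * b * K%:R <= 6 * (1 + 4 * D / c) * S * eps^-1].
Proof.
move=> /andP[e0 e1] c0 b0 bS D0 ->.
have S0 : 0 < S by exact: lt_le_trans bS.
have q0 : 0 < 1 + S / b by rewrite addr_gt0 // divr_gt0.
set a' := c / _.
have a0 : 0 < a' by rewrite divr_gt0.
pose X := 2 * D / a' / eps.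
have X0 : 0 <= X by rewrite !divr_ge0 ?mulr_ge0 // ltW.
exists (Num.truncn X).+1; split=> //.
- rewrite mulrC ler_pdivrMr ?ltr0Sn // [leRHS]mulrC -ler_pdivrMr //.
  by apply: ltW; exact: truncnS_gt.
have KX : (Num.truncn X).+1%:R <= X + 1.
  by rewrite -natr1 lerD2r truncn_le.
have bX : b * X = 2 * D * (b + S) / c / eps.
  rewrite /X /a'; field; rewrite ?(gt_eqF e0) ?(gt_eqF c0) ?(gt_eqF b0) //.
  by rewrite gt_eqF // addr_gt0.
have h1 : b * X <= 4 * D / c * S * eps^-1.
  rewrite bX; have -> : 4 * D / c * S * eps^-1 = 2 * D * (2 * S) / c / eps by ring.
  rewrite ler_wpM2r ?invr_ge0 ?(ltW e0) // ler_wpM2r ?invr_ge0 ?(ltW c0) //.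
  by rewrite ler_wpM2l ?mulr_ge0 // mulr_natl mulr2n lerD2r.
have h2 : b <= S * eps^-1.
  apply: le_trans bS _; rewrite ler_peMr ?(ltW S0) // -[eps^-1]div1r.
  by rewrite ler_pdivlMr // mul1r.
have h3 := ler_wpM2l (ltW b0) KX; lra.
Qed.

Theorem corollaryF6 (R : realType) (Lf Cf L1g L2g mu : R)
    (hLf : 0 <= Lf) (hCf : 0 <= Cf) (hL1g : 0 <= L1g) (hL2g : 0 <= L2g)
    (hmu : 0 < mu) :
  exists c cbeta cgamma : R, [/\ 0 < c, 0 < cbeta & 0 < cgamma] /\
  exists C : R -> R,
  forall (dx dy n m b : nat)
    (F : 'I_n -> 'cV[R]_(dx + dy) -> R) (G : 'I_m -> 'cV[R]_(dx + dy) -> R),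
  (0 < n)%N -> (0 < m)%N -> (0 < b)%N ->
  b%:R <= Num.sqrt (n + m)%:R :> R ->
  finite_sum_assumptions Lf Cf L1g L2g mu F G ->
  let p : R := b%:R / (n + m + b)%:R in
  let alpha (k : nat) : R := c / (1 + Num.sqrt ((1 - p) / (p * b%:R))) in
  let beta (k : nat) : R := cbeta * alpha k in
  let gamma (k : nat) : R := cgamma * alpha k in
  forall (d : measure_display) (T : measurableType d) (P : probability T R)
    (I : nat -> T -> 'I_b -> 'I_n) (J : nat -> T -> 'I_b -> 'I_m)
    (cx cy cz : nat -> T -> bool) (past : nat -> set (set T))
    (x0 : 'cV[R]_dx) (y0 z0 : 'cV[R]_dy)
    (x : nat -> T -> 'cV[R]_dx) (y z : nat -> T -> 'cV[R]_dy)
    (vx : nat -> T -> 'cV[R]_dx) (vy vz : nat -> T -> 'cV[R]_dy),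
  spaba_sampling P p I J cx cy cz past ->
  spaba_run F G (Cf / mu) alpha beta gamma x0 y0 z0
    I J cx cy cz past x y z vx vy vz ->
  forall Delta : R,
  initial_value P p (alpha 0%N) (avg F) (avg G) x0 y0 z0
    (vx 0%N) (vy 0%N) (vz 0%N) = Delta%:E ->
  forall eps : R, 0 < eps <= 1 ->
  exists K : nat, [/\ (0 < K)%N,
    ((K%:R^-1)%:E * \sum_(k < K)
       'E_P[fun w => (enorm (grad (hyperobj (avg F) (avg G)) (x k w)) ^+ 2)%R]
     <= eps%:E)%E &
    ('E_P[sample_count R n m b cx cy cz K]
     <= (C Delta * Num.sqrt (n + m)%:R * eps^-1)%:E)%E].
Proof.
set M := spaba_const Lf Cf L1g L2g mu.
have M1 : 1 <= M.
  have [M3 _ _ _ _] := spaba_const_ge L1g hLf hCf hL2g hmu.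
  by apply: le_trans M3; rewrite ler1n.
have [c0 _ _ _ _] := step_x_small M1.
have [kap1 _ _] := weight_v_ge M1.
exists (step_x M), (step_y M), (step_z M); split.
  by split=> //; apply: lt_le_trans ltr01 _; [exact: step_y_ge1|exact: step_z_ge1].
exists (fun D => 6 * (1 + 4 * (weight_v M * D) / step_x M)).
move=> dx dy n m b F G n0 m0 b0 bS fsa p alpha beta gamma d T P I J cx cy cz past
  x0 y0 z0 x y z vx vy vz smp rn D hD eps heps.
have bp : 0 < b%:R :> R by rewrite ltr0n.
have sr : Num.sqrt ((1 - p) / (p * b%:R)) = Num.sqrt (n + m)%:R / b%:R.
  exact: step_ratio.
pose s := (1 - p) / (p * b%:R).
have s0 : 0 <= s.
  have p1 : p <= 1 by exact: p_le1.
  have pg : 0 < p by exact: p_gt0.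
  by rewrite divr_ge0 ?subr_ge0 // mulr_ge0 // ltW.
pose a := step_x M / (1 + Num.sqrt s).
have q0 : 0 < 1 + Num.sqrt s by rewrite ltr_pwDl // sqrtr_ge0.
have ha : 0 < a <= step_x M.
  rewrite divr_gt0 //= ler_pdivrMr // ler_peMr ?(ltW c0) //.
  by rewrite lerDl sqrtr_ge0.
have has : a ^+ 2 * s <= step_x M ^+ 2.
  rewrite expr_div_n mulrAC ler_pdivrMr ?exprn_gt0 // ler_wpM2l ?sqr_ge0 //.
  rewrite -{1}(sqr_sqrtr s0) ler_sqr ?nnegrE ?sqrtr_ge0 ?(ltW q0) //.
  by rewrite lerDr.
have D0 : 0 <= weight_v M * D.
  rewrite -lee_fin.
  apply: le_trans (lyapunov_initial hLf hCf hL1g hL2g hmu n0 m0 b0 fsa ha smp rn hD).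
  apply: mean_ge0 => w.
  exact: (nonneg_measurable_lyap hLf hCf hL1g hL2g hmu n0 m0 b0 fsa ha smp rn 0%N).1.
have aE : a = step_x M / (1 + Num.sqrt (n + m)%:R / b%:R) by rewrite /a sr.
have [K [K0 hK hC]] := iteration_count heps c0 bp bS D0 aE.
exists K; split=> //.
  apply: le_trans (stationarity hLf hCf hL1g hL2g hmu n0 m0 b0 fsa ha has
    smp rn K0 hD) _.
  by rewrite lee_fin -[2 * _ * D]mulrA.
apply: le_trans (sample_count_mean b0 smp K) _.
by rewrite lee_fin.
Qed.
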